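(* Let $\mathbf{u}_0,\mathbf{b}_0\in\mathcal{V}$ satisfy $\mathcal{L}[\mathbf{u}_0]=\mathbf{b}_0$, assume $D(\mathcal{L})[\mathbf{u}_0]^{-1}$ exists and is bounded on $\mathcal{V}$, and let $R=C\epsilon^{5/2}/|||D(\mathcal{L})[\mathbf{u}_0]^{-1}|||$. Let $\mathbf{b}:[0,T]\to\mathcal{V}$ be continuously differentiable in $t$ with $\mathbf{b}(0)=\mathbf{b}_0$ and $\mathbf{b}(t)\in B\!\left(\mathbf{b}_0,\frac{R}{2|||D(\mathcal{L})[\mathbf{u}_0]^{-1}|||}\right)$ for all $t\in[0,T]$, and let $\mathbf{u}:[0,T]\to\mathcal{V}\cap B(\mathbf{u}_0,R)$ be the unique continuous path with $\mathcal{L}[\mathbf{u}(t)]=\mathbf{b}(t)$ for $t\in[0,T]$. Assume that $D(\mathcal{L})[\mathbf{u}]^{-1}$ exists (on $\mathcal{V}$) for all $\mathbf{u}\in\overline{B(\mathbf{u}_0,R)}$. Then the derivative $\frac{\partial\mathbf{u}(t,\mathbf{x})}{\partial t}$ belongs to $L^\infty(\Omega;\mathbb{R}^d)$, is continuous in $t$, and is related to the loading rate by $$D(\mathcal{L})[\mathbf{u}(t)]^{-1}\left(\frac{\partial\mathbf{b}(t)}{\partial t}\right)=\frac{\partial\mathbf{u}(t)}{\partial t},$$ and for $0<t<T$ the energy balance $$PD[\mathbf{u}(t)]-\int_\Omega\mathbf{u}(t)\cdot\mathbf{b}(t)\,d\mathbf{x}=PD[\mathbf{u}_0]-\int_\Omega\mathbf{u}_0\cdot\mathbf{b}_0\,d\mathbf{x}-\int_0^t\int_\Omega\mathbf{u}(\tau)\cdot\mathbf{b}_t(\tau)\,d\mathbf{x}\,d\tau$$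 holds, where $\mathbf{b}_t$ is the derivative of $\mathbf{b}(t)$.
   Context: Let $d\in\{2,3\}$ and let $\Omega\subset\mathbb{R}^d$ be a bounded domain (connected open set) satisfying the interior cone condition: there are $\lambda>0$, $\theta>0$ such that every $\mathbf{x}\in\Omega$ is the apex of a spherical cone contained in $\Omega$ of radius $\lambda$ and aperture angle $2\theta$ (with axis along some unit vector $\mathbf{e}_{\mathbf{x}}$). Fix $\epsilon>0$ and let $H_\epsilon(\mathbf{x})$ be the ball of radius $\epsilon$ centered at $\mathbf{x}$; $\omega_d$ is the volume of the unit ball of $\mathbb{R}^d$; $\mathbf{e}_{\mathbf{y}-\mathbf{x}}=(\mathbf{y}-\mathbf{x})/|\mathbf{y}-\mathbf{x}|$. $J$ is a non-negative bounded measurable function supported on $[0,1]$ and $J^\epsilon(r)=J(r/\epsilon)$. The function $g:\mathbb{R}\to\mathbb{R}$ is three times continuously differentiable, $g,g',g'',g'''$ are bounded, $g(0)=0$, $g(r)>0$ for $r\ne0$, $g$ is convex on $(r^e,r^c)$ with $r^e<0<r^c$ and concave outside this interval, has finite limits at $\pm\infty$, and $\max_r|g''(r)|=g''(0)$. The strain is $S(\mathbf{y},\mathbf{x},\mathbf{u})=\frac{\mathbf{u}(\mathbf{y})-\mathbf{u}(\mathbf{x})}{|\mathbf{y}-\mathbf{x}|}\cdot\mathbf{e}_{\mathbf{y}-\mathbf{x}}$. The force operator is $$\mathcal{L}[\mathbf{u}](\mathbf{x})=-\int_{H_\epsilon(\mathbf{x})\cap\Omega}\frac{2J^\epsilon(|\mathbf{y}-\mathbf{x}|)}{\epsilon^{d+1}\omega_d\sqrt{|\mathbf{y}-\mathbf{x}|}}\,g'\!\left(\sqrt{|\mathbf{y}-\mathbf{x}|}\,S(\mathbf{y},\mathbf{x},\mathbf{u})\right)\mathbf{e}_{\mathbf{y}-\mathbf{x}}\,d\mathbf{y},$$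 its Fréchet derivative is $$D(\mathcal{L})[\mathbf{u}]\Delta\mathbf{u}(\mathbf{x})=-\int_{H_\epsilon(\mathbf{x})\cap\Omega}\frac{2J^\epsilon(|\mathbf{y}-\mathbf{x}|)}{\epsilon^{d+1}\omega_d}\,g''\!\left(\sqrt{|\mathbf{y}-\mathbf{x}|}\,S(\mathbf{y},\mathbf{x},\mathbf{u})\right)S(\mathbf{y},\mathbf{x},\Delta\mathbf{u})\,\mathbf{e}_{\mathbf{y}-\mathbf{x}}\,d\mathbf{y},$$ and the peridynamic energy is $$PD[\mathbf{u}]=\int_\Omega\int_{H_\epsilon(\mathbf{x})\cap\Omega}|\mathbf{y}-\mathbf{x}|\,\mathcal{W}^\epsilon(S(\mathbf{y},\mathbf{x},\mathbf{u}))\,d\mathbf{y}\,d\mathbf{x},\qquad \mathcal{W}^\epsilon(S(\mathbf{y},\mathbf{x},\mathbf{u}))=\frac{J^\epsilon(|\mathbf{y}-\mathbf{x}|)}{\epsilon^{d+1}\omega_d|\mathbf{y}-\mathbf{x}|}\,g\!\left(\sqrt{|\mathbf{y}-\mathbf{x}|}\,S(\mathbf{y},\mathbf{x},\mathbf{u})\right).$$ Let $\Pi=\{\mathbf{Q}\mathbf{x}+\mathbf{c}:\mathbf{Q}^T=-\mathbf{Q}\in\mathbb{R}^{d\times d},\ \mathbf{c}\in\mathbb{R}^d\}$ and $\mathcal{V}=\{\mathbf{u}\in L^\infty(\Omega;\mathbb{R}^d):\int_\Omega\mathbf{u}\cdot\mathbf{w}\,d\mathbf{x}=0\ \text{for all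 }\mathbf{w}\in\Pi\}$, with norm $\|\cdot\|_\infty$; $\mathcal{L}$ and $D(\mathcal{L})[\mathbf{u}]$ map $\mathcal{V}$ to $\mathcal{V}$. $B(\hat{\mathbf{u}},R)=\{\mathbf{u}:\|\mathbf{u}-\hat{\mathbf{u}}\|_\infty\le R\}$, and displacements in this ball are taken in $\mathcal{V}$. $|||D(\mathcal{L})[\mathbf{u}]^{-1}|||=\sup_{\mathbf{0}\ne\Delta\mathbf{u}\in\mathcal{V}}\|D(\mathcal{L})[\mathbf{u}]^{-1}\Delta\mathbf{u}\|_\infty/\|\Delta\mathbf{u}\|_\infty$. $C>0$ is a fixed constant, depending only on $d,g,J$, for which, for every $\mathbf{u}_0,\mathbf{b}_0$ as in the claim and every continuous $\mathbf{b}:[0,T]\to\mathcal{V}\cap B(\mathbf{b}_0,R/(2|||D(\mathcal{L})[\mathbf{u}_0]^{-1}|||))$, there is a unique continuous path $\mathbf{u}:[0,T]\to\mathcal{V}\cap B(\mathbf{u}_0,R)$ with $\mathcal{L}[\mathbf{u}(t)]=\mathbf{b}(t)$. Continuity and differentiability in $t$ are with respect to $\|\cdot\|_\infty$. *)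

(* Defs.v *)
From HB Require Import structures.
From mathcomp Require Import all_boot all_order all_algebra.
From mathcomp Require Import all_classical all_reals all_analysis.

Set Implicit Arguments.
Unset Strict Implicit.
Unset Printing Implicit Defensive.

Import Order.TTheory GRing.Theory Num.Theory.
Import numFieldNormedType.Exports.

Local Open Scope classical_set_scope.
Local Open Scope ring_scope.

(* Matrices carry the product sigma-algebra, which for real entries is the
   Borel sigma-algebra of their norm topology. *)
Definition coord_sets {R : realType} m n : set (set 'M[R]_(m, n)) :=
  [set A | exists i j (B : set (measurableTypeR R)),
    measurable B /\ A = [set M : 'M[R]_(m, n) | B (M i j)]].

Fact matrix_display : measure_display. Proof. exact. Qed.

HB.instance Definition _ (R : realType) m n :=
  @isMeasurable.Build matrix_display 'M[R]_(m, n) <<s @coord_sets R m n >>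
    (@sigma_algebra0 _ setT _) (@sigma_algebraC _ _)
    (@sigma_algebra_bigcup _ setT _).

Definition rV_cons {R : realType} n (p : measurableTypeR R * 'rV[R]_n) :
  'rV[R]_n.+1 := row_mx (p.1 : R)%:M p.2 : 'rV[R]_(1 + n).

Definition rV_uncons {R : realType} n (x : 'rV[R]_n.+1) :
  measurableTypeR R * 'rV[R]_n := (x ord0 ord0, @rsubmx R 1 1 n x).

(* Lebesgue measure on R^n: (lebesgue_measure) x (Lebesgue on R^(n-1)), the unit
   mass on the one-point space for n = 0. *)
Fixpoint lebesgue_rV (R : realType) (n : nat) : set 'rV[R]_n -> \bar R :=
  match n with
  | 0 => fun A => \d_(0 : 'rV[R]_0) A
  | k.+1 => fun A => (\int[@lebesgue_measure R]_t
      @lebesgue_rV R k [set y | A (rV_cons (t, y))])%E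
  end.

Lemma measurable_coord {R : realType} m n i j :
  measurable_fun setT (fun M : 'M[R]_(m, n) => M i j : measurableTypeR R).
Proof.
move=> _ B mB; rewrite setTI; apply: sub_sigma_algebra.
by exists i, j, B.
Qed.

Lemma measurable_matrixP {R : realType} d (T : measurableType d) m n (D : set T)
    (f : T -> 'M[R]_(m, n)) :
  (forall i j, measurable_fun D (fun t => f t i j : measurableTypeR R)) ->
  measurable_fun D f.
Proof.
move=> mf mD; apply: (@measurability _ _ _ _ D f (@coord_sets R m n)) => //.
by move=> _ [_ [i [j [B [mB ->]]]] <-]; exact: (mf i j).
Qed.

Lemma rV_cons0 {R : realType} n (p : measurableTypeR R * 'rV[R]_n) i :
  rV_cons p i ord0 = p.1.
Proof.
rewrite /rV_cons (_ : ord0 = lshift n (ord0 : 'I_1)); last exact: val_inj.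
by apply: etrans (row_mxEl _ _ _ _) _; rewrite (ord1 i) mxE eqxx mulr1n.
Qed.

Lemma rV_consS {R : realType} n (p : measurableTypeR R * 'rV[R]_n) i j :
  rV_cons p i (rshift 1 j) = p.2 i j.
Proof. exact: row_mxEr. Qed.

Lemma ord_consP n (j : 'I_n.+1) : j = ord0 \/ exists k : 'I_n, j = rshift 1 k.
Proof.
case: (unliftP ord0 j) => [k ->|->]; last by left.
by right; exists k; apply: val_inj.
Qed.

Lemma rV_unconsK {R : realType} n : cancel (@rV_uncons R n) (@rV_cons R n).
Proof.
move=> x; apply/rowP => j; have [->|[k ->]] := ord_consP j.
  by rewrite rV_cons0.
by rewrite rV_consS mxE.
Qed.

Lemma rV_consK {R : realType} n : cancel (@rV_cons R n) (@rV_uncons R n).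
Proof.
move=> [t y]; rewrite /rV_uncons rV_cons0; congr pair.
by apply/rowP => j; rewrite mxE rV_consS.
Qed.

Lemma measurable_rV_cons {R : realType} n : measurable_fun setT (@rV_cons R n).
Proof.
apply: measurable_matrixP => i j; have [->|[k ->]] := ord_consP j.
  rewrite [X in measurable_fun _ X](_ : _ = fst); first exact: measurable_fst.
  by apply/funext => p; rewrite rV_cons0.
rewrite [X in measurable_fun _ X](_ : _ = (fun M : 'rV[R]_n => M i k) \o snd).
  by apply: measurableT_comp; [exact: measurable_coord|exact: measurable_snd].
by apply/funext => p; rewrite rV_consS.
Qed.

Lemma measurable_rV_uncons {R : realType} n :
  measurable_fun setT (@rV_uncons R n).
Proof.
apply: measurable_fun_pair; first exact: measurable_coord.
apply: measurable_matrixP => i j.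
rewrite [X in measurable_fun _ X](_ : _ =
    fun M : 'rV[R]_n.+1 => M i (rshift 1 j)); first exact: measurable_coord.
by apply/funext => p; rewrite mxE.
Qed.

Lemma pushforward_sigma_finite d1 d2 (T1 : measurableType d1)
    (T2 : measurableType d2) (R : realType)
    (m : {sigma_finite_measure set T1 -> \bar R}) (f : T1 -> T2) (h : T2 -> T1) :
  measurable_fun setT f -> measurable_fun setT h -> cancel f h ->
  exists mu : {sigma_finite_measure set T2 -> \bar R},
    mu = pushforward m f :> (set T2 -> \bar R).
Proof.
move=> mf mh fK.
pose m0 : {measure set T2 -> \bar R} := pushforward m f.
pose m' := m0 mf.
have sf : sigma_finite setT m'.
  have [F FT Foo] := sigma_finiteT m.
  exists (fun k => h @^-1` F k); first by rewrite -preimage_bigcup -FT preimage_setT.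
  move=> k; have [mF Fk] := Foo k; split.
    by rewrite -[X in measurable X]setTI; exact: mh.
  rewrite /m' /= /pushforward -comp_preimage (_ : _ \o _ = idfun) ?preimage_id//.
  by apply/funext => p /=; rewrite fK.
pose H := @Measure_isSigmaFinite.Build _ _ _ m' sf.
pose m'' : {sigma_finite_measure set T2 -> \bar R} :=
  HB.pack_for (SigmaFiniteMeasure.type _ _) (Measure.sort m') H.
by exists m''.
Qed.

Lemma product_sigma_finite d1 d2 (T1 : measurableType d1)
    (T2 : measurableType d2) (R : realType)
    (m1 : {sigma_finite_measure set T1 -> \bar R})
    (m2 : {sigma_finite_measure set T2 -> \bar R}) :
  exists mu : {sigma_finite_measure set (T1 * T2)%type -> \bar R},
    mu = (m1 \x m2)%E :> (set (T1 * T2)%type -> \bar R).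
Proof.
pose p : {measure set (T1 * T2)%type -> \bar R} := (m1 \x m2)%E.
have sf : sigma_finite setT p.
  have /sigma_finiteP[F [TF ndF Foo]] := sigma_finiteT m1.
  have /sigma_finiteP[G [TG ndG Goo]] := sigma_finiteT m2.
  exists (fun n => F n `*` G n).
    rewrite -setXTT TF TG predeqE => -[x y]; split.
      move=> [/= [n _ Fnx] [k _ Gky]]; exists (maxn n k) => //; split.
      - by move: x Fnx; exact/subsetPset/ndF/leq_maxl.
      - by move: y Gky; exact/subsetPset/ndG/leq_maxr.
    by move=> [n _ []/= ? ?]; split; exists n.
  move=> k; have [? ?] := Foo k; have [? ?] := Goo k.
  split; first exact: measurableX.
  rewrite /p [ltLHS]product_measure1E//.
  by rewrite lte_mul_pinfty// ge0_fin_numE.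
pose H := @Measure_isSigmaFinite.Build _ _ _ p sf.
pose p' : {sigma_finite_measure set (T1 * T2)%type -> \bar R} :=
  HB.pack_for (SigmaFiniteMeasure.type _ _) (Measure.sort p) H.
by exists p'.
Qed.

Lemma lebesgue_rV_subproof (R : realType) n :
  exists mu : {sigma_finite_measure set 'rV[R]_n -> \bar R},
    mu = @lebesgue_rV R n :> (set 'rV[R]_n -> \bar R).
Proof.
elim: n => [|n [mu muE]]; first by exists (\d_(0 : 'rV[R]_0)).
have [prod prodE] := product_sigma_finite (@lebesgue_measure R) mu.
have [nu nuE] := pushforward_sigma_finite prod (@measurable_rV_cons R n)
  (@measurable_rV_uncons R n) (@rV_consK R n).
exists nu; rewrite nuE; apply/funext => A.
rewrite /pushforward prodE /product_measure1 /=.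
apply: eq_integral => t _ /=; rewrite muE; congr lebesgue_rV.
by apply/seteqP; split => y; rewrite /xsection /= inE.
Qed.

Lemma lebesgue_rV_set0 (R : realType) n : @lebesgue_rV R n set0 = 0%E.
Proof. by have [mu <-] := lebesgue_rV_subproof R n; rewrite measure0. Qed.

Lemma lebesgue_rV_ge0 (R : realType) n A : (0 <= @lebesgue_rV R n A)%E.
Proof. by have [mu <-] := lebesgue_rV_subproof R n; rewrite measure_ge0. Qed.

Lemma lebesgue_rV_sigma_additive (R : realType) n :
  semi_sigma_additive (@lebesgue_rV R n).
Proof.
have [mu <-] := lebesgue_rV_subproof R n.
exact: measure_semi_sigma_additive.
Qed.

HB.instance Definition _ (R : realType) n := isMeasure.Build _ _ _
  (@lebesgue_rV R n) (@lebesgue_rV_set0 R n) (@lebesgue_rV_ge0 R n)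
  (@lebesgue_rV_sigma_additive R n).

Lemma lebesgue_rV_sigma_finite (R : realType) n :
  sigma_finite setT (@lebesgue_rV R n).
Proof. by have [mu <-] := lebesgue_rV_subproof R n; exact: sigma_finiteT. Qed.

HB.instance Definition _ (R : realType) n := Measure_isSigmaFinite.Build _ _ _
  (@lebesgue_rV R n) (@lebesgue_rV_sigma_finite R n).

Section euclidean.
Context {R : realType} {d : nat}.
Implicit Types x y : 'rV[R]_d.

(* The library norm of 'rV[R]_d is the sup norm, hence a separate Euclidean
   norm; both induce the same topology and the same bounded sets. *)
Definition dotp x y : R := \sum_i x 0 i * y 0 i.

Definition enorm x : R := Num.sqrt (dotp x x).

Definition eball x (r : R) : set 'rV[R]_d := [set y | enorm (y - x) < r].

Definition unit_ball_volume : R := fine (@lebesgue_rV R d (eball 0 1)).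

Definition vintegral (D : set 'rV[R]_d) (F : 'rV[R]_d -> 'rV[R]_d) : 'rV[R]_d :=
  \row_i \int[@lebesgue_rV R d]_(y in D) F y 0 i.

(* A spherical cone with half-aperture theta: y - x makes an angle at most theta
   with the axis e. *)
Definition spherical_cone x e (lam theta : R) : set 'rV[R]_d :=
  [set y | enorm (y - x) <= lam /\
           enorm (y - x) * cos theta <= dotp (y - x) e].

Definition interior_cone (Om : set 'rV[R]_d) : Prop :=
  exists lam theta : R, [/\ 0 < lam, 0 < theta <= pi &
    forall x, Om x -> exists e, enorm e = 1 /\
      spherical_cone x e lam theta `<=` Om].

Definition cone_domain (Om : set 'rV[R]_d) : Prop :=
  [/\ open Om, connected Om, Om !=set0, bounded_set Om & interior_cone Om].

End euclidean.

Arguments unit_ball_volume R d : clear implicits.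

Section material.
Context {R : realType}.
Implicit Types g J : R -> R.

Record influence_function J : Prop := {
  influence_ge0 : forall r, 0 <= J r;
  influence_bounded : exists M, forall r, J r <= M;
  influence_measurable : measurable_fun setT (J : measurableTypeR R -> R);
  influence_support : forall r, ~ (0 <= r <= 1) -> J r = 0 }.

Record potential g : Prop := {
  potential_derivable :
    forall n, (n < 3)%N -> forall r, derivable (derive1n n g) r 1;
  potential_C3 : continuous (derive1n 3 g : R -> R);
  potential_bounded :
    forall n, (n <= 3)%N -> exists M, forall r, `|derive1n n g r| <= M;
  potential0 : g 0 = 0;
  potential_gt0 : forall r, r != 0 -> 0 < g r;
  potential_convex_concave : exists re rc : R,
    [/\ re < 0 < rc,
        convex_function (`]re, rc[%classic : set R^o) g,
        convex_function (`]-oo, re]%classic : set R^o) (\- g) &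
        convex_function (`[rc, +oo[%classic : set R^o) (\- g)];
  potential_limits :
    (exists l : R, g r @[r --> +oo] --> l) /\
    (exists l : R, g r @[r --> -oo] --> l);
  potential_max : forall r, `|derive1n 2 g r| <= derive1n 2 g 0 }.

End material.

Section peridynamics.
Context {R : realType} {d : nat}.
Context (g J : R -> R) (Om : set 'rV[R]_d) (eps : R).
Local Notation leb := (@lebesgue_rV R d).
Implicit Types (u v w : 'rV[R]_d -> 'rV[R]_d) (x y : 'rV[R]_d).

Definition direction y x : 'rV[R]_d := (enorm (y - x))^-1 *: (y - x).

Definition strain y x u : R :=
  dotp ((enorm (y - x))^-1 *: (u y - u x)) (direction y x).

Definition horizon x : set 'rV[R]_d := eball x eps `&` Om.

Definition force u x : 'rV[R]_d :=
  - vintegral (horizon x) (fun y =>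
      (2 * J (enorm (y - x) / eps) /
        (eps ^+ d.+1 * unit_ball_volume R d * Num.sqrt (enorm (y - x))) *
        derive1n 1 g (Num.sqrt (enorm (y - x)) * strain y x u))
      *: direction y x).

Definition Dforce u v x : 'rV[R]_d :=
  - vintegral (horizon x) (fun y =>
      (2 * J (enorm (y - x) / eps) / (eps ^+ d.+1 * unit_ball_volume R d) *
        derive1n 2 g (Num.sqrt (enorm (y - x)) * strain y x u) * strain y x v)
      *: direction y x).

Definition bond_energy y x u : R :=
  J (enorm (y - x) / eps) /
    (eps ^+ d.+1 * unit_ball_volume R d * enorm (y - x)) *
  g (Num.sqrt (enorm (y - x)) * strain y x u).

Definition PD u : R :=
  \int[leb]_(x in Om) \int[leb]_(y in horizon x)
    (enorm (y - x) * bond_energy y x u).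

Definition L2pairing u v : R := \int[leb]_(x in Om) dotp (u x) (v x).

(* Elements of L^oo(Om; R^d) are represented by Borel functions; their values
   outside Om are irrelevant and equality is a.e. equality on Om. *)
Definition eqae u v : Prop := ae_eq leb Om u v.

Definition linf_norm u : \bar R :=
  Lnorm leb +oo%E ((fun x => (enorm (u x))%:E) \_ Om).

Definition Linf u : Prop := measurable_fun Om u /\ (linf_norm u < +oo)%E.

(* Row vectors: x *m Q^T + c is the transpose of Q x + c. *)
Definition in_V u : Prop :=
  Linf u /\ forall (Q : 'M[R]_d) (c : 'rV[R]_d), Q^T = - Q ->
    L2pairing u (fun x => x *m Q^T + c) = 0.

(* Closed ball, so it is its own closure. *)
Definition in_ball u0 (r : R) u : Prop :=
  in_V u /\ (linf_norm (u - u0)%R <= r%:E)%E.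

Definition invertible_on_V (A : ('rV[R]_d -> 'rV[R]_d) -> 'rV[R]_d -> 'rV[R]_d)
    : Prop :=
  forall v, in_V v -> exists w, [/\ in_V w, eqae (A w) v &
    forall w', in_V w' -> eqae (A w') v -> eqae w' w].

(* A representative of A^-1 v; it is unique up to a.e. equality when A is
   invertible on V. *)
Definition inverse_on_V (A : ('rV[R]_d -> 'rV[R]_d) -> 'rV[R]_d -> 'rV[R]_d) v :
    'rV[R]_d -> 'rV[R]_d :=
  xget 0 [set w | in_V w /\ eqae (A w) v].

Definition bounded_on_V (A : ('rV[R]_d -> 'rV[R]_d) -> 'rV[R]_d -> 'rV[R]_d)
    : Prop :=
  exists M : R, forall v, in_V v -> (linf_norm (A v) <= M%:E * linf_norm v)%E.

Definition op_norm (A : ('rV[R]_d -> 'rV[R]_d) -> 'rV[R]_d -> 'rV[R]_d) : R :=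
  sup [set fine (linf_norm (A v)) / fine (linf_norm v)
      | v in [set v | in_V v /\ ~ eqae v 0]].

(* Only the values of a path on [0, T] matter; limits are within [0, T], so
   one-sided at the end points. *)
Definition path_continuous (T : R) (p : R -> 'rV[R]_d -> 'rV[R]_d) : Prop :=
  forall t : R, 0 <= t <= T ->
    linf_norm (p s - p t) @[s --> within `[0, T]%classic (nbhs t)] --> 0%E.

Definition path_derivative (T : R) (p : R -> 'rV[R]_d -> 'rV[R]_d) (t : R) v
    : Prop :=
  linf_norm ((s - t)^-1 *: (p s - p t) - v)
    @[s --> within `[0, T]%classic t^'] --> 0%E.

Definition base_state u0 b0 : Prop :=
  [/\ in_V u0, in_V b0, eqae (force u0) b0, invertible_on_V (Dforce u0) &
      bounded_on_V (inverse_on_V (Dforce u0))].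

Definition inv_norm u0 : R := op_norm (inverse_on_V (Dforce u0)).

Definition solution_radius (C : R) u0 : R := C * eps `^ (5 / 2) / inv_norm u0.

Definition load_path (C T : R) u0 b0 (b : R -> 'rV[R]_d -> 'rV[R]_d) : Prop :=
  path_continuous T b /\ forall t : R, 0 <= t <= T ->
    in_ball b0 (solution_radius C u0 / (2 * inv_norm u0)) (b t).

Definition displacement_path (C T : R) u0 (b u : R -> 'rV[R]_d -> 'rV[R]_d)
    : Prop :=
  path_continuous T u /\ forall t : R, 0 <= t <= T ->
    in_ball u0 (solution_radius C u0) (u t) /\ eqae (force (u t)) (b t).

End peridynamics.

(* C depends only on d, g and J: it serves all domains, horizons, base states,
   final times and loads at once. *)
Definition inverse_function_constant {R : realType} (d : nat) (g J : R -> R)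
    (C : R) : Prop :=
  0 < C /\
  forall (Om : set 'rV[R]_d) (eps : R) (u0 b0 : 'rV[R]_d -> 'rV[R]_d),
    cone_domain Om -> 0 < eps -> base_state g J Om eps u0 b0 ->
  forall (T : R) (b : R -> 'rV[R]_d -> 'rV[R]_d),
    0 < T -> load_path g J Om eps C T u0 b0 b ->
    exists u, displacement_path g J Om eps C T u0 b u /\
      forall v, displacement_path g J Om eps C T u0 b v ->
        forall t : R, 0 <= t <= T -> eqae Om (v t) (u t).

(* Main.v *)
Require Import Defs.
From HB Require Import structures.
From mathcomp Require Import all_boot all_order all_algebra.
From mathcomp Require Import all_classical all_reals all_analysis.
From mathcomp Require Import measurable_realfun ess_sup_inf ring lra.

Set Implicit Arguments.
Unset Strict Implicit.
Unset Printing Implicit Defensive.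

Import Order.TTheory GRing.Theory Num.Theory.
Import numFieldNormedType.Exports.

Local Open Scope classical_set_scope.
Local Open Scope ring_scope.

(** Write F for the force operator, DF(v) for its linearization at v, and V for
    the essentially bounded fields orthogonal to the rigid motions.  The theorem
    is the differentiated form of F(u(t)) = b(t), together with the fact that F
    is the gradient of the peridynamic energy.

    All integrands live on bonds, that is on pairs (x, y) of points closer than
    eps, and all of them are dominated by the kernel |y - x|^(-3/2), which has a
    uniformly bounded integral because d >= 2.  The exponent 3/2 comes from the
    Taylor remainders: a field bounded by N strains a bond of length r by at
    most 2N/r, the potential g sees sqrt(r) times the strain, so a quadratic
    remainder of g' divided by sqrt(r) costs sqrt(r) (N/r)^2.  This gives
    force_frechet (F is differentiable with a quadratic remainder, uniformly),
    Dforce_lipschitz (DF(v) is Lipschitz in v) and PD_frechet (the same quadratic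
    estimate for the energy).  In the last one the first variation of the energy
    must be recognized as the pairing with the force; this is bond_field_pairing,
    which is Fubini plus the symmetry of the bonds, and it also shows that DF(v)
    maps into V, since a rigid motion does not strain any bond.

    Only bijectivity of DF(u(t)) on V is assumed, so the bound for its inverse
    has to come from completeness.  V is complete for the essential supremum
    norm (in_V_complete), and bounded_inverse is the bounded inverse theorem,
    deduced from Zabreiko's lemma by a nested ball argument carried out directly
    for seminorms, so that no quotient by equality almost everywhere is formed.

    Let h = u(s) - u(t).  The quadratic remainder and the bounded inverse give
    |h| <= M (|b(s) - b(t)| + K |h|^2), and continuity of u makes |h| small
    enough to absorb the last term.  Hence u is Lipschitz at t
    (solution_lipschitz); dividing by s - t identifies the derivative as the
    inverse applied to b_t (velocity_derivative), and the Lipschitz dependence of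
    DF on the state gives its continuity (velocity_continuous).

    For the balance, PD_frechet at u(t) shows that in the increment of the work
    of b against u minus the energy, the contributions of h cancel up to second
    order, leaving the pairing of u(t) with b(s) - b(t).  So this quantity has
    the continuous derivative given by the pairing of u with b_t, and the
    fundamental theorem of calculus concludes.  The initial value is the one at
    u0 because u(0) and u0 are both constant solution paths for the constant load
    b0, and solution paths are unique. *)

(** * The bounded inverse theorem in a complete seminormed space *)

Section seminorms.
Context {R : realType} {E : lmodType R}.
Implicit Types (P : E -> Prop) (N p : E -> R).

Record linear_subspace P : Prop := {
  subspace0 : P 0;
  subspaceD : forall x y, P x -> P y -> P (x + y);
  subspaceZ : forall a x, P x -> P (a *: x) }.

Record seminorm_on P N : Prop := {
  seminorm_ge0 : forall x, P x -> 0 <= N x;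
  seminormD : forall x y, P x -> P y -> N (x + y) <= N x + N y;
  seminormZ : forall a x, P x -> N (a *: x) <= `|a| * N x }.

(** Completeness for sequences that converge geometrically: the rate is kept, so
    that no subsequence has to be extracted. *)
Definition geometrically_complete P N : Prop :=
  forall (c : R) (x : nat -> E), (forall n, P (x n)) ->
    (forall n m, (n <= m)%N -> N (x m - x n) <= c * 2^-1 ^+ n) ->
    exists l, P l /\ forall n, N (l - x n) <= c * 2^-1 ^+ n.

Lemma subspaceN P : linear_subspace P -> forall x, P x -> P (- x).
Proof. by move=> hP x Px; rewrite -scaleN1r; apply: subspaceZ. Qed.

Lemma subspaceB P : linear_subspace P -> forall x y, P x -> P y -> P (x - y).
Proof. by move=> hP x y Px Py; apply: subspaceD => //; apply: subspaceN. Qed.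

Lemma subspace_sum P : linear_subspace P -> forall (f : nat -> E) n,
  (forall i, P (f i)) -> P (\sum_(i < n) f i).
Proof.
move=> hP f n Pf; elim: n => [|n IH]; first by rewrite big_ord0; apply: subspace0.
by rewrite big_ord_recr /=; apply: subspaceD.
Qed.

Lemma seminormN P N : linear_subspace P -> seminorm_on P N ->
  forall x, P x -> N (- x) = N x.
Proof.
move=> hP hN.
have le x : P x -> N (- x) <= N x.
  by move=> Px; rewrite -scaleN1r (le_trans (seminormZ hN _ _))// normrN1 mul1r.
move=> x Px; apply/eqP; rewrite eq_le le//= -{1}[x]opprK le//.
exact: subspaceN.
Qed.

Lemma seminormB P N : linear_subspace P -> seminorm_on P N ->
  forall x y, P x -> P y -> N (x - y) <= N x + N y.
Proof.
move=> hP hN x y Px Py; rewrite (le_trans (seminormD hN _ _))//.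
  exact: subspaceN.
by rewrite (seminormN hP hN).
Qed.

Lemma seminorm_distC P N : linear_subspace P -> seminorm_on P N ->
  forall x y, P x -> P y -> N (x - y) = N (y - x).
Proof.
by move=> hP hN x y Px Py; rewrite -opprB (seminormN hP hN)//; apply: subspaceB.
Qed.

Lemma seminorm0 P N : linear_subspace P -> seminorm_on P N -> N 0 = 0.
Proof.
move=> hP hN; apply/eqP; rewrite eq_le (seminorm_ge0 hN) ?andbT; last exact: subspace0.
rewrite -[X in N X](scale0r 0) (le_trans (seminormZ hN _ _)) ?normr0 ?mul0r//.
exact: subspace0.
Qed.

Lemma half_expr_gt0 n : 0 < 2^-1 ^+ n :> R.
Proof. by rewrite exprn_gt0// invr_gt0. Qed.

Lemma le_geometric_eps (c a b : R) : 0 <= c ->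
  (forall n, a <= b + c * 2^-1 ^+ n) -> a <= b.
Proof.
move=> c0 h; apply/ler_addgt0Pr => e e0.
have [n hn] : exists n, c * 2^-1 ^+ n <= e.
  have h0 : (fun n => c * 2^-1 ^+ n) @ \oo --> (0 : R).
    rewrite -[X in _ --> X](mulr0 c); apply: cvgMl_tmp; apply: cvg_expr.
    by rewrite ger0_norm ?invr_ge0// invf_lt1// ltr1n.
  have [n _ /(_ n (leqnn n))] := (cvgrPdist_le _ _).1 h0 _ e0.
  move=> /= hn; exists n; by move: hn; rewrite sub0r normrN; apply: le_trans; exact: ler_norm.
by rewrite (le_trans (h n))// lerD2l.
Qed.

Section zabreiko.
Context (P : E -> Prop) (N p : E -> R).
Hypotheses (hP : linear_subspace P) (hN : seminorm_on P N) (hp : seminorm_on P p).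
Hypothesis cN : geometrically_complete P N.

Definition sublevel_dense (k : R) (v0 : E) (r : R) :=
  forall v, P v -> N (v - v0) <= r -> forall e, 0 < e ->
    exists f, [/\ P f, p f <= k & N (v - f) <= e].

(** Baire's argument.  If no sublevel set of p were dense in a ball, then below
    every ball there would be a smaller one missing the sublevel set of level n;
    the nested balls would shrink to a point where p exceeds every integer. *)
Lemma sublevel_dense_somewhere :
  exists (k : R) (v0 : E) (r : R), [/\ 0 <= k, P v0, 0 < r & sublevel_dense k v0 r].
Proof.
apply: contrapT => hno.
have next (s : nat * (E * R)) : exists s' : E * R,
    P s.2.1 -> 0 < s.2.2 -> [/\ P s'.1, N (s'.1 - s.2.1) <= s.2.2 / 2,
      0 < s'.2 <= s.2.2 / 2 &
      forall f, P f -> N (s'.1 - f) <= s'.2 -> s.1%:R < p f].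
  case: s => k [v0 r] /=.
  have [Pv0|] := pselect (P v0); last by exists (v0, r).
  have [r0|] := pselect (0 < r); last by exists (v0, r).
  apply: contrapT => hs; apply: hno; exists k%:R, v0, (r / 2); split=> //.
    by rewrite divr_gt0.
  move=> v Pv vv0 e e0; apply: contrapT => hf; apply: hs.
  exists (v, Num.min e (r / 2)) => _ _; split => //=.
    by rewrite lt_min e0 divr_gt0//= ge_min lexx orbT.
  move=> f Pf vf; rewrite ltNge; apply/negP => pf; apply: hf.
  by exists f; split => //; rewrite (le_trans vf)// ge_min lexx.
(* s n is the centre and the radius of the n-th ball *)
have [nx nxP] := choice next.
pose s := fix s n := if n is m.+1 then nx (m, s m) else (0, 1).
have sP n : P (s n).1 /\ 0 < (s n).2.
  elim: n => [|n [IH1 IH2]] /=; first by split; [exact: subspace0|].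
  by have [? _ /andP[? ?] _] := nxP (n, s n) IH1 IH2.
have Ps n := (sP n).1; have s0 n := (sP n).2.
have sN n : N ((s n.+1).1 - (s n).1) <= (s n).2 / 2.
  by have [_ ? _ _] := nxP (n, s n) (Ps n) (s0 n).
have sr n : (s n.+1).2 <= (s n).2 / 2.
  by have [_ _ /andP[_ ?] _] := nxP (n, s n) (Ps n) (s0 n).
have sp n f : P f -> N ((s n.+1).1 - f) <= (s n.+1).2 -> n%:R < p f.
  by have [_ _ _] := nxP (n, s n) (Ps n) (s0 n); apply.
have sle n : (s n).2 <= 1 * 2^-1 ^+ n.
  elim: n => [|n IH]; first by rewrite expr0 mul1r.
  by rewrite (le_trans (sr n))// exprSr mulrA ler_pM2r ?invr_gt0.
have sd n m : (n <= m)%N -> N ((s m).1 - (s n).1) <= (s n).2 - (s m).2.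
  move=> /subnK <-; elim: (m - n)%N => [|k IH].
    by rewrite add0n !subrr (seminorm0 hP hN).
  rewrite addSn -(subrKA (s (k + n)%N).1).
  have := seminormD hN (subspaceB hP (Ps (k + n).+1) (Ps (k + n)%N))
                       (subspaceB hP (Ps (k + n)%N) (Ps n)).
  have := sN (k + n)%N; have := sr (k + n)%N; lra.
have [l [Pl ll]] : exists l, P l /\ forall n, N (l - (s n).1) <= 1 * 2^-1 ^+ n.
  apply: cN => // n m nm; rewrite (le_trans (sd _ _ nm))//.
  by rewrite (le_trans _ (sle n))// lerBlDr lerDl ltW.
(* completeness only places l within 2^-n of the centres; the nesting improves
   this to the actual radii *)
have lr n : N ((s n).1 - l) <= (s n).2.
  rewrite (seminorm_distC hP hN)//; apply: (@le_geometric_eps 1) => // m.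
  rewrite -(subrKA (s (n + m)%N).1).
  have := seminormD hN (subspaceB hP Pl (Ps (n + m)%N))
                       (subspaceB hP (Ps (n + m)%N) (Ps n)).
  have := ll (n + m)%N; have := sd _ _ (leq_addr m n).
  have := s0 (n + m)%N.
  have : 1 * 2^-1 ^+ (n + m) <= 1 * 2^-1 ^+ m :> R.
    by rewrite !mul1r ler_wiXn2l ?invr_ge0 ?leq_addl// invf_le1// ler1n.
  lra.
have pl0 := seminorm_ge0 hp Pl.
have := sp (Num.truncn (p l)).+1 l Pl (lr _).
by apply/negP; rewrite -leNgt ltW// truncnS_gt.
Qed.

(** A sublevel set dense in a ball around v0 has differences dense in the ball of
    the same radius around 0, and homogeneity then spreads this to all scales. *)
Lemma sublevel_dense_homogeneous : exists2 M : R, 0 <= M &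
  forall s v, 0 < s -> P v -> N v <= s -> forall e, 0 < e ->
    exists f, [/\ P f, p f <= M * s & N (v - f) <= e].
Proof.
have [k [v0 [r [k0 Pv0 r0 hd]]]] := sublevel_dense_somewhere.
exists (2 * k / r); first by rewrite divr_ge0 ?mulr_ge0 // ltW.
move=> s v s0 Pv Nv e e0.
have sr0 : 0 < s / r by rewrite divr_gt0.
have e20 : 0 < e / (s / r) / 2 by rewrite !divr_gt0.
have Pv' : P ((s / r)^-1 *: v) by apply: subspaceZ.
have [|f1 [Pf1 pf1 Nf1]] := hd (v0 + (s / r)^-1 *: v) (subspaceD hP Pv0 Pv') _ _ e20.
  rewrite addrAC subrr add0r (le_trans (seminormZ hN _ _))// gtr0_norm ?invr_gt0//.
  by rewrite ler_pdivrMl// divfK ?gt_eqF.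
have [|f2 [Pf2 pf2 Nf2]] := hd v0 Pv0 _ _ e20.
  by rewrite subrr (seminorm0 hP hN) ltW.
have Pf := subspaceB hP Pf1 Pf2.
exists ((s / r) *: (f1 - f2)); split; first exact: subspaceZ.
  rewrite (le_trans (seminormZ hp _ _))// gtr0_norm//.
  have -> : 2 * k / r * s = s / r * (2 * k) by ring.
  rewrite ler_pM2l//; have := seminormB hP hp Pf1 Pf2; lra.
have -> : v - (s / r) *: (f1 - f2) =
    (s / r) *: ((v0 + (s / r)^-1 *: v - f1) - (v0 - f2)).
  have -> : v0 + (s / r)^-1 *: v - f1 - (v0 - f2) = (s / r)^-1 *: v - (f1 - f2).
    rewrite [v0 + _]addrC -[_ + v0 - f1]addrA [v0 - f1]addrC addrA.
    by rewrite !opprB [f2 - v0]addrC addrA addrK [f2 - f1]addrC addrA.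
  by rewrite [RHS]scalerBr scalerA divff ?scale1r ?gt_eqF.
have P1 : P (v0 + (s / r)^-1 *: v - f1) by apply: subspaceB => //; exact: subspaceD.
have P2 := subspaceB hP Pv0 Pf2.
rewrite (le_trans (seminormZ hN _ (subspaceB hP P1 P2)))// gtr0_norm//.
rewrite mulrC -ler_pdivlMr//; have := seminormB hP hN P1 P2; lra.
Qed.

(** Zabreiko's lemma: a countably subadditive seminorm on a complete space is
    bounded.  A vector is expanded as a series whose n-th term approximates the
    current remainder to within half of it, with p controlled by the remainder. *)
Theorem zabreiko :
  (forall (c c' : R) (f : nat -> E) v, (forall n, P (f n)) -> P v ->
    (forall n, p (f n) <= c * 2^-1 ^+ n) ->
    (forall n, N (v - \sum_(i < n) f i) <= c' * 2^-1 ^+ n) -> p v <= 2 * c) ->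
  exists2 M : R, 0 <= M & forall v, P v -> p v <= M * N v.
Proof.
move=> hcs; have [M M0 hM] := sublevel_dense_homogeneous.
exists (2 * M); first by rewrite mulr_ge0.
move=> v Pv.
suff hs s : N v < s -> p v <= 2 * (M * s).
  apply/ler_addgt0Pr => e e0.
  have e20 : 0 < e / (2 * M + 1) by rewrite divr_gt0// ltr_pwDr// mulr_ge0.
  rewrite (le_trans (hs (N v + e / (2 * M + 1)) _))// ?ltrDl//.
  rewrite mulrA mulrDr lerD2l mulrA ler_pdivrMr ?ltr_pwDr// ?mulr_ge0//.
  by rewrite mulrC ler_pM2l// lerDl.
move=> Nvs; have s0 : 0 < s by rewrite (le_lt_trans _ Nvs)// (seminorm_ge0 hN).
have next (q : E * R) : exists f, P q.1 -> 0 < q.2 -> N q.1 <= q.2 ->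
    [/\ P f, p f <= M * q.2 & N (q.1 - f) <= q.2 / 2].
  have [Pq|] := pselect (P q.1); last by exists 0.
  have [q0|] := pselect (0 < q.2); last by exists 0.
  have [Nq|] := pselect (N q.1 <= q.2); last by exists 0.
  have [|f hf] := hM q.2 q.1 q0 Pq Nq (q.2 / 2); first by rewrite divr_gt0.
  by exists f.
have [F FP] := choice next.
pose sn n := s * 2^-1 ^+ n : R.
have sn0 n : 0 < sn n by rewrite mulr_gt0// half_expr_gt0.
pose e := fix e n := if n is m.+1 then e m - F (e m, sn m) else v.
have eP n : P (e n) /\ N (e n) <= sn n.
  elim: n => [|n [IH1 IH2]] /=; first by rewrite /sn expr0 mulr1 ltW.
  have [? ? Ne] := FP (e n, sn n) IH1 (sn0 n) IH2; split; first exact: subspaceB.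
  by rewrite (le_trans Ne)// /sn exprSr mulrA.
have fP n := FP (e n, sn n) (eP n).1 (sn0 n) (eP n).2.
have eE n : v - \sum_(i < n) F (e i, sn i) = e n.
  elim: n => [|n IH]; first by rewrite big_ord0 subr0.
  by rewrite big_ord_recr /= opprD addrA IH.
apply: (hcs _ s (fun n => F (e n, sn n))) => //.
- by move=> n; have [] := fP n.
- by move=> n; have [_ + _] := fP n; rewrite /sn /= mulrA.
- by move=> n; rewrite eE; exact: (eP n).2.
Qed.

End zabreiko.

Section bounded_inverse.
Context (P : E -> Prop) (N : E -> R) (A : E -> E) (K : R).
Hypotheses (hP : linear_subspace P) (hN : seminorm_on P N).
Hypothesis cN : geometrically_complete P N.
Hypotheses (PA : forall x, P x -> P (A x)) (K0 : 0 <= K)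
  (NA : forall x, P x -> N (A x) <= K * N x).
Hypothesis linA : forall a x y, P x -> P y ->
  N (A (a *: x + y) - (a *: A x + A y)) = 0.
Hypothesis injA : forall x, P x -> N (A x) = 0 -> N x = 0.
Hypothesis surjA : forall y, P y -> exists2 x, P x & N (A x - y) = 0.

Let N_le0 x : P x -> N x <= 0 -> N x = 0.
Proof. by move=> Px h; apply/eqP; rewrite eq_le h (seminorm_ge0 hN). Qed.

Lemma seminorm_close x y : P x -> P y -> N (x - y) = 0 -> N x = N y.
Proof.
move=> Px Py h; apply/eqP; rewrite eq_le.
rewrite -{1}[x](subrK y) -{4}[y](subrK x).
rewrite (le_trans (seminormD hN (subspaceB hP Px Py) Py)) ?h ?add0r//=.
rewrite (le_trans (seminormD hN (subspaceB hP Py Px) Px))//.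
by rewrite (seminorm_distC hP hN)// h add0r.
Qed.

Local Ltac in_subspace := repeat first [ assumption | apply: (subspace0 hP)
  | apply: PA | apply: (subspaceB hP) | apply: (subspaceD hP)
  | apply: (subspaceZ hP) ].

Let sub_A x y : P x -> P y -> N (A (x - y) - (A x - A y)) = 0.
Proof.
move=> Px Py; rewrite [x - y]addrC -scaleN1r [A x - A y]addrC -[- A y]scaleN1r.
exact: linA.
Qed.

Let add_A x y : P x -> P y -> N (A (x + y) - (A x + A y)) = 0.
Proof. by move=> Px Py; have := linA 1 Px Py; rewrite !scale1r. Qed.

Let N_addr0 x y : P x -> P y -> N x = 0 -> N y = 0 -> N (x + y) = 0.
Proof.
move=> Px Py x0 y0; apply: N_le0; first by in_subspace.
by rewrite (le_trans (seminormD hN Px Py))// x0 y0 addr0.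
Qed.

Let NA0 : N (A 0) = 0.
Proof.
apply: N_le0; first by in_subspace.
by rewrite (le_trans (NA (subspace0 hP)))// (seminorm0 hP hN) mulr0.
Qed.

Let inv_close x y z : P x -> P y -> P z ->
  N (A x - z) = 0 -> N (A y - z) = 0 -> N (x - y) = 0.
Proof.
move=> Px Py Pz xz yz; apply: injA; first by in_subspace.
rewrite (@seminorm_close _ (A x - A y)) ?sub_A//; try by in_subspace.
rewrite -(subrKA z); apply: N_addr0; try by in_subspace.
by rewrite (seminorm_distC hP hN)//; in_subspace.
Qed.

(** The seminorm y |-> N (A^-1 y) is countably subadditive, since a convergent
    series of preimages is mapped by A onto the series of the images; Zabreiko's
    lemma bounds it.  A is linear, injective and onto only up to vectors of
    seminorm zero, which is the situation of functions up to null sets. *)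
Theorem bounded_inverse : exists2 M : R, 0 <= M &
  forall x, P x -> N x <= M * N (A x).
Proof.
have [B BP] : {B : E -> E & forall y, P y -> P (B y) /\ N (A (B y) - y) = 0}.
  apply: (@choice _ _ (fun y x => P y -> P x /\ N (A x - y) = 0)) => y.
  have [Py|] := pselect (P y); last by exists 0.
  by have [x ? ?] := surjA Py; exists x.
have PB y : P y -> P (B y) by move=> /BP[].
have BK y : P y -> N (A (B y) - y) = 0 by move=> /BP[].
have Bu x y : P x -> P y -> N (A x - y) = 0 -> N (B y) = N x.
  move=> Px Py xy; apply: seminorm_close => //; first exact: PB.
  by apply: (inv_close (z := y)); rewrite ?BK//; apply: PB.
have hp : seminorm_on P (N \o B).
  split => /=; first by move=> x Px; apply: (seminorm_ge0 hN); apply: PB.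
  - move=> x y Px Py; have PBx := PB x Px; have PBy := PB y Py.
    rewrite (Bu (B x + B y)) ?(seminormD hN)//; try by in_subspace.
    have -> : A (B x + B y) - (x + y) =
      (A (B x + B y) - (A (B x) + A (B y))) + ((A (B x) - x) + (A (B y) - y)).
      by rewrite [(A (B x) - x) + _]addrACA -opprD subrKA.
    apply: N_addr0; rewrite ?add_A//; try by in_subspace.
    by apply: N_addr0; rewrite ?BK//; in_subspace.
  - move=> a x Px; have PBx := PB x Px.
    rewrite (Bu (a *: B x)) ?(seminormZ hN)//; try by in_subspace.
    have -> : A (a *: B x) - a *: x =
      (A (a *: B x + 0) - (a *: A (B x) + A 0)) + (A 0 + a *: (A (B x) - x)).
      rewrite addr0 scalerBr opprD addrA.
      by rewrite -[_ + (_ - _) + A 0]addrA subrK subrKA.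
    apply: N_addr0; rewrite ?linA//; try by in_subspace.
    apply: N_addr0; rewrite ?NA0//; try by in_subspace.
    apply: N_le0; first by in_subspace.
    by rewrite (le_trans (seminormZ hN _ _)) ?BK ?mulr0//; in_subspace.
have [M M0 hM] : exists2 M : R, 0 <= M & forall v, P v -> (N \o B) v <= M * N v.
  apply: zabreiko => // c c' f v Pf Pv /= pf vf.
  have PBf i : P (B (f i)) by apply: PB.
  pose W n := \sum_(i < n) B (f i).
  have PW n : P (W n) by exact: (subspace_sum hP (f := B \o f)).
  have c0 : 0 <= c.
    by have := pf 0%N; rewrite expr0 mulr1; apply: le_trans; apply: (seminorm_ge0 hN).
  have c'0 : 0 <= c'.
    have := vf 0%N; rewrite expr0 mulr1; apply: le_trans; apply: (seminorm_ge0 hN).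
    by rewrite big_ord0 subr0.
  have WW n m : (n <= m)%N -> N (W m - W n) <= 2 * c * 2^-1 ^+ n.
    move=> nm; suff : N (W m - W n) <= 2 * c * 2^-1 ^+ n - 2 * c * 2^-1 ^+ m.
      by move/le_trans; apply; rewrite lerBlDr lerDl !mulr_ge0// ltW// half_expr_gt0.
    move: nm => /subnK <-; elim: (m - n)%N => [|k IH].
      by rewrite add0n !subrr (seminorm0 hP hN).
    rewrite addSn {1}/W big_ord_recr /= -/(W (k + n)%N) addrAC.
    rewrite (le_trans (seminormD hN (subspaceB hP (PW _) (PW _)) (PBf _)))//.
    have := pf (k + n)%N; rewrite exprS; move: IH; lra.
  have [w [Pw wW]] := cN PW WW.
  have Psf n : P (\sum_(i < n) f i) by exact: (subspace_sum hP).
  have AW n : N (A (W n) - \sum_(i < n) f i) = 0.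
    elim: n => [|n IH]; first by rewrite /W !big_ord0 subr0 NA0.
    have PWn := PW n; have Psfn := Psf n.
    rewrite /W !big_ord_recr /= -/(W n).
    have -> : A (W n + B (f n)) - (\sum_(i < n) f i + f n) =
      (A (W n + B (f n)) - (A (W n) + A (B (f n)))) +
      ((A (W n) - \sum_(i < n) f i) + (A (B (f n)) - f n)).
      by rewrite [(A (W n) - _) + _]addrACA -opprD subrKA.
    have Pfn := Pf n; have PBfn := PBf n.
    apply: N_addr0; rewrite ?add_A//; try by in_subspace.
    by apply: N_addr0; rewrite ?BK//; in_subspace.
  rewrite (Bu w)//; first by have := wW 0%N; rewrite /W big_ord0 subr0 expr0 mulr1.
  apply: N_le0; first by in_subspace.
  apply: (@le_geometric_eps (K * (2 * c) + c')); first by rewrite addr_ge0// !mulr_ge0.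
  move=> n; rewrite add0r; have PWn := PW n; have Psfn := Psf n.
  have P2 : P (A w - A (W n)) by in_subspace.
  have P3 : P (A (W n) - \sum_(i < n) f i) by in_subspace.
  have P4 : P (\sum_(i < n) f i - v) by in_subspace.
  have -> : A w - v =
      (A w - A (W n)) + ((A (W n) - \sum_(i < n) f i) + (\sum_(i < n) f i - v)).
    by rewrite !subrKA.
  rewrite (le_trans (seminormD hN P2 (subspaceD hP P3 P4)))// mulrDl lerD//.
    rewrite -(seminorm_close _ P2 (sub_A Pw PWn)); last by in_subspace.
    by rewrite (le_trans (NA (subspaceB hP Pw PWn)))// -mulrA ler_wpM2l.
  rewrite (le_trans (seminormD hN P3 P4))// AW add0r.
  by rewrite (seminorm_distC hP hN)//; exact: vf.
exists M => // x Px; have PAx := PA Px.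
by have := hM _ PAx; rewrite /= (Bu x)// subrr (seminorm0 hP hN).
Qed.

End bounded_inverse.
End seminorms.

(** * Euclidean geometry of bonds *)

Section euclidean_geometry.
Context {R : realType} {d : nat}.
Implicit Types (x y z : 'rV[R]_d) (a : R).

Lemma dotpC x y : dotp x y = dotp y x.
Proof. by apply: eq_bigr => i _; rewrite mulrC. Qed.

Lemma dotpDl x y z : dotp (x + y) z = dotp x z + dotp y z.
Proof. by rewrite -big_split; apply: eq_bigr => i _; rewrite mxE mulrDl. Qed.

Lemma dotpZl a x y : dotp (a *: x) y = a * dotp x y.
Proof. by rewrite mulr_sumr; apply: eq_bigr => i _; rewrite mxE mulrA. Qed.

Lemma dotpNl x y : dotp (- x) y = - dotp x y.
Proof. by rewrite -scaleN1r dotpZl mulN1r. Qed.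

Lemma dotpBl x y z : dotp (x - y) z = dotp x z - dotp y z.
Proof. by rewrite dotpDl dotpNl. Qed.

Lemma dotpDr x y z : dotp x (y + z) = dotp x y + dotp x z.
Proof. by rewrite dotpC dotpDl !(dotpC x). Qed.

Lemma dotpZr a x y : dotp x (a *: y) = a * dotp x y.
Proof. by rewrite dotpC dotpZl dotpC. Qed.

Lemma dotpNr x y : dotp x (- y) = - dotp x y.
Proof. by rewrite dotpC dotpNl dotpC. Qed.

Lemma dotpBr x y z : dotp x (y - z) = dotp x y - dotp x z.
Proof. by rewrite dotpDr dotpNr. Qed.

Lemma dotp_ge0 x : 0 <= dotp x x.
Proof. by apply: sumr_ge0 => i _; rewrite -expr2 sqr_ge0. Qed.

Lemma sqr_enorm x : enorm x ^+ 2 = dotp x x.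
Proof. by rewrite sqr_sqrtr// dotp_ge0. Qed.

Lemma enorm_ge0 x : 0 <= enorm x.
Proof. exact: sqrtr_ge0. Qed.

Lemma coord_le_enorm x i : `|x 0 i| <= enorm x.
Proof.
rewrite -sqrtr_sqr ler_wsqrtr// expr2 /dotp (bigD1 i)//= lerDl.
by apply: sumr_ge0 => j _; rewrite -expr2 sqr_ge0.
Qed.

Lemma enorm0 : enorm (0 : 'rV[R]_d) = 0.
Proof. by rewrite /enorm /dotp big1 ?sqrtr0// => i _; rewrite mxE mul0r. Qed.

Lemma enorm_eq0 x : enorm x = 0 -> x = 0.
Proof.
move=> x0; apply/rowP => i; apply/eqP; rewrite mxE -normr_le0 -x0.
exact: coord_le_enorm.
Qed.

Lemma enormZ a x : enorm (a *: x) = `|a| * enorm x.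
Proof.
by rewrite /enorm dotpZl dotpZr mulrA -expr2 sqrtrM ?sqr_ge0// sqrtr_sqr.
Qed.

Lemma enormN x : enorm (- x) = enorm x.
Proof. by rewrite -scaleN1r enormZ normrN1 mul1r. Qed.

Lemma enormB x y : enorm (x - y) = enorm (y - x).
Proof. by rewrite -opprB enormN. Qed.

Lemma cauchy_schwarz x y : `|dotp x y| <= enorm x * enorm y.
Proof.
have [y0|y0] := eqVneq (dotp y y) 0.
  have -> : y = 0 by apply: enorm_eq0; rewrite /enorm y0 sqrtr0.
  by rewrite enorm0 mulr0 -[X in dotp x X](scale0r 0) dotpZr mul0r normr0.
rewrite -[leLHS]sqrtr_sqr -sqrtrM ?dotp_ge0// ler_wsqrtr//.
have yp : 0 < dotp y y by rewrite lt_def y0 dotp_ge0.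
have := dotp_ge0 (dotp y y *: x - dotp x y *: y).
rewrite !dotpBl !dotpBr !dotpZl !dotpZr (dotpC y x) => h.
rewrite -(ler_pM2l yp) -subr_ge0; apply: le_trans h _.
by rewrite le_eqVlt; apply/orP; left; apply/eqP; ring.
Qed.

Lemma ler_enormD x y : enorm (x + y) <= enorm x + enorm y.
Proof.
rewrite -(ler_pXn2r (n := 2))// ?nnegrE ?addr_ge0 ?enorm_ge0//.
rewrite sqr_enorm sqrrD !sqr_enorm dotpDl !dotpDr (dotpC y x) !addrA lerD2r.
have := le_trans (ler_norm _) (cauchy_schwarz x y); lra.
Qed.

Lemma ler_enormB x y : enorm (x - y) <= enorm x + enorm y.
Proof. by rewrite (le_trans (ler_enormD _ _))// enormN. Qed.

Lemma enorm_le_sum x : enorm x <= \sum_i `|x 0 i|.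
Proof.
rewrite -(ler_pXn2r (n := 2))// ?nnegrE ?enorm_ge0 ?sumr_ge0//.
rewrite sqr_enorm expr2 mulr_suml; apply: ler_sum => i _.
apply: le_trans (ler_norm _) _; rewrite normrM ler_wpM2l//.
by rewrite (bigD1 i)//= lerDl sumr_ge0.
Qed.

Lemma direction_swap x y : direction x y = - direction y x.
Proof. by rewrite /direction enormB -scalerN opprB. Qed.

Lemma enorm_direction x y : enorm (direction y x) <= 1.
Proof.
rewrite enormZ ger0_norm ?invr_ge0 ?enorm_ge0//.
have [->|h] := eqVneq (enorm (y - x)) 0; first by rewrite mulr0.
by rewrite mulVf.
Qed.

Lemma strainE y x u :
  strain y x u = (enorm (y - x))^-1 * dotp (u y - u x) (direction y x).
Proof. by rewrite /strain dotpZl. Qed.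

Lemma strain_swap (u : 'rV[R]_d -> 'rV[R]_d) x y : strain x y u = strain y x u.
Proof.
by rewrite !strainE enormB direction_swap dotpNr -dotpNl opprB.
Qed.

Lemma strainD y x u v : strain y x (u + v) = strain y x u + strain y x v.
Proof. by rewrite !strainE -mulrDr -dotpDl /= opprD addrACA. Qed.

Lemma strainZ a y x u : strain y x (a *: u) = a * strain y x u.
Proof. by rewrite !strainE /= -scalerBr dotpZl mulrCA. Qed.

Lemma strainB y x u v : strain y x (u - v) = strain y x u - strain y x v.
Proof. by rewrite strainD -scaleN1r strainZ mulN1r. Qed.

Lemma strain_le (M : R) y x u : enorm (u y) <= M -> enorm (u x) <= M ->
  `|strain y x u| <= 2 * M / enorm (y - x).
Proof.
move=> uy ux; rewrite strainE normrM ger0_norm ?invr_ge0 ?enorm_ge0//.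
rewrite mulrC ler_wpM2r ?invr_ge0 ?enorm_ge0//.
apply: le_trans (cauchy_schwarz _ _) _.
rewrite -[leRHS]mulr1 ler_pM ?enorm_ge0 ?enorm_direction//.
by rewrite (le_trans (ler_enormB _ _))// mulr2n mulrDl !mul1r lerD.
Qed.

(** This is why rigid motions do not strain: the component of Q z along z
    vanishes for a skew Q. *)
Lemma dotp_skew (Q : 'M[R]_d) z : Q^T = - Q -> dotp (z *m Q^T) z = 0.
Proof.
move=> hQ.
have E (B : 'M[R]_d) : (z *m B *m z^T) 0 0 = dotp (z *m B) z.
  by rewrite mxE; apply: eq_bigr => i _; rewrite !mxE.
have h : (z *m Q^T *m z^T) 0 0 = - (z *m Q^T *m z^T) 0 0.
  have e : z *m Q^T *m z^T = (z *m Q *m z^T)^T by rewrite !trmx_mul trmxK mulmxA.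
  by rewrite {1}e [LHS]mxE hQ mulmxN mulNmx [X in - X]mxE opprK.
by rewrite -E; lra.
Qed.

End euclidean_geometry.

(** * Lebesgue measure and the singular kernel *)

Section measurability.
Context {R : realType}.

Lemma measurable_invr : measurable_fun setT (fun x : R => x^-1).
Proof.
rewrite -(setUv [set (0 : R)]); apply/measurable_funU => //.
  exact: measurableC.
split; first exact: measurable_fun_set1.
apply: open_continuous_measurable_fun; first by apply: closed_openC; exact: accessible_closed_set1 (hausdorff_accessible (@Rhausdorff R)) _.
by move=> x; rewrite inE /= => /eqP x0; exact: inv_continuous.
Qed.

Lemma measurable_sqrt : measurable_fun setT (@Num.sqrt R).
Proof. by apply: continuous_measurable_fun; exact: sqrt_continuous. Qed.

Section norms.
Context {dd} {T : measurableType dd} {n : nat} (D : set T).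
Implicit Types f g : T -> 'rV[R]_n.

Lemma measurable_coord_fun f i : measurable_fun D f ->
  measurable_fun D (fun t => f t 0 i : measurableTypeR R).
Proof. by move=> mf; apply: (measurableT_comp (measurable_coord 0 i) mf). Qed.

Lemma measurable_dotp f g : measurable_fun D f -> measurable_fun D g ->
  measurable_fun D (fun t => dotp (f t) (g t)).
Proof.
by move=> mf mg; apply: measurable_sum => i; apply: measurable_funM;
  apply: measurable_coord_fun.
Qed.

Lemma measurable_enorm f : measurable_fun D f -> measurable_fun D (fun t => enorm (f t)).
Proof.
move=> mf; apply: (measurableT_comp measurable_sqrt); exact: measurable_dotp.
Qed.

Lemma measurable_rVP f : (forall i, measurable_fun D (fun t => f t 0 i : measurableTypeR R)) ->
  measurable_fun D f.
Proof. by move=> mf; apply: measurable_matrixP => i j; rewrite (ord1 i). Qed.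

Lemma measurable_rVD f g : measurable_fun D f -> measurable_fun D g ->
  measurable_fun D (fun t => f t + g t).
Proof.
move=> mf mg; apply: measurable_rVP => i.
rewrite (_ : (fun t => _) = (fun t => f t 0 i + g t 0 i)); last by apply/funext => t; rewrite mxE.
by apply: measurable_funD; apply: measurable_coord_fun.
Qed.

Lemma measurable_rVZ (a : T -> R) f : measurable_fun D a -> measurable_fun D f ->
  measurable_fun D (fun t => a t *: f t).
Proof.
move=> ma mf; apply: measurable_rVP => i.
rewrite (_ : (fun t => _) = (fun t => a t * f t 0 i)); last by apply/funext => t; rewrite mxE.
by apply: measurable_funM => //; apply: measurable_coord_fun.
Qed.

Lemma measurable_rVB f g : measurable_fun D f -> measurable_fun D g ->
  measurable_fun D (fun t => f t - g t).
Proof.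
move=> mf mg; apply: measurable_rVP => i.
rewrite (_ : (fun t => _) = (fun t => f t 0 i - g t 0 i)); last by apply/funext => t; rewrite !mxE.
by apply: measurable_funB; apply: measurable_coord_fun.
Qed.

End norms.

Context {n : nat}.

Definition cube (x : 'rV[R]_n) (r : R) : set 'rV[R]_n :=
  [set y | forall i, `|y 0 i - x 0 i| <= r].

Lemma measurable_cube x r : measurable (cube x r).
Proof.
rewrite (_ : cube x r = \bigcap_(i in [set: 'I_n])
   ((fun y : 'rV[R]_n => `|y 0 i - x 0 i|) @^-1` `]-oo, r])); last first.
  by apply/seteqP; split => y /= h i => [_|]; have := h i; rewrite /= in_itv //=; apply.
apply: fin_bigcap_measurable => [|i _]; first exact: finite_finset.
rewrite -[X in measurable X]setTI.
apply: (_ : measurable_fun setT _) => //.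
apply: measurableT_comp => //; apply: measurable_funB => //.
exact: measurable_coord.
Qed.

(** An open set is the union of the countably many rational cubes that it
    contains. *)
Lemma open_measurable_rV (A : set 'rV[R]_n) : open A -> measurable A.
Proof.
move=> oA.
pose F (p : 'rV[rat]_n * nat) : set 'rV[R]_n :=
  let C := cube (\row_i ratr (p.1 0 i)) (p.2.+1%:R^-1) in
  if `[< C `<=` A >] then C else set0.
rewrite (_ : A = \bigcup_p F p).
  apply: countable_bigcupT_measurable => [|p]; first exact: countableP.
  by rewrite /F; case: ifP => // _; exact: measurable_cube.
apply/seteqP; split => [x Ax|x [p _]]; last first.
  by rewrite /F; case: asboolP => // h; apply: h.
have /nbhs_ballP[e /= e0 xeA] : nbhs x A by exact: open_nbhs_nbhs.
have [k ke] : exists k, k.+1%:R^-1 < e / 2.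
  exists (Num.truncn (e / 2)^-1).
  have e2 : 0 < e / 2 by rewrite divr_gt0.
  by rewrite invf_plt ?posrE// truncnS_gt.
have q_ i : {q : rat | `|x 0 i - ratr q| <= k.+1%:R^-1}.
  apply: cid.
  have [q] : exists q, ratr q \in `](x 0 i - k.+1%:R^-1), (x 0 i + k.+1%:R^-1)[%R.
    by apply: rat_in_itvoo; rewrite ltrBlDr -addrA ltrDl addr_gt0 ?invr_gt0.
  rewrite in_itv /= => /andP[h1 h2]; exists q.
  by rewrite ler_distlC !ltW.
exists (\row_i sval (q_ i), k) => //; rewrite /F /=.
have qE i : (\row_i0 ratr ((\row_i1 sval (q_ i1)) 0 i0) : 'rV[R]_n) 0 i = ratr (sval (q_ i)).
  by rewrite !mxE.
case: asboolP => [_ i|]; first by rewrite qE; exact: (svalP (q_ i)).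
case=> y hy; apply: xeA; split => //= i j; rewrite (ord1 i) /ball /=.
have := hy j; rewrite qE; have := svalP (q_ j); set q := ratr _ => h1 h2.
rewrite (_ : x 0 j - y 0 j = (x 0 j - q) - (y 0 j - q)); last by rewrite opprB addrA subrK.
rewrite (le_lt_trans (ler_normB _ _))// (le_lt_trans (lerD h1 h2))//.
by rewrite (splitr e) ltrD.
Qed.

End measurability.

Lemma lebesgue_cube (R : realType) n (x : 'rV[R]_n) r : 0 <= r ->
  lebesgue_rV (cube x r) = ((2 * r) ^+ n)%:E.
Proof.
move=> r0; elim: n x => [|n IH] x.
  by rewrite expr0 /= diracE (_ : 0 \in _)// inE => -[].
have E (t : R) : [set y | cube x r (rV_cons (t, y))] =
    if `|t - x 0 0| <= r then cube (rsubmx (x : 'rV_(1 + n))) r else set0.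
  have e0 y : (rV_cons (t, y)) 0 0 = t by rewrite rV_cons0.
  case: ifP => h; apply/seteqP; split => y //=.
  - by move=> hy i; have := hy (rshift 1 i); rewrite rV_consS mxE.
  - move=> hy i; have [->|[k ->]] := ord_consP i; first by rewrite e0.
    by rewrite rV_consS; have := hy k; rewrite mxE.
  - by move=> /(_ 0); rewrite e0 h.
transitivity (\int[@lebesgue_measure R]_(t in `[(x 0%R 0%R - r)%R, (x 0%R 0%R + r)%R]) cst ((2 * r) ^+ n)%R%:E t)%E.
  rewrite [RHS]integral_mkcond; apply: eq_integral => t _; rewrite E patchE.
  have -> : (t \in `[x 0 0 - r, x 0 0 + r]%classic) = (`|t - x 0 0| <= r).
    by rewrite mem_setE in_itv /= distrC ler_distlC.
  by case: ifP => _; [exact: IH|exact: lebesgue_rV_set0].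
rewrite integral_cst//= lebesgue_measure_itv /= lte_fin.
case: ifPn => h.
  rewrite -EFinB -EFinM; congr EFin; rewrite exprS; ring.
have -> : r = 0 by apply/eqP; rewrite eq_le r0 andbT; move: h; rewrite -leNgt; lra.
by rewrite mule0 mulr0 expr0n.
Qed.

Section singular_kernel.
Context {R : realType} {d : nat}.
Hypothesis d2 : (1 < d)%N.
Local Notation leb := (@lebesgue_rV R d).
Implicit Types (x y : 'rV[R]_d).

(** The Riesz kernel |y - x|^(-3/2), with value 0 on the diagonal. *)
Definition riesz x y : R := (enorm (y - x) * Num.sqrt (enorm (y - x)))^-1.

Lemma riesz_ge0 x y : 0 <= riesz x y.
Proof. by rewrite invr_ge0 mulr_ge0 ?enorm_ge0 ?sqrtr_ge0. Qed.

Lemma dyadic_scale (r : R) : 0 < r <= 1 -> exists k, 4^-1 ^+ k.+1 < r <= 4^-1 ^+ k.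
Proof.
move=> /andP[r0 r1].
have ex : exists n, 4^-1 ^+ n < r.
  have h0 : (fun n => 4^-1 ^+ n : R) @ \oo --> (0 : R).
    apply: cvg_expr; rewrite ger0_norm ?invr_ge0//; lra.
  have [n _ /(_ n (leqnn n))] := (cvgrPdist_lt _ _).1 h0 _ r0.
  move=> /= hn; exists n; apply: le_lt_trans hn.
  by rewrite sub0r normrN ler_norm.
case: (ex_minnP ex) => -[|k] hk hmin; first by move: hk; rewrite expr0 ltNge r1.
exists k; rewrite hk /= leNgt; apply/negP => /hmin; by rewrite ltnn.
Qed.

(** On the shell 4^-(k+1) < |y - x| <= 4^-k the kernel is below 8^(k+1).  Only
    cubes have to be measured to integrate the right-hand side. *)
Lemma riesz_le_series x y :
  ((riesz x y)%:E <= 1 + \sum_(0 <= k <oo) ((8 ^+ k.+1)%:E * (\1_(cube x (4^-1 ^+ k)) y)%:E))%E.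
Proof.
have t0 k : (0 <= (8 ^+ k.+1)%:E * (\1_(cube x (4^-1 ^+ k)) y)%:E :> \bar R)%E.
  by rewrite mule_ge0 ?lee_fin ?exprn_ge0.
have s0 : (0 <= \sum_(0 <= k <oo) ((8 ^+ k.+1)%:E * (\1_(cube x (4^-1 ^+ k)) y)%:E) :> \bar R)%E.
  by apply: nneseries_ge0.
have [r1|r1] := leP (enorm (y - x)) 1; last first.
  have rp := lt_trans ltr01 r1.
  rewrite -[leLHS]adde0 leeD// lee_fin invf_le1 ?mulr_gt0 ?(sqrtr_gt0 (enorm _))//.
  by rewrite -[leLHS]mulr1 ler_pM// ?(ltW r1)// -[leLHS]sqrtr1 ler_wsqrtr// ltW.
have [r0|] := ltrP 0 (enorm (y - x)); last first.
  move=> r0; have -> : riesz x y = 0.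
    rewrite /riesz; have -> : enorm (y - x) = 0 by apply/eqP; rewrite eq_le r0 enorm_ge0.
    by rewrite mul0r invr0.
  by rewrite adde_ge0.
have [|k /andP[kl kr]] := @dyadic_scale (enorm (y - x)); first by rewrite r0.
rewrite -[leLHS]add0e leeD//.
apply: (@le_trans _ _ (\sum_(0 <= i < k.+1) ((8 ^+ i.+1)%:E * (\1_(cube x (4^-1 ^+ i)) y)%:E)%E)); last first.
  by apply: nneseries_lim_ge.
rewrite big_nat_recr //= -[leLHS]add0e leeD ?sume_ge0//.
rewrite indicE mem_set; last by move=> i; rewrite (le_trans _ kr)//; have := coord_le_enorm (y - x) i; rewrite !mxE.
rewrite mule1 lee_fin -[leRHS]invrK lef_pV2 ?posrE ?invr_gt0 ?exprn_gt0 ?mulr_gt0 ?(sqrtr_gt0 (enorm _))//.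
have -> : (8 ^+ k.+1)^-1 = 4^-1 ^+ k.+1 * 2^-1 ^+ k.+1 :> R.
  by rewrite -exprMn -invfM -exprVn; congr (_^-1 ^+ _); ring.
apply: ler_pM; rewrite ?exprn_ge0 ?(ltW kl)//.
rewrite -(ler_pXn2r (n := 2)) ?nnegrE ?exprn_ge0 ?sqrtr_ge0//.
rewrite sqr_sqrtr ?enorm_ge0// -exprM mulnC exprM.
by rewrite (_ : 2^-1 ^+ 2 = 4^-1) ?(ltW kl)// expr2 -invfM; congr (_^-1); ring.
Qed.

Lemma measurable_riesz D x : measurable_fun D (riesz x).
Proof.
have m1 : measurable_fun D (fun y => enorm (y - x)).
  by apply: measurable_enorm; apply: measurable_rVB => //; apply: measurable_cst.
apply: (measurableT_comp measurable_invr); apply: measurable_funM => //.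
exact: (measurableT_comp measurable_sqrt).
Qed.

Definition riesz_bound (Om : set 'rV[R]_d) : R := fine (leb Om) + 16 * 2 ^+ d.

(** The k-th term of the dyadic series integrates to at most
    8^(k+1) (2 4^-k)^d <= 8 2^d 2^-k, because d >= 2. *)
Lemma riesz_integral_le (Om : set 'rV[R]_d) x : measurable Om -> (leb Om < +oo)%E ->
  (\int[leb]_(y in Om) (riesz x y)%:E <= (riesz_bound Om)%:E)%E.
Proof.
move=> mOm fOm.
pose F k y : \bar R := ((8 ^+ k.+1)%:E * (\1_(cube x (4^-1 ^+ k)) y)%:E)%E.
have F0 k y : (0 <= F k y)%E by rewrite mule_ge0 ?lee_fin ?exprn_ge0.
have mF k D : measurable_fun D (F k).
  apply: emeasurable_funM => //; apply/measurable_EFinP.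
  by apply: measurable_indic; exact: measurable_cube.
apply: (@le_trans _ _ (\int[leb]_(y in Om) (1 + \sum_(0 <= k <oo) F k y))%E).
  apply: ge0_le_integral => //.
  - by move=> y _; rewrite lee_fin riesz_ge0.
  - by apply/measurable_EFinP; exact: measurable_riesz.
  - by apply: emeasurable_funD => //; apply: ge0_emeasurable_sum.
  - by move=> y _; exact: riesz_le_series.
rewrite ge0_integralD//; last 2 first.
  by move=> y _; apply: nneseries_ge0.
  by apply: ge0_emeasurable_sum.
rewrite (_ : (\int[leb]_(y in Om) 1 = leb Om)%E); last by rewrite integral_cst// mul1e.
rewrite EFinD fineK ?ge0_fin_numE//= leeD//.
rewrite integral_nneseries//.
have := @cvg_geometric_eseries_half R (16 * 2 ^+ d) 0.
rewrite expr0 divr1 => /cvg_lim <- //.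
apply: lee_nneseries => [k _ _|k _]; first exact: integral_ge0.
rewrite ge0_integralZl//; last first.
  by apply/measurable_EFinP; apply: measurable_indic; exact: measurable_cube.
rewrite integral_indic//; last exact: measurable_cube.
apply: (@le_trans _ _ ((8 ^+ k.+1)%:E * leb (cube x (4^-1 ^+ k)))%E).
  rewrite lee_wpmul2l ?lee_fin ?exprn_ge0// le_measure ?inE//.
    by apply: measurableI => //; exact: measurable_cube.
  exact: measurable_cube.
rewrite [lebesgue_rV _]lebesgue_cube ?exprn_ge0// -EFinM lee_fin.
rewrite addn1 exprMn.
have h : (4^-1 ^+ k) ^+ d <= (4^-1 ^+ k) ^+ 2 :> R.
  by rewrite ler_wiXn2l ?exprn_ge0// exprn_ile1// ; lra.
have -> : 16 * 2 ^+ d / (2 ^ k.+1)%:R = 8 ^+ k.+1 * (2 ^+ d * (4^-1 ^+ k) ^+ 2) :> R.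
  have -> : (2 ^ k.+1)%:R^-1 = 2^-1 * (8 ^+ k * ((4^-1 ^+ k) ^+ 2)) :> R.
    rewrite natrX exprS invfM; congr (_ * _).
    rewrite -[(4^-1 ^+ k) ^+ 2]exprM mulnC [4^-1 ^+ _]exprM -exprMn -exprVn.
    by congr (_ ^+ _); lra.
  by rewrite [8 ^+ k.+1]exprS; field.
by rewrite ler_wpM2l ?exprn_ge0// ler_wpM2l ?exprn_ge0.
Qed.

Lemma bounded_open_finite (Om : set 'rV[R]_d) : open Om -> bounded_set Om ->
  measurable Om /\ (leb Om < +oo)%E.
Proof.
move=> oOm bOm; have mOm := open_measurable_rV oOm; split => //.
have [M [Mr hM]] := bOm.
pose r := Num.max 0 (M + 1).
have r0 : 0 <= r by rewrite le_max lexx.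
have sub : Om `<=` cube 0 r.
  move=> y Oy i; rewrite mxE subr0.
  apply: (@le_trans _ _ `|y|); last first.
    by apply: hM => //; rewrite /r lt_max ltrDl ltr01 orbT.
  rewrite -[`|y|]/(mx_norm y) mx_normrE; exact: (le_bigmax _ (fun i : 'I_1 * 'I_d => `|y i.1 i.2|) (0, i)).
apply: (@le_lt_trans _ _ (leb (cube 0 r))).
  by apply: le_measure => //; rewrite inE//; exact: measurable_cube.
by rewrite [lebesgue_rV _]lebesgue_cube// ltry.
Qed.

End singular_kernel.

(** * Integrals over bonds *)

Section dominated_integrals.
Context {dd} {T : measurableType dd} {R : realType} (mu : {measure set T -> \bar R}).
Implicit Types (D : set T) (f g : T -> R).

Lemma ae_le_integrable D f (g : T -> R) : measurable D ->
  measurable_fun D f -> mu.-integrable D (EFin \o g) ->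
  {ae mu, forall x, D x -> `|f x| <= g x} -> mu.-integrable D (EFin \o f).
Proof.
move=> mD mf /[dup] ig /integrableP[mg gfin] fg.
apply/integrableP; split; first exact/measurable_EFinP.
apply: le_lt_trans gfin; apply: ae_ge0_le_integral => //.
- by do 2?apply: measurableT_comp => //; apply/measurable_EFinP.
- by apply: measurableT_comp => //; apply/measurable_EFinP/measurable_EFinP.
- apply: filterS fg => x h Dx /=; rewrite lee_fin (le_trans (h Dx))//.
  exact: ler_norm.
Qed.

Lemma ae_le_Rintegral D f (g : T -> R) : measurable D ->
  measurable_fun D f -> mu.-integrable D (EFin \o g) ->
  (forall x, D x -> 0 <= g x) ->
  {ae mu, forall x, D x -> `|f x| <= g x} ->
  `|\int[mu]_(x in D) f x| <= \int[mu]_(x in D) g x.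
Proof.
move=> mD mf ig g0 fg; have iF := ae_le_integrable mD mf ig fg.
apply: le_trans (le_normr_Rintegral mD iF) _.
have ia : mu.-integrable D (EFin \o (fun x => `|f x|)).
  by have := integrable_abse iF.
rewrite /Rintegral fine_le//; try by apply: integrable_fin_num.
apply: ae_ge0_le_integral => //.
- exact: measurable_int ia.
- exact: measurable_int ig.
Qed.

Lemma cst_integrable D (B : R) : measurable D -> (mu D < +oo)%E ->
  mu.-integrable D (EFin \o cst B).
Proof.
move=> mD fD; apply/integrableP; split; first by apply/measurable_EFinP; exact: measurable_cst.
by have /= -> := integral_cst mu mD `|B|%:E; rewrite lte_mul_pinfty.
Qed.

Lemma ae_bounded_integrable D f (B : R) : measurable D -> (mu D < +oo)%E ->
  measurable_fun D f -> {ae mu, forall x, D x -> `|f x| <= B} ->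
  mu.-integrable D (EFin \o f).
Proof.
move=> mD fD mf fB; apply: (ae_le_integrable (g := cst B)) => //.
exact: cst_integrable.
Qed.

Lemma ae_bounded_Rintegral D f (B : R) : measurable D -> (mu D < +oo)%E -> 0 <= B ->
  measurable_fun D f -> {ae mu, forall x, D x -> `|f x| <= B} ->
  `|\int[mu]_(x in D) f x| <= B * fine (mu D).
Proof.
move=> mD fD B0 mf fB; rewrite -(@Rintegral_cst _ _ _ mu D)//.
by apply: (ae_le_Rintegral (g := cst B)) => //; exact: cst_integrable.
Qed.

Lemma ae_eq_Rintegral D f g : measurable D ->
  measurable_fun D f -> measurable_fun D g ->
  {ae mu, forall x, D x -> f x = g x} ->
  \int[mu]_(x in D) f x = \int[mu]_(x in D) g x.
Proof.
move=> mD mf mg fg; congr fine; apply: ae_eq_integral => //; try exact/measurable_EFinP.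
by apply: filterS fg => x h Dx; rewrite h.
Qed.

End dominated_integrals.

Section tonelli_section.
Context {d1 d2} {T1 : measurableType d1} {T2 : measurableType d2} {R : realType}.
Variable m2 : {sigma_finite_measure set T2 -> \bar R}.

(** By Tonelli's theorem for the positive and the negative part. *)
Lemma measurable_section_integral (f : T1 * T2 -> \bar R) : measurable_fun setT f ->
  measurable_fun setT (fun x => \int[m2]_y f (x, y))%E.
Proof.
move=> mf.
pose F1 x := (\int[m2]_y f^\+ (x, y))%E; pose F2 x := (\int[m2]_y f^\- (x, y))%E.
have -> : (fun x => \int[m2]_y f (x, y))%E = (F1 \- F2)%E.
  apply/funext => x; rewrite [LHS]integralE.
  under eq_integral do rewrite funepos_comp/=.
  by under [X in (_ - X)%E = _]eq_integral do rewrite funeneg_comp/=.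
apply: emeasurable_funB.
  by apply: measurable_fun_fubini_tonelli_F => //; exact: measurable_funepos.
by apply: measurable_fun_fubini_tonelli_F => //; exact: measurable_funeneg.
Qed.

Lemma integrable_section2 (m1 : {sigma_finite_measure set T1 -> \bar R})
    (f : T1 * T2 -> \bar R) : (m1 \x m2)%E.-integrable setT f ->
  m2.-integrable setT (fun y => \int[m1]_x f (x, y))%E.
Proof.
move=> imf; have mf : measurable_fun setT f := measurable_int _ imf.
have mG := measurable_fubini_G imf.
apply/integrableP; split => //.
apply: le_lt_trans ((integrable21ltyP m1 m2 mf).1 imf).
apply: ge0_le_integral => //.
- exact: measurableT_comp.
- apply: (measurable_fun_fubini_tonelli_G (abse \o f)) => [|z].
    exact: measurableT_comp.
  exact: abse_ge0.
- move=> y _; apply: le_abse_integral => //.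
  exact: measurable_fun_pair1.
Qed.

End tonelli_section.

Section bond_integrals.
Context {R : realType} {d : nat}.
Hypothesis d2 : (1 < d)%N.
Context (Om : set 'rV[R]_d) (eps : R).
Local Notation leb := (@lebesgue_rV R d).
Hypotheses (mOm : measurable Om) (fOm : (leb Om < +oo)%E).
Implicit Types (k : 'rV[R]_d -> 'rV[R]_d -> R) (x y : 'rV[R]_d) (K : R).
Local Notation hor := (horizon Om eps).

Definition bond_measurable k : Prop :=
  measurable_fun (Om `*` Om) (fun p => k p.1 p.2).

(** The bound is only required for almost every y, because it is applied with
    fields that are bounded almost everywhere. *)
Definition bond_le_at K k x : Prop :=
  {ae leb, forall y, hor x y -> `|k x y| <= K * riesz x y}.

Definition bond_le K k : Prop := {ae leb, forall x, Om x -> bond_le_at K k x}.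

Definition bond_int k x : R := \int[leb]_(y in hor x) k x y.

Definition bond_int2 k : R := \int[leb]_(x in Om) bond_int k x.

Let C0 := riesz_bound Om.

Lemma riesz_bound_ge0 : 0 <= C0.
Proof. by rewrite addr_ge0 ?fine_ge0// mulr_ge0// exprn_ge0. Qed.

Lemma measurable_horizon x : measurable (hor x).
Proof.
apply: measurableI => //.
rewrite (_ : eball _ _ = (fun y => enorm (y - x)) @^-1` `]-oo, eps[); last first.
  by apply/seteqP; split => y; rewrite /eball /= in_itv.
rewrite -[X in measurable X]setTI; apply: (_ : measurable_fun setT _) => //.
by apply: measurable_enorm; apply: measurable_rVB => //; exact: measurable_cst.
Qed.

Lemma horizon_sub x : hor x `<=` Om. Proof. by move=> y []. Qed.

Lemma bond_measurable_at k x : bond_measurable k -> Om x -> measurable_fun Om (k x).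
Proof.
move=> mk Omx.
apply: (@measurable_comp _ _ _ _ _ _ (Om `*` Om) (fun p => k p.1 p.2) Om (pair x)) => //.
- exact: measurableX.
- by move=> _ [y Oy <-].
- by apply: measurable_funTS; exact: pair1_measurable.
Qed.

Lemma bond_measurable_hor k x : bond_measurable k -> Om x -> measurable_fun (hor x) (k x).
Proof.
by move=> mk Ox; apply: measurable_funS mOm (@horizon_sub x) _; exact: bond_measurable_at.
Qed.

Lemma riesz_integrable K x : leb.-integrable (hor x) (EFin \o (fun y => K * riesz x y)).
Proof.
have mh := measurable_horizon x.
rewrite (_ : EFin \o _ = (fun y => K%:E * (EFin \o riesz x) y)%E); last first.
  by apply/funext => y; rewrite /= EFinM.
apply: integrableZl => //.
apply/integrableP; split; first by apply/measurable_EFinP; exact: measurable_riesz.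
apply: le_lt_trans (ltry C0); apply: le_trans (riesz_integral_le d2 x mOm fOm).
rewrite (eq_integral (EFin \o riesz x)); last first.
  by move=> y _ /=; rewrite ger0_norm ?riesz_ge0.
apply: ge0_subset_integral => //.
- by apply/measurable_EFinP; exact: measurable_riesz.
- by move=> y _; rewrite lee_fin riesz_ge0.
- exact: horizon_sub.
Qed.

Lemma riesz_Rintegral_le K x : 0 <= K -> \int[leb]_(y in hor x) (K * riesz x y) <= K * C0.
Proof.
move=> K0; have mh := measurable_horizon x.
have i1 : leb.-integrable (hor x) (EFin \o riesz x).
  have := riesz_integrable 1 x; by under [X in EFin \o X]eq_fun do rewrite mul1r.
rewrite RintegralZl// ler_wpM2l// -lee_fin /Rintegral fineK; last exact: integrable_fin_num.
apply: le_trans (riesz_integral_le d2 x mOm fOm).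
apply: ge0_subset_integral => //.
- by apply/measurable_EFinP; exact: measurable_riesz.
- by move=> y _; rewrite lee_fin riesz_ge0.
- exact: horizon_sub.
Qed.

Lemma bond_integrable k K x : bond_measurable k -> Om x -> bond_le_at K k x ->
  leb.-integrable (hor x) (EFin \o k x).
Proof.
move=> mk Ox kK; apply: (ae_le_integrable (g := fun y => K * riesz x y)) => //.
- exact: measurable_horizon.
- exact: bond_measurable_hor.
- exact: riesz_integrable.
Qed.

Lemma bond_int_le k K x : bond_measurable k -> 0 <= K -> Om x -> bond_le_at K k x ->
  `|bond_int k x| <= K * C0.
Proof.
move=> mk K0 Ox kK; apply: le_trans (riesz_Rintegral_le x K0).
apply: ae_le_Rintegral => //.
- exact: measurable_horizon.
- exact: bond_measurable_hor.
- exact: riesz_integrable.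
- by move=> y _; rewrite mulr_ge0// riesz_ge0.
Qed.

Let H : set ('rV[R]_d * 'rV[R]_d) := [set p | Om p.1 /\ hor p.1 p.2].

Let mH : measurable H.
Proof.
rewrite (_ : H = (Om `*` Om) `&` ((fun p => enorm (p.2 - p.1)) @^-1` `]-oo, eps[)); last first.
  apply/seteqP; split => -[x y]; rewrite /H /= in_itv /=.
    by move=> [Ox [xy Oy]].
  by move=> [[Ox Oy] xy].
apply: measurableI; first exact: measurableX.
rewrite -[X in measurable X]setTI; apply: (_ : measurable_fun setT _) => //.
by apply: measurable_enorm; apply: measurable_rVB; [exact: measurable_snd|exact: measurable_fst].
Qed.

Let ext k (p : 'rV[R]_d * 'rV[R]_d) : \bar R := (((fun p => k p.1 p.2) \_ H) p)%:E.

Let measurable_ext k : bond_measurable k -> measurable_fun setT (ext k).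
Proof.
move=> mk; apply/measurable_EFinP/(measurable_restrictT _ mH).
apply: measurable_funS mk; first exact: measurableX.
by move=> [x y] [/= ? [_ ?]]; split.
Qed.

Let extE k x : Om x -> (\int[leb]_y ext k (x, y) = \int[leb]_(y in hor x) (k x y)%:E)%E.
Proof.
move=> Ox; rewrite [RHS]integral_mkcond; apply: eq_integral => y _.
rewrite /ext !patchE; have -> : ((x, y) \in H) = (y \in hor x).
  by apply/idP/idP; rewrite !inE; [case|split].
by case: ifP.
Qed.

Let ext_out k x : ~ Om x -> (\int[leb]_y ext k (x, y) = 0)%E.
Proof.
move=> nOx; apply: integral0_eq => y _; rewrite /ext patchE memNset//.
by move=> -[].
Qed.

Lemma measurable_bond_int k : bond_measurable k -> measurable_fun Om (bond_int k).
Proof.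
move=> mk; have m1 := measurable_section_integral leb (measurable_ext mk).
apply: (eq_measurable_fun (fine \o (fun x => \int[leb]_y ext k (x, y))%E)).
  by move=> x; rewrite inE => Ox /=; rewrite extE.
apply: measurable_funTS; exact: (measurableT_comp (fine_measurable measurableT) m1).
Qed.

Lemma bond_int_bounded k K : bond_measurable k -> 0 <= K -> bond_le K k ->
  {ae leb, forall x, Om x -> `|bond_int k x| <= K * C0}.
Proof.
move=> mk K0; apply: filterS => x h Ox; exact: bond_int_le (h Ox).
Qed.

Lemma bond_int_integrable k K : bond_measurable k -> 0 <= K -> bond_le K k ->
  leb.-integrable Om (EFin \o bond_int k).
Proof.
move=> mk K0 kK; apply: (ae_bounded_integrable _ _ _ (bond_int_bounded mk K0 kK)) => //.
exact: measurable_bond_int.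
Qed.

Lemma bond_int2_le k K : bond_measurable k -> 0 <= K -> bond_le K k ->
  `|bond_int2 k| <= K * C0 * fine (leb Om).
Proof.
move=> mk K0 kK; apply: ae_bounded_Rintegral => //; last exact: bond_int_bounded.
  by rewrite mulr_ge0// riesz_bound_ge0.
exact: measurable_bond_int.
Qed.

Let ext_integrable k K : bond_measurable k -> 0 <= K -> bond_le K k ->
  (leb \x leb)%E.-integrable setT (ext k).
Proof.
move=> mk K0 kK; apply/integrable12ltyP; first exact: measurable_ext.
have mka : bond_measurable (fun x y => `|k x y|) by exact: measurableT_comp.
apply: (@le_lt_trans _ _ (\int[leb]_(x in Om) (cst (K * C0)%:E x))%E); last first.
  by rewrite integral_cst// lte_mul_pinfty// lee_fin mulr_ge0// riesz_bound_ge0.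
rewrite [leRHS]integral_mkcond; apply: ae_ge0_le_integral => //.
- by move=> x _; apply: integral_ge0.
- apply: (measurable_section_integral leb (f := abse \o ext k)).
  by apply: measurableT_comp => //; exact: measurable_ext.
- by move=> x _; rewrite patchE; case: ifP => // _; rewrite lee_fin mulr_ge0// riesz_bound_ge0.
- by apply/(measurable_restrictT _ mOm); exact: measurable_cst.
apply: filterS kK => x h _; rewrite patchE.
have -> : (\int[leb]_y `|ext k (x, y)| = \int[leb]_y ext (fun x y => `|k x y|%R) (x, y))%E.
  by apply: eq_integral => y _; rewrite /ext !patchE; case: ifP => //; rewrite /= ?normr0.
have [xO|xO] := boolP (x \in Om); last first.
  by rewrite ext_out//; move: xO; rewrite notin_setE.
move: xO; rewrite inE => Ox; rewrite extE//.
have kx : bond_le_at K (fun x y => `|k x y|) x.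
  by apply: filterS (h Ox) => y hy /hy; rewrite normr_id.
have i := bond_integrable mka Ox kx.
rewrite -[leLHS]fineK; last by apply: integrable_fin_num => //; exact: measurable_horizon.
by rewrite lee_fin (le_trans (ler_norm _))//; exact: (bond_int_le mka K0 Ox kx).
Qed.

Let bond_int2E k (F : 'rV[R]_d -> \bar R) : leb.-integrable setT F ->
  (forall x, Om x -> F x = \int[leb]_(y in hor x) (k x y)%:E)%E ->
  (forall x, ~ Om x -> F x = 0%E) ->
  bond_int2 k = fine (\int[leb]_x F x).
Proof.
move=> iF FE F0; congr fine; rewrite [LHS]integral_mkcond.
have mF : measurable_fun setT F := measurable_int _ iF.
apply: ae_eq_integral => //.
  apply/(measurable_restrictT _ mOm)/measurable_EFinP.
  apply: (eq_measurable_fun (fine \o F)).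
    by move=> x; rewrite inE => Ox /=; rewrite FE.
  by apply: measurable_funTS; exact: (measurableT_comp (fine_measurable measurableT) mF).
have := integrable_ae measurableT iF; apply: filterS => x h _.
rewrite patchE; have [xO|xO] := boolP (x \in Om).
  by move: xO; rewrite inE => Ox; rewrite /= /bond_int /Rintegral -FE// fineK// h.
by rewrite F0//; move: xO; rewrite notin_setE.
Qed.

(** Fubini's theorem; the set of bonds is symmetric, so exchanging the order of
    integration amounts to exchanging the two ends of the bond in k. *)
Lemma bond_int2_swap k K : bond_measurable k -> 0 <= K -> bond_le K k ->
  bond_int2 k = bond_int2 (fun x y => k y x).
Proof.
move=> mk K0 kK; have iext := ext_integrable mk K0 kK.
rewrite (@bond_int2E k (fun x => \int[leb]_y ext k (x, y))%E); first last.
- exact: ext_out.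
- exact: extE.
- exact: (integrable_fubini_F iext).
rewrite (@bond_int2E _ (fun y => \int[leb]_x ext k (x, y))%E); first last.
- move=> y nOy; apply: integral0_eq => x _; rewrite /ext patchE memNset//.
  by move=> -[_ []].
- move=> y Oy; rewrite [RHS]integral_mkcond; apply: eq_integral => x _.
  rewrite /ext !patchE; have -> : ((x, y) \in H) = (x \in hor y).
    apply/idP/idP; rewrite !inE /H /horizon /eball /= (enormB y x).
      by move=> [Ox [xy _]].
    by move=> [xy Ox].
  by case: ifP.
- exact: (integrable_section2 iext).
by rewrite (Fubini iext).
Qed.

Lemma bond_intD k1 k2 K1 K2 x : bond_measurable k1 -> bond_measurable k2 -> Om x ->
  bond_le_at K1 k1 x -> bond_le_at K2 k2 x ->
  bond_int (fun x y => k1 x y + k2 x y) x = bond_int k1 x + bond_int k2 x.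
Proof.
move=> m1 m2 Ox h1 h2; apply: RintegralD; first exact: measurable_horizon.
- exact: bond_integrable h1.
- exact: bond_integrable h2.
Qed.

Lemma bond_intZ (a : R) k K x : bond_measurable k -> Om x -> bond_le_at K k x ->
  bond_int (fun x y => a * k x y) x = a * bond_int k x.
Proof.
move=> mk Ox h; apply: RintegralZl; first exact: measurable_horizon.
exact: bond_integrable h.
Qed.

Lemma eq_bond_int k1 k2 x : (forall y, hor x y -> k1 x y = k2 x y) ->
  bond_int k1 x = bond_int k2 x.
Proof. by move=> h; apply: eq_Rintegral => y; rewrite inE => /h. Qed.

Lemma ae_eq_bond_int k1 k2 x : bond_measurable k1 -> bond_measurable k2 -> Om x ->
  {ae leb, forall y, hor x y -> k1 x y = k2 x y} -> bond_int k1 x = bond_int k2 x.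
Proof.
move=> m1 m2 Ox h; apply: ae_eq_Rintegral => //; try exact: bond_measurable_hor.
exact: measurable_horizon.
Qed.

Lemma bond_int2D k1 k2 K1 K2 : bond_measurable k1 -> bond_measurable k2 ->
  0 <= K1 -> 0 <= K2 -> bond_le K1 k1 -> bond_le K2 k2 ->
  bond_int2 (fun x y => k1 x y + k2 x y) = bond_int2 k1 + bond_int2 k2.
Proof.
move=> m1 m2 K10 K20 h1 h2.
rewrite /bond_int2 -RintegralD//; try exact: bond_int_integrable.
  apply: ae_eq_Rintegral => //.
  - by apply: measurable_bond_int; exact: measurable_funD.
  - by apply: measurable_funD; exact: measurable_bond_int.
  - by apply: filterS2 h1 h2 => x h1 h2 Ox; apply: bond_intD (h1 Ox) (h2 Ox).
- exact: bond_int_integrable h1.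
- exact: bond_int_integrable h2.
Qed.

Lemma bond_int2Z (a : R) k K : bond_measurable k -> 0 <= K -> bond_le K k ->
  bond_int2 (fun x y => a * k x y) = a * bond_int2 k.
Proof.
move=> mk K0 h.
rewrite /bond_int2 -RintegralZl//; last exact: bond_int_integrable h.
apply: ae_eq_Rintegral => //.
- by apply: measurable_bond_int; apply: measurable_funM => //; exact: measurable_cst.
- by apply: measurable_funM; [exact: measurable_cst|exact: measurable_bond_int].
- by apply: filterS h => x h Ox; apply: bond_intZ (h Ox).
Qed.

Lemma eq_bond_int2 k1 k2 : bond_measurable k1 -> bond_measurable k2 ->
  {ae leb, forall x, Om x -> {ae leb, forall y, hor x y -> k1 x y = k2 x y}} ->
  bond_int2 k1 = bond_int2 k2.
Proof.
move=> m1 m2 h; apply: ae_eq_Rintegral => //; try exact: measurable_bond_int.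
by apply: filterS h => x h Ox; apply: ae_eq_bond_int => //; exact: h.
Qed.

End bond_integrals.

(** * Essentially bounded fields *)

Lemma cauchy_geometric (R : realType) (c : R) (a : nat -> R) :
  (forall n m, (n <= m)%N -> `|a m - a n| <= c * 2^-1 ^+ n) ->
  exists2 l : R, a n @[n --> \oo] --> l & forall n, `|l - a n| <= c * 2^-1 ^+ n.
Proof.
move=> h.
have h0 : (fun n => c * 2^-1 ^+ n) @ \oo --> (0 : R).
  rewrite -[X in _ --> X](mulr0 c); apply: cvgMl_tmp; apply: cvg_expr.
  by rewrite ger0_norm ?invr_ge0// invf_lt1// ltr1n.
have /cauchy_cvgP /cvg_ex[l al] : cauchy (a @ \oo).
  apply: cauchy_exP => e e0.
  have [n _ /(_ n (leqnn n)) hn] := (cvgrPdist_lt _ _).1 h0 _ e0.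
  exists (a n); exists n => // m /= nm; rewrite /ball /= distrC.
  apply: le_lt_trans (h _ _ nm) _; apply: le_lt_trans hn.
  by rewrite sub0r normrN ler_norm.
exists l => // n.
have hl : `|a m - a n| @[m --> \oo] --> `|l - a n|.
  by apply: cvg_norm; apply: cvgB => //; exact: cvg_cst.
by apply: (cvgr_to_le hl); exists n => // m /= nm; exact: h.
Qed.

Section essential_bound.
Context {R : realType} {d : nat}.
Context (Om : set 'rV[R]_d).
Local Notation leb := (@lebesgue_rV R d).
Hypotheses (mOm : measurable Om) (fOm : (leb Om < +oo)%E).
Local Notation field := ('rV[R]_d -> 'rV[R]_d).
Implicit Types (u v w : field) (M : R).

Definition ess_le M u : Prop := {ae leb, forall x, Om x -> enorm (u x) <= M}.

Definition normoo u : R := fine (linf_norm Om u).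

Lemma lebesgue_setT_gt0 : (0 < leb setT)%E.
Proof.
apply: (@lt_le_trans _ _ (leb (cube 0 1))).
  by rewrite [lebesgue_rV _]lebesgue_cube// lte_fin exprn_gt0// mulr1.
by apply: le_measure; rewrite ?inE//; exact: measurable_cube.
Qed.

Lemma linf_normP u M : 0 <= M -> (linf_norm Om u <= M%:E)%E <-> ess_le M u.
Proof.
move=> M0; rewrite /linf_norm unlock lebesgue_setT_gt0.
split.
  move=> /ess_supP; apply: filterS => x /= + Ox.
  by rewrite patchE mem_set// gee0_abs ?lee_fin ?enorm_ge0.
move=> h; apply/ess_supP; apply: filterS h => x h /=.
rewrite patchE; case: ifPn => [|_]; last by rewrite abse0 lee_fin.
by rewrite inE => Ox; rewrite gee0_abs lee_fin ?enorm_ge0// h.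
Qed.

Lemma linf_norm_ge0 u : (0 <= linf_norm Om u)%E. Proof. exact: Lnorm_ge0. Qed.

Lemma normoo_ge0 u : 0 <= normoo u. Proof. by rewrite fine_ge0// linf_norm_ge0. Qed.

Lemma LinfP u : Linf Om u <-> measurable_fun Om u /\ exists2 M, 0 <= M & ess_le M u.
Proof.
split=> -[mu]; last first.
  move=> [M M0 uM]; split => //; apply: le_lt_trans (ltry M).
  exact/linf_normP.
move=> ufin; split => //; exists (normoo u); first exact: normoo_ge0.
apply/linf_normP; first exact: normoo_ge0.
by rewrite fineK// ge0_fin_numE// linf_norm_ge0.
Qed.

Lemma Linf_normE u : Linf Om u -> linf_norm Om u = (normoo u)%:E.
Proof. by move=> [_ uf]; rewrite fineK// ge0_fin_numE// linf_norm_ge0. Qed.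

Lemma normoo_ess u : Linf Om u -> ess_le (normoo u) u.
Proof. by move=> hu; apply/linf_normP; rewrite ?normoo_ge0// Linf_normE. Qed.

Lemma normoo_le u M : 0 <= M -> ess_le M u -> normoo u <= M.
Proof.
move=> M0 uM; have h := (linf_normP u M0).2 uM.
by rewrite -lee_fin fineK// ge0_fin_numE ?linf_norm_ge0// (le_lt_trans h)// ltry.
Qed.

Lemma ess_leD M1 M2 u v : ess_le M1 u -> ess_le M2 v -> ess_le (M1 + M2) (u + v).
Proof.
apply: filterS2 => x hu hv Ox /=; rewrite (le_trans (ler_enormD _ _))// lerD//.
  exact: hu.
exact: hv.
Qed.

Lemma ess_leZ a M u : ess_le M u -> ess_le (`|a| * M) (a *: u).
Proof. by apply: filterS => x h Ox /=; rewrite enormZ ler_wpM2l// h. Qed.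

Lemma Linf_subspace : linear_subspace (Linf Om).
Proof.
split.
- apply/LinfP; split; first exact: measurable_cst.
  by exists 0 => //; apply: aeW => x _ /=; rewrite enorm0.
- move=> u v /LinfP[mu [M M0 uM]] /LinfP[mv [N N0 vN]]; apply/LinfP; split.
    exact: measurable_rVD.
  by exists (M + N); rewrite ?addr_ge0//; exact: ess_leD.
- move=> a u /LinfP[mu [M M0 uM]]; apply/LinfP; split.
    by apply: measurable_rVZ => //; exact: measurable_cst.
  by exists (`|a| * M); rewrite ?mulr_ge0//; exact: ess_leZ.
Qed.

Lemma Linf_seminorm : seminorm_on (Linf Om) normoo.
Proof.
split.
- by move=> u _; exact: normoo_ge0.
- move=> u v hu hv; apply: normoo_le; first by rewrite addr_ge0 ?normoo_ge0.
  by apply: ess_leD; exact: normoo_ess.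
- move=> a u hu; apply: normoo_le; first by rewrite mulr_ge0 ?normoo_ge0.
  by apply: ess_leZ; exact: normoo_ess.
Qed.

Lemma normoo_eqae u v : Linf Om (u - v) -> normoo (u - v) = 0 <-> eqae Om u v.
Proof.
move=> huv; split => h.
  have := normoo_ess huv; rewrite h; apply: filterS => x + Ox => /(_ Ox) /= le0.
  apply/eqP; rewrite -subr_eq0; apply/eqP/enorm_eq0/eqP.
  by rewrite eq_le le0 enorm_ge0.
apply/eqP; rewrite eq_le normoo_ge0 andbT; apply: normoo_le => //.
by apply: filterS h => x h Ox; rewrite -[(u - v) x]/(u x - v x) h// subrr enorm0.
Qed.

Lemma ess_le_eqae M u v : eqae Om u v -> ess_le M u -> ess_le M v.
Proof. by apply: filterS2 => x e h Ox; rewrite -e//; exact: h. Qed.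

Lemma eqae_sym u v : eqae Om u v -> eqae Om v u.
Proof. by apply: filterS => x h Ox; rewrite h. Qed.

Lemma eqae_trans u v w : eqae Om u v -> eqae Om v w -> eqae Om u w.
Proof. by apply: filterS2 => x h1 h2 Ox; rewrite h1// h2. Qed.

Lemma eqae_refl u : eqae Om u u. Proof. exact: aeW. Qed.

Section pairing.

Lemma pairing_integrable u v : Linf Om u -> Linf Om v ->
  leb.-integrable Om (EFin \o (fun x => dotp (u x) (v x))).
Proof.
move=> /[dup] hu [mu _] /[dup] hv [mv _].
apply: (ae_bounded_integrable (B := normoo u * normoo v)) => //; first exact: measurable_dotp.
apply: filterS2 (normoo_ess hu) (normoo_ess hv) => x ux vx Ox.
by rewrite (le_trans (cauchy_schwarz _ _))// ler_pM ?enorm_ge0 ?ux ?vx.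
Qed.

Lemma L2pairing_le u v : Linf Om u -> Linf Om v ->
  `|L2pairing Om u v| <= normoo u * normoo v * fine (leb Om).
Proof.
move=> /[dup] hu [mu _] /[dup] hv [mv _].
apply: ae_bounded_Rintegral => //; first by rewrite mulr_ge0 ?normoo_ge0.
  exact: measurable_dotp.
apply: filterS2 (normoo_ess hu) (normoo_ess hv) => x ux vx Ox.
by rewrite (le_trans (cauchy_schwarz _ _))// ler_pM ?enorm_ge0 ?ux ?vx.
Qed.

Lemma L2pairingC u v : L2pairing Om u v = L2pairing Om v u.
Proof. by apply: eq_Rintegral => x _; rewrite dotpC. Qed.

Lemma L2pairingDl u v w : Linf Om u -> Linf Om v -> Linf Om w ->
  L2pairing Om (u + v) w = L2pairing Om u w + L2pairing Om v w.
Proof.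
move=> hu hv hw; rewrite /L2pairing -RintegralD//; try exact: pairing_integrable.
by apply: eq_Rintegral => x _; rewrite dotpDl.
Qed.

Lemma L2pairingZl a u w : Linf Om u -> Linf Om w ->
  L2pairing Om (a *: u) w = a * L2pairing Om u w.
Proof.
move=> hu hw; rewrite /L2pairing -RintegralZl//; try exact: pairing_integrable.
by apply: eq_Rintegral => x _; rewrite dotpZl.
Qed.

Lemma L2pairingBl u v w : Linf Om u -> Linf Om v -> Linf Om w ->
  L2pairing Om (u - v) w = L2pairing Om u w - L2pairing Om v w.
Proof.
move=> hu hv hw; rewrite -scaleN1r L2pairingDl ?L2pairingZl ?mulN1r//.
exact: (subspaceZ Linf_subspace).
Qed.

Lemma L2pairingBr u v w : Linf Om u -> Linf Om v -> Linf Om w ->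
  L2pairing Om u (v - w) = L2pairing Om u v - L2pairing Om u w.
Proof. by move=> hu hv hw; rewrite !(L2pairingC u) L2pairingBl. Qed.

Lemma eqae_L2pairing u v w : measurable_fun Om u -> measurable_fun Om v ->
  measurable_fun Om w -> eqae Om u v -> L2pairing Om u w = L2pairing Om v w.
Proof.
move=> mu mv mw uv; apply: ae_eq_Rintegral => //; try exact: measurable_dotp.
by apply: filterS uv => x h Ox; rewrite h.
Qed.

End pairing.

Lemma rigid_Linf (Q : 'M[R]_d) (c : 'rV[R]_d) : bounded_set Om ->
  Linf Om (fun x => x *m Q^T + c).
Proof.
move=> [M [Mr hM]]; apply/LinfP; split.
  apply: measurable_rVD; last exact: measurable_cst.
  apply: measurable_rVP => i.
  rewrite (_ : (fun t => _) = (fun t : 'rV[R]_d => \sum_j t 0 j * Q^T j i)); last first.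
    by apply/funext => t; rewrite mxE.
  apply: measurable_sum => j; apply: measurable_funM; last exact: measurable_cst.
  exact: measurable_funTS (measurable_coord 0 j).
exists (\sum_i (\sum_j (`|M| + 1) * `|Q^T j i|) + enorm c).
  by rewrite addr_ge0 ?enorm_ge0// sumr_ge0// => i _; rewrite sumr_ge0// => j _; rewrite mulr_ge0// addr_ge0.
apply: aeW => x Ox /=; rewrite (le_trans (ler_enormD _ _))// lerD2r.
rewrite (le_trans (enorm_le_sum _))// ler_sum// => i _.
rewrite mxE (le_trans (ler_norm_sum _ _ _))// ler_sum// => j _.
rewrite normrM ler_wpM2r// (@le_trans _ _ `|x|)//.
  rewrite -[`|x|]/(mx_norm x) mx_normrE.
  exact: (le_bigmax _ (fun i : 'I_1 * 'I_d => `|x i.1 i.2|) (0, j)).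
by apply: hM => //; rewrite (le_lt_trans (ler_norm _))// ltrDl.
Qed.

Section rigid_orthogonal.
Hypothesis bOm : bounded_set Om.

Lemma in_V_subspace : linear_subspace (in_V Om).
Proof.
have hL := Linf_subspace.
split.
- split=> [|Q c hQ]; first exact: (subspace0 hL).
  rewrite -(scale0r 0) L2pairingZl ?mul0r//; [exact: (subspace0 hL)|exact: rigid_Linf].
- move=> u v [hu ou] [hv ov]; split=> [|Q c hQ]; first exact: (subspaceD hL).
  by rewrite L2pairingDl ?ou ?ov ?addr0//; exact: rigid_Linf.
- move=> a u [hu ou]; split=> [|Q c hQ]; first exact: (subspaceZ hL).
  by rewrite L2pairingZl ?ou ?mulr0//; exact: rigid_Linf.
Qed.

Lemma in_V_seminorm : seminorm_on (in_V Om) normoo.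
Proof.
have hL := Linf_seminorm.
split.
- by move=> u _; exact: normoo_ge0.
- by move=> u v [hu _] [hv _]; exact: (seminormD hL).
- by move=> a u [hu _]; exact: (seminormZ hL).
Qed.

(** The set G of points at which the sequence converges at the announced rate is
    itself measurable and of full measure, so the pointwise limit, extended by 0,
    is measurable without completing the measure.  Orthogonality to rigid motions
    passes to the limit because the pairing is continuous. *)
Lemma in_V_complete : geometrically_complete (in_V Om) normoo.
Proof.
move=> c x Vx xc.
have Lx n : Linf Om (x n) by have [] := Vx n.
have mx n : measurable_fun Om (x n) by have [] := Lx n.
have Lsub n m := subspaceB Linf_subspace (Lx m) (Lx n).
have c0 : 0 <= c.
  by have := xc 0%N 0%N (leqnn _); rewrite expr0 mulr1; apply: le_trans; exact: normoo_ge0.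
pose G : set 'rV[R]_d := \bigcap_n \bigcap_m
  (Om `&` [set z | enorm (x (n + m)%N z - x n z) <= c * 2^-1 ^+ n]).
have mG : measurable G.
  apply: bigcapT_measurable => n; apply: bigcapT_measurable => m.
  rewrite [X in _ `&` X](_ : _ = (fun z => enorm (x (n + m)%N z - x n z)) @^-1`
      `]-oo, c * 2^-1 ^+ n]); last by apply/seteqP; split => z; rewrite /= in_itv.
  apply: (_ : measurable_fun Om _) => //.
  by apply: measurable_enorm; exact: measurable_rVB.
have GOm z : G z -> Om z by move=> /(_ 0%N I 0%N I)[].
have aeG : {ae leb, forall z, Om z -> G z}.
  have : {ae leb, forall z, forall n m, Om z -> enorm (x (n + m)%N z - x n z) <= c * 2^-1 ^+ n}.
    apply: ae_foralln => n; apply: ae_foralln => m.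
    have := normoo_ess (Lsub n (n + m)%N); apply: filterS => z h Oz.
    by rewrite (le_trans (h Oz))// xc// leq_addr.
  by apply: filterS => z h Oz n _ m _; split => //; exact: h.
have Gc z i : G z -> forall n m, (n <= m)%N -> `|x m z 0 i - x n z 0 i| <= c * 2^-1 ^+ n.
  move=> Gz n m nm; have [_ /=] := Gz n I (m - n)%N I; rewrite subnKC//.
  apply: le_trans; have := coord_le_enorm (x m z - x n z) i; by rewrite !mxE.
pose l z : 'rV[R]_d := if z \in G then \row_i lim (x n z 0 i @[n --> \oo]) else 0.
have lE z i : G z -> l z 0 i = lim (x n z 0 i @[n --> \oo]).
  by move=> Gz; rewrite /l mem_set// mxE.
have lx z i n : G z -> `|l z 0 i - x n z 0 i| <= c * 2^-1 ^+ n.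
  move=> Gz; have [a xa al] := cauchy_geometric (Gc z i Gz).
  by rewrite lE// (cvg_lim _ xa).
have ml : measurable_fun Om l.
  apply: measurable_rVP => i.
  apply: (measurable_fun_cvg (h := fun n => (fun z => x n z 0 i) \_ G)).
    move=> n; apply: measurable_funTS; apply/(measurable_restrictT _ mG).
    by apply: measurable_coord_fun; apply: measurable_funS (mx n).
  move=> z Oz; have [Gz|Gz] := pselect (G z); last first.
    rewrite /l memNset// mxE.
    under eq_fun do rewrite patchE memNset//.
    exact: cvg_cst.
  have [a xa _] := cauchy_geometric (Gc z i Gz).
  under eq_fun do rewrite patchE mem_set//.
  by rewrite lE// (cvg_lim _ xa).
have lxn z n : G z -> enorm (l z - x n z) <= c * 2^-1 ^+ n.
  move=> Gz; apply: (@le_geometric_eps _ (d%:R * c)) => [|j]; first by rewrite mulr_ge0.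
  rewrite -(subrKA (x (n + j)%N z)) (le_trans (ler_enormD _ _))// addrC lerD//.
    by have [_] := Gz n I j I.
  rewrite (le_trans (enorm_le_sum _))//.
  apply: (@le_trans _ _ (\sum_(i < d) c * 2^-1 ^+ j)); last first.
    by rewrite sumr_const card_ord -[leLHS]mulr_natl mulrA.
  apply: ler_sum => i _; rewrite !mxE (le_trans (lx _ _ _ Gz))// ler_wpM2l//.
  by rewrite ler_wiXn2l ?invr_ge0 ?leq_addl// invf_le1// ler1n.
have lxe n : ess_le (c * 2^-1 ^+ n) (l - x n).
  by apply: filterS aeG => z h Oz; apply: lxn; exact: h.
have c2 n : 0 <= c * 2^-1 ^+ n by rewrite mulr_ge0// ltW// half_expr_gt0.
have Llx n : Linf Om (l - x n).
  by apply/LinfP; split; [exact: measurable_rVB|exists (c * 2^-1 ^+ n)].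
have Ll : Linf Om l.
  by have := subspaceD Linf_subspace (Llx 0%N) (Lx 0%N); rewrite subrK.
have lxnormoo n : normoo (l - x n) <= c * 2^-1 ^+ n by exact: normoo_le.
exists l; split => //; split => // Q q hQ; set w := (fun x => _).
have hw : Linf Om w by exact: rigid_Linf.
apply/eqP; rewrite -normr_le0.
apply: (@le_geometric_eps _ (c * (normoo w * fine (leb Om)))) => [|n].
  by rewrite !mulr_ge0 ?normoo_ge0 ?fine_ge0.
rewrite add0r -[L2pairing _ _ _]subr0 -((Vx n).2 Q q hQ) -L2pairingBl//.
apply: le_trans (L2pairing_le (Llx n) hw) _.
rewrite [leRHS]mulrAC -[leLHS]mulrA ler_wpM2r// mulr_ge0 ?normoo_ge0 ?fine_ge0//.
Qed.

End rigid_orthogonal.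

Lemma linf_norm_cvg0P (F : set_system R) (FF : Filter F) (p : R -> field) :
  (\forall s \near F, Linf Om (p s)) ->
  linf_norm Om (p s) @[s --> F] --> 0%E <->
  (forall e, 0 < e -> \forall s \near F, normoo (p s) <= e).
Proof.
move=> Lp; split.
  move=> /fine_cvgP[_ h] e e0; have he := (cvgrPdist_le _ _).1 h e e0.
  apply: (@filterS _ F FF _ _ _ (he FF)) => s /=; by rewrite sub0r normrN; apply: le_trans; exact: ler_norm.
move=> h; apply/fine_cvgP; split.
  by apply: (@filterS _ F FF _ _ _ Lp) => s hs; rewrite Linf_normE.
apply/cvgrPdist_le => e e0; apply: (@filterS _ F FF _ _ _ (h e e0)) => s hs /=.
by rewrite sub0r normrN ger0_norm// normoo_ge0.
Qed.
End essential_bound.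

(** * Kernels of bond forces *)

Section mean_value.
Context {R : realType}.
Implicit Types f : R -> R.

Lemma mean_value f a b : (forall x : R, derivable f x 1) ->
  exists2 c, `|c - a| <= `|b - a| & f b - f a = derive1 f c * (b - a).
Proof.
move=> df.
have dF (x : R) : is_derive x 1 f (derive1 f x) by rewrite derive1E; exact: derivableP.
have cf x y : {within `[x, y], continuous f}.
  by apply: derivable_within_continuous => z _; exact: df.
have [ab|/ltW ba] := leP a b.
  have [c + ->] := @MVT_segment R f (derive1 f) a b ab (fun x _ => dF x) (cf a b).
  rewrite in_itv /= => /andP[ac cb]; exists c => //.
  by rewrite !ger0_norm ?subr_ge0// lerD2r.
have [c + e] := @MVT_segment R f (derive1 f) b a ba (fun x _ => dF x) (cf b a).
rewrite in_itv /= => /andP[bc ca]; exists c.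
  by rewrite !ler0_norm ?subr_le0// lerN2 lerD2r.
by rewrite -opprB e -mulrN opprB.
Qed.

Lemma derive_bound_lipschitz f M a b : (forall x : R, derivable f x 1) ->
  (forall x, `|derive1 f x| <= M) -> `|f (a + b) - f a| <= M * `|b|.
Proof.
move=> df fM; have [c _ ->] := @mean_value f a (a + b) df.
by rewrite normrM addrAC subrr add0r ler_wpM2r.
Qed.

Lemma derive2_bound_taylor f M a b : (forall x : R, derivable f x 1) ->
  (forall x : R, derivable (derive1 f) x 1) -> (forall x, `|derive1 (derive1 f) x| <= M) ->
  `|f (a + b) - f a - derive1 f a * b| <= M * b ^+ 2.
Proof.
move=> df ddf fM; have [c ca ->] := @mean_value f a (a + b) df.
have ab : a + b - a = b by rewrite addrAC subrr add0r.
have M0 : 0 <= M by apply: le_trans (fM 0).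
rewrite ab -mulrBl normrM -(subrKC a c) [a + _]addrC [_ + a]addrC.
rewrite -[b ^+ 2]real_normK ?num_real// expr2 mulrA ler_wpM2r//.
rewrite (le_trans (derive_bound_lipschitz _ _ ddf fM))// ler_wpM2l//.
by rewrite -[b]ab.
Qed.

End mean_value.

Lemma Rintegral_eq0 dd (T : measurableType dd) (R : realType)
    (mu : {measure set T -> \bar R}) (D : set T) (f : T -> R) :
  (forall x, D x -> f x = 0) -> \int[mu]_(x in D) f x = 0.
Proof. by move=> f0; rewrite /Rintegral integral0_eq// => x /f0 ->. Qed.

Section bond_fields.
Context {R : realType} {d : nat}.
Hypothesis d2 : (1 < d)%N.
Context (Om : set 'rV[R]_d) (eps : R).
Local Notation leb := (@lebesgue_rV R d).
Hypotheses (mOm : measurable Om) (fOm : (leb Om < +oo)%E).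
Local Notation field := ('rV[R]_d -> 'rV[R]_d).
Local Notation hor := (horizon Om eps).
Local Notation bint := (bond_int Om eps).
Local Notation bint2 := (bond_int2 Om eps).
Implicit Types (s : 'rV[R]_d -> 'rV[R]_d -> R) (u v w : field) (x y : 'rV[R]_d).

(** The common form of force and of Dforce: a scalar density s on bonds, acting
    along the bond. *)
Definition bond_field s x : 'rV[R]_d :=
  - vintegral (hor x) (fun y => s x y *: direction y x).

Lemma bond_fieldE s x i : bond_field s x 0 i =
  - bint (fun x y => s x y * direction y x 0 i) x.
Proof. by rewrite mxE mxE; congr (- _); apply: eq_Rintegral => y _; rewrite mxE. Qed.

Lemma measurable_bond_diff D : measurable_fun D (fun p : 'rV[R]_d * 'rV[R]_d => p.2 - p.1).
Proof.
by apply: measurable_funTS; apply: measurable_rVB; [exact: measurable_snd|exact: measurable_fst].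
Qed.

Lemma measurable_bond_length D :
  measurable_fun D (fun p : 'rV[R]_d * 'rV[R]_d => enorm (p.2 - p.1)).
Proof. by apply: measurable_enorm; exact: measurable_bond_diff. Qed.

Lemma measurable_direction D :
  measurable_fun D (fun p : 'rV[R]_d * 'rV[R]_d => direction p.2 p.1).
Proof.
apply: measurable_rVZ; last exact: measurable_bond_diff.
by apply: (measurableT_comp measurable_invr); exact: measurable_bond_length.
Qed.

Lemma measurable_left_end u : measurable_fun Om u ->
  measurable_fun (Om `*` Om) (fun p => u p.1).
Proof.
move=> mu; apply: (measurable_comp (F := Om)) => //; last exact: measurable_funTS measurable_fst.
by move=> _ [[x y] [Ox Oy] <-].
Qed.

Lemma measurable_right_end u : measurable_fun Om u ->
  measurable_fun (Om `*` Om) (fun p => u p.2).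
Proof.
move=> mu; apply: (measurable_comp (F := Om)) => //; last exact: measurable_funTS measurable_snd.
by move=> _ [[x y] [Ox Oy] <-].
Qed.

Lemma measurable_elongation u : measurable_fun Om u ->
  bond_measurable Om (fun x y => dotp (u y - u x) (direction y x)).
Proof.
move=> mu; apply: measurable_dotp; last exact: measurable_direction.
by apply: measurable_rVB; [exact: measurable_right_end|exact: measurable_left_end].
Qed.

Lemma measurable_strain u : measurable_fun Om u ->
  bond_measurable Om (fun x y => strain y x u).
Proof.
move=> mu; rewrite /bond_measurable.
rewrite (_ : (fun p => _) = (fun p : 'rV[R]_d * 'rV[R]_d => (enorm (p.2 - p.1))^-1 *
   dotp (u p.2 - u p.1) (direction p.2 p.1))); last by apply/funext => p; rewrite strainE.
apply: measurable_funM; last exact: measurable_elongation.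
by apply: (measurableT_comp measurable_invr); exact: measurable_bond_length.
Qed.

Lemma bond_measurable_coord s i : bond_measurable Om s ->
  bond_measurable Om (fun x y => s x y * direction y x 0 i).
Proof.
move=> ms; apply: measurable_funM => //.
by apply: measurable_coord_fun; exact: measurable_direction.
Qed.

Lemma bond_le_coord s K x i : bond_le_at Om eps K s x ->
  bond_le_at Om eps K (fun x y => s x y * direction y x 0 i) x.
Proof.
apply: filterS => y h hy; rewrite normrM -[leRHS]mulr1 ler_pM ?h//.
exact: le_trans (coord_le_enorm _ _) (enorm_direction _ _).
Qed.

Definition field_bound (K : R) : R := d%:R * (K * riesz_bound Om).

Lemma bond_field_le s K x : bond_measurable Om s -> 0 <= K -> Om x ->
  bond_le_at Om eps K s x -> enorm (bond_field s x) <= field_bound K.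
Proof.
move=> ms K0 Ox sK; rewrite (le_trans (enorm_le_sum _))//.
apply: (@le_trans _ _ (\sum_(i < d) (K * riesz_bound Om))); last first.
  by rewrite sumr_const card_ord -[leLHS]mulr_natl.
apply: ler_sum => i _; rewrite bond_fieldE normrN.
by apply: bond_int_le => //; [exact: bond_measurable_coord|exact: bond_le_coord].
Qed.

Lemma bond_fieldD s1 s2 K1 K2 x : bond_measurable Om s1 -> bond_measurable Om s2 ->
  Om x -> bond_le_at Om eps K1 s1 x -> bond_le_at Om eps K2 s2 x ->
  bond_field (fun x y => s1 x y + s2 x y) x = bond_field s1 x + bond_field s2 x.
Proof.
move=> m1 m2 Ox h1 h2; apply/rowP => i.
rewrite [RHS]mxE !bond_fieldE -opprD; congr (- _).
rewrite -(bond_intD d2 mOm fOm (K1 := K1) (K2 := K2))//;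
  try exact: bond_measurable_coord; try exact: bond_le_coord.
by apply: eq_bond_int => y _; rewrite mulrDl.
Qed.

Lemma bond_fieldZ a s K x : bond_measurable Om s -> Om x -> bond_le_at Om eps K s x ->
  bond_field (fun x y => a * s x y) x = a *: bond_field s x.
Proof.
move=> ms Ox h; apply/rowP => i.
rewrite [RHS]mxE !bond_fieldE mulrN; congr (- _).
rewrite -(bond_intZ d2 mOm fOm _ (K := K))//;
  try exact: bond_measurable_coord; try exact: bond_le_coord.
by apply: eq_bond_int => y _; rewrite mulrA.
Qed.

Lemma measurable_bond_field s : bond_measurable Om s -> measurable_fun Om (bond_field s).
Proof.
move=> ms; apply: measurable_rVP => i.
apply: (eq_measurable_fun (fun x => - bint (fun x y => s x y * direction y x 0 i) x)).
  by move=> x _; rewrite bond_fieldE.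
apply: measurable_funN; apply: measurable_bond_int => //.
exact: bond_measurable_coord.
Qed.

Lemma field_bound_ge0 K : 0 <= K -> 0 <= field_bound K.
Proof. by move=> K0; rewrite !mulr_ge0// riesz_bound_ge0. Qed.

Lemma bond_field_ess s K : bond_measurable Om s -> 0 <= K ->
  bond_le Om eps K s -> ess_le Om (field_bound K) (bond_field s).
Proof. by move=> ms K0; apply: filterS => x h Ox; apply: bond_field_le => //; exact: h. Qed.

Lemma bond_field_Linf s K : bond_measurable Om s -> 0 <= K ->
  bond_le Om eps K s -> Linf Om (bond_field s).
Proof.
move=> ms K0 sK; apply/LinfP; split; first exact: measurable_bond_field.
by exists (field_bound K); [exact: field_bound_ge0|exact: bond_field_ess].
Qed.

Lemma bond_field_dotp s K x (w : 'rV[R]_d) : bond_measurable Om s -> Om x ->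
  bond_le_at Om eps K s x ->
  dotp (bond_field s x) w = - bint (fun x y => s x y * dotp (direction y x) w) x.
Proof.
move=> ms Ox sK; rewrite [LHS]/dotp.
have mh := measurable_horizon eps mOm x.
have I0 i : leb.-integrable (hor x) (EFin \o (fun y => s x y * direction y x 0 i)).
  apply: (bond_integrable d2 mOm fOm (k := fun x y => s x y * direction y x 0 i) (K := K)) => //.
    exact: bond_measurable_coord.
  exact: bond_le_coord.
transitivity (\sum_(i < d) - (\int[leb]_(y in hor x) (w 0 i * (s x y * direction y x 0 i)))).
  by apply: eq_bigr => i _; rewrite bond_fieldE mulNr; congr (- _); rewrite RintegralZl// mulrC.
rewrite sumrN; congr (- _); rewrite /bond_int /Rintegral.
have I1 i : leb.-integrable (hor x) (fun y => (w 0 i * (s x y * direction y x 0 i))%:E).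
  by under eq_fun do rewrite EFinM; exact: (integrableZl mh _ (I0 i)).
rewrite sum_fine; last by move=> i _; exact: integrable_fin_num.
congr fine; rewrite -integral_sum//; apply: eq_integral => y _; rewrite /dotp.
by rewrite sumEFin mulr_sumr; congr EFin; apply: eq_bigr => i _; ring.
Qed.

(** Passes from a property of almost every point to a property of almost every
    bond. *)
Lemma ae_bond (A : set 'rV[R]_d) (P : 'rV[R]_d -> 'rV[R]_d -> Prop) :
  {ae leb, forall x, Om x -> A x} ->
  (forall x y, Om x -> hor x y -> A x -> A y -> P x y) ->
  {ae leb, forall x, Om x -> {ae leb, forall y, hor x y -> P x y}}.
Proof.
move=> hA h; apply: filterS (hA) => x Ax Ox; have {}Ax := Ax Ox.
by apply: filterS hA => y Ay hy; apply: h => //; apply: Ay; case: hy.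
Qed.

(** Newton's third law: the two ends of a bond are acted on by opposite forces, so
    the work done in a displacement w only sees how w elongates the bonds.  It is
    the average of the integral and of its exchange by Fubini's theorem; the
    direction changes sign and s does not. *)
Lemma bond_field_pairing s K w : bond_measurable Om s -> 0 <= K ->
  bond_le Om eps K s -> (forall x y, s x y = s y x) -> Linf Om w ->
  L2pairing Om (bond_field s) w =
  2^-1 * bint2 (fun x y => s x y * dotp (w y - w x) (direction y x)).
Proof.
move=> ms K0 sK sC /[dup] hw [mw _].
pose k x y := s x y * dotp (direction y x) (w x).
have mk : bond_measurable Om k.
  by apply: measurable_funM => //; apply: measurable_dotp;
    [exact: measurable_direction|exact: measurable_left_end].
pose N := normoo Om w; have N0 : 0 <= N by exact: normoo_ge0.
have kK : bond_le Om eps (K * N) k.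
  apply: filterS2 sK (normoo_ess hw) => x sx wx Ox.
  apply: filterS (sx Ox) => y h hy; rewrite normrM mulrAC ler_pM ?h//.
  rewrite (le_trans (cauchy_schwarz _ _))// -[leRHS]mul1r.
  by rewrite ler_pM ?enorm_ge0 ?enorm_direction ?wx.
have KN0 : 0 <= K * N by rewrite mulr_ge0.
have mk' : bond_measurable Om (fun x y => k y x).
  apply: measurable_funM; last first.
    apply: measurable_dotp; last exact: measurable_right_end.
    rewrite (_ : (fun t => _) = (fun p : 'rV[R]_d * 'rV[R]_d => - 1 *: direction p.2 p.1)).
      by apply: measurable_rVZ; [exact: measurable_cst|exact: measurable_direction].
    by apply/funext => p; rewrite direction_swap scaleN1r.
  by apply: eq_measurable_fun ms => p _; rewrite sC.
have kK' : bond_le Om eps (K * N) (fun x y => k y x).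
  have hA : {ae leb, forall x, Om x -> enorm (w x) <= N} by exact: normoo_ess.
  apply: filterS2 (sK) (hA) => x sx wx Ox.
  apply: filterS2 (sx Ox) hA => y h wy hy; rewrite normrM mulrAC ler_pM//.
    by rewrite sC h.
  rewrite (le_trans (cauchy_schwarz _ _))// -[leRHS]mul1r.
  by rewrite ler_pM ?enorm_ge0 ?enorm_direction// wy//; case: hy.
have -> : L2pairing Om (bond_field s) w = - bint2 k.
  rewrite /L2pairing /bond_int2.
  transitivity (\int[leb]_(x in Om) - bint k x).
    apply: ae_eq_Rintegral => //.
    - by apply: measurable_dotp => //; exact: measurable_bond_field.
    - by apply: measurable_funN; exact: measurable_bond_int.
    - by apply: filterS sK => x h Ox; rewrite (bond_field_dotp _ ms Ox (h Ox)).
  transitivity (\int[leb]_(x in Om) (- 1 * bint k x)).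
    by apply: eq_Rintegral => x _; rewrite mulN1r.
  by rewrite RintegralZl ?mulN1r//; exact: (bond_int_integrable d2 mOm fOm mk KN0 kK).
have key x y : - 1 * (k x y + k y x) = s x y * dotp (w y - w x) (direction y x).
  rewrite /k (sC y x) (direction_swap x y) dotpNl dotpBl.
  by rewrite !(dotpC (direction y x)); ring.
clearbody k; have sw := bond_int2_swap d2 mOm fOm mk KN0 kK.
have -> : - bint2 k = 2^-1 * (- 1 * (bint2 k + bint2 (fun x y => k y x))).
  by rewrite -sw; field.
congr (_ * _); rewrite -(bond_int2D d2 mOm fOm mk mk' KN0 KN0 kK kK').
have KK0 := addr_ge0 KN0 KN0.
have kk : bond_le Om eps (K * N + K * N) (fun x y => k x y + k y x).
  apply: filterS2 kK kK' => x h1 h2 Ox; apply: filterS2 (h1 Ox) (h2 Ox) => y {}h1 {}h2 hy.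
  by rewrite mulrDl; apply: le_trans (ler_normD _ _) (lerD (h1 hy) (h2 hy)).
rewrite -(bond_int2Z d2 mOm fOm (- 1) (measurable_funD mk mk') KK0 kk).
by congr bond_int2; apply/funext => x; apply/funext => y; exact: key.
Qed.

(** Orthogonality to rigid motions: these do not elongate any bond. *)
Lemma bond_field_in_V s K : bounded_set Om -> bond_measurable Om s -> 0 <= K ->
  bond_le Om eps K s -> (forall x y, s x y = s y x) -> in_V Om (bond_field s).
Proof.
move=> bOm ms K0 sK sC; split; first exact: bond_field_Linf sK.
move=> Q c hQ; have hw := rigid_Linf Q c bOm.
rewrite (bond_field_pairing ms K0 sK sC hw) /bond_int2.
rewrite (_ : \int[leb]_(x in Om) _ = 0) ?mulr0//.
apply: Rintegral_eq0 => x _; apply: Rintegral_eq0 => y _.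
rewrite opprD addrACA subrr addr0 -mulmxBl /direction dotpZr dotp_skew//.
by rewrite !mulr0.
Qed.

End bond_fields.

(** * Differentiability of the force and of the energy *)

Section operators.
Context {R : realType} {d : nat}.
Hypothesis d2 : (1 < d)%N.
Context (g J : R -> R) (Om : set 'rV[R]_d) (eps : R).
Local Notation leb := (@lebesgue_rV R d).
Hypotheses (hg : potential g) (hJ : influence_function J).
Hypotheses (mOm : measurable Om) (fOm : (leb Om < +oo)%E) (bOm : bounded_set Om).
Hypothesis eps0 : 0 < eps.
Local Notation field := ('rV[R]_d -> 'rV[R]_d).
Local Notation hor := (horizon Om eps).
Implicit Types (u v w h : field) (x y : 'rV[R]_d) (M N K : R).

Let c : R := eps ^+ d.+1 * unit_ball_volume R d.

Lemma potential_bound n : (n <= 3)%N ->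
  exists2 M, 0 <= M & forall r, `|derive1n n g r| <= M.
Proof.
move=> /(potential_bounded hg)[M hM]; exists M => //.
exact: le_trans (normr_ge0 _) (hM 0).
Qed.

Lemma influence_bound : exists2 M, 0 <= M & forall r, `|2 * J r / c| <= M.
Proof.
have [M hM] := influence_bounded hJ.
exists (2 * M / `|c|) => [|r].
  by rewrite !mulr_ge0 ?invr_ge0// (le_trans (influence_ge0 hJ 0) (hM 0)).
rewrite normrM normfV ler_wpM2r ?invr_ge0// ger0_norm ?ler_wpM2l//.
by rewrite mulr_ge0// (influence_ge0 hJ).
Qed.

Lemma measurable_potential n : (n <= 3)%N -> measurable_fun setT (derive1n n g).
Proof.
rewrite leq_eqVlt => /orP[/eqP ->|n3].
  by apply: continuous_measurable_fun; exact: (potential_C3 hg).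
apply: continuous_measurable_fun => x.
by apply/differentiable_continuous/derivable1_diffP; exact: (potential_derivable hg).
Qed.

Definition force_density u x y : R :=
  2 * J (enorm (y - x) / eps) / (c * Num.sqrt (enorm (y - x))) *
  derive1n 1 g (Num.sqrt (enorm (y - x)) * strain y x u).

Definition Dforce_density u v x y : R :=
  2 * J (enorm (y - x) / eps) / c *
  derive1n 2 g (Num.sqrt (enorm (y - x)) * strain y x u) * strain y x v.

Definition energy_density u x y : R := enorm (y - x) * bond_energy g J eps y x u.

Lemma force_bond u : force g J Om eps u = bond_field Om eps (force_density u).
Proof. by []. Qed.

Lemma Dforce_bond u v : Dforce g J Om eps u v = bond_field Om eps (Dforce_density u v).
Proof. by []. Qed.

Lemma PD_bond u : PD g J Om eps u = bond_int2 Om eps (energy_density u).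
Proof. by []. Qed.

Lemma force_density_sym u x y : force_density u x y = force_density u y x.
Proof. by rewrite /force_density strain_swap enormB. Qed.

Lemma Dforce_density_sym u v x y : Dforce_density u v x y = Dforce_density u v y x.
Proof. by rewrite /Dforce_density !(strain_swap _ x) enormB. Qed.

Local Notation D2 := (Om `*` Om).

Let mlen : measurable_fun D2 (fun p : 'rV[R]_d * 'rV[R]_d => enorm (p.2 - p.1)).
Proof. exact: measurable_bond_length. Qed.

Let msqrtlen : measurable_fun D2 (fun p : 'rV[R]_d * 'rV[R]_d => Num.sqrt (enorm (p.2 - p.1))).
Proof. exact: (measurableT_comp measurable_sqrt mlen). Qed.

Let minfl (a : R) : measurable_fun D2
  (fun p : 'rV[R]_d * 'rV[R]_d => a * J (enorm (p.2 - p.1) / eps)).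
Proof.
apply: measurable_funM; first exact: measurable_cst.
apply: (measurableT_comp (influence_measurable hJ)).
by apply: measurable_funM => //; exact: measurable_cst.
Qed.

Let minv (f : 'rV[R]_d * 'rV[R]_d -> R) : measurable_fun D2 f -> measurable_fun D2 (fun p => (f p)^-1).
Proof. exact: (measurableT_comp measurable_invr). Qed.

Let mpot n u : (n <= 3)%N -> measurable_fun Om u -> measurable_fun D2
  (fun p : 'rV[R]_d * 'rV[R]_d => derive1n n g (Num.sqrt (enorm (p.2 - p.1)) * strain p.2 p.1 u)).
Proof.
move=> n3 mu; apply: (measurableT_comp (measurable_potential n3)).
by apply: measurable_funM => //; exact: measurable_strain.
Qed.

Lemma measurable_force_density u : measurable_fun Om u -> bond_measurable Om (force_density u).
Proof.
move=> mu; apply: measurable_funM; last exact: mpot.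
apply: measurable_funM; first exact: minfl.
apply: minv; apply: measurable_funM => //; exact: measurable_cst.
Qed.

Lemma measurable_Dforce_density u v : measurable_fun Om u -> measurable_fun Om v ->
  bond_measurable Om (Dforce_density u v).
Proof.
move=> mu mv; apply: measurable_funM; last exact: measurable_strain.
apply: measurable_funM; last exact: mpot.
apply: measurable_funM; first exact: minfl.
exact: measurable_cst.
Qed.

Lemma measurable_energy_density u : measurable_fun Om u -> bond_measurable Om (energy_density u).
Proof.
move=> mu; apply: measurable_funM => //.
apply: measurable_funM; last by apply: (@mpot 0%N).
apply: measurable_funM.
  by have := minfl 1; under eq_fun do rewrite mul1r.
apply: minv; apply: measurable_funM => //; exact: measurable_cst.
Qed.

(** On the horizon, less singular powers of the length are dominated by the Riesz
    kernel; at zero length both sides vanish. *)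
Lemma inv_sqrt_length_le x y : hor x y ->
  (Num.sqrt (enorm (y - x)))^-1 <= eps * riesz x y.
Proof.
move=> [+ _]; rewrite /eball /riesz /= => re.
have := enorm_ge0 (y - x); rewrite le_eqVlt => /orP[/eqP <-|r0].
  by rewrite sqrtr0 mulr0 invr0 mulr0.
rewrite invfM mulrA -[leLHS]mul1r ler_wpM2r ?invr_ge0 ?sqrtr_ge0//.
by rewrite ler_pdivlMr// mul1r ltW.
Qed.

Lemma inv_length_le x y : hor x y -> (enorm (y - x))^-1 <= Num.sqrt eps * riesz x y.
Proof.
move=> [+ _]; rewrite /eball /riesz /= => re.
have := enorm_ge0 (y - x); rewrite le_eqVlt => /orP[/eqP <-|r0].
  by rewrite mul0r invr0 mulr0.
rewrite invfM mulrCA -[leLHS]mulr1 ler_wpM2l ?invr_ge0 ?(ltW r0)//.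
by rewrite ler_pdivlMr ?(sqrtr_gt0 (enorm _))// mul1r ler_wsqrtr// ltW.
Qed.

(** The argument of g is the strain times the square root of the length, which
    leaves one power of the length in the square. *)
Lemma scaled_strain_sqr N x y h : enorm (h x) <= N -> enorm (h y) <= N ->
  (Num.sqrt (enorm (y - x)) * strain y x h) ^+ 2 <= (2 * N) ^+ 2 / enorm (y - x).
Proof.
move=> hx hy; have N0 := le_trans (enorm_ge0 _) hx.
rewrite exprMn sqr_sqrtr ?enorm_ge0//.
have [->|r0] := eqVneq (enorm (y - x)) 0; first by rewrite mul0r invr0 mulr0.
have rp : 0 < enorm (y - x) by rewrite lt_def r0 enorm_ge0.
have h2 : strain y x h ^+ 2 <= (2 * N / enorm (y - x)) ^+ 2.
  rewrite -[leLHS]real_normK ?num_real// ler_pXn2r ?nnegrE//.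
    exact: strain_le.
  by rewrite divr_ge0 ?mulr_ge0 ?(ltW rp).
have -> : (2 * N) ^+ 2 / enorm (y - x) = enorm (y - x) * (2 * N / enorm (y - x)) ^+ 2.
  by field.
by rewrite ler_pM2l.
Qed.

Lemma rieszE x y : riesz x y = (Num.sqrt (enorm (y - x)))^-1 * (enorm (y - x))^-1.
Proof. by rewrite /riesz invfM mulrC. Qed.

Let ler_normM (a b A B : R) : `|a| <= A -> `|b| <= B -> `|a * b| <= A * B.
Proof. by move=> ha hb; rewrite normrM ler_pM. Qed.

Let len0 x y : enorm (y - x) = 0 -> direction y x = 0.
Proof. by move=> r0; rewrite /direction r0 invr0 scale0r. Qed.

Let strain0 x y u : enorm (y - x) = 0 -> strain y x u = 0.
Proof. by move=> r0; rewrite strainE r0 invr0 mul0r. Qed.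

Let sqrt_len_neq0 x y : enorm (y - x) != 0 -> Num.sqrt (enorm (y - x)) != 0.
Proof. by move=> r0; rewrite gt_eqF// (sqrtr_gt0 (enorm _)) lt_def r0 enorm_ge0. Qed.

Lemma force_density_le : exists2 K, 0 <= K & forall u x y, hor x y ->
  `|force_density u x y| <= K * riesz x y.
Proof.
have [G G0 hG] := @potential_bound 1 isT.
have [j j0 hj] := influence_bound.
exists (j * eps * G) => [|u x y hy]; first by rewrite !mulr_ge0 // ltW.
rewrite /force_density invfM mulrA.
have -> : j * eps * G * riesz x y = j * (eps * riesz x y) * G by ring.
apply: ler_normM => //; apply: ler_normM => //.
by rewrite ger0_norm ?invr_ge0 ?sqrtr_ge0// inv_sqrt_length_le.
Qed.

Let strain_riesz N x y v : hor x y -> enorm (v x) <= N -> enorm (v y) <= N ->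
  `|strain y x v| <= 2 * N * (Num.sqrt eps * riesz x y).
Proof.
move=> hy vx vy; apply: le_trans (strain_le vy vx) _.
by rewrite ler_wpM2l ?inv_length_le// mulr_ge0// (le_trans (enorm_ge0 _) vx).
Qed.

Lemma Dforce_density_le : exists2 K, 0 <= K & forall u v x y N, hor x y ->
  enorm (v x) <= N -> enorm (v y) <= N ->
  `|Dforce_density u v x y| <= K * N * riesz x y.
Proof.
have [G G0 hG] := @potential_bound 2 isT.
have [j j0 hj] := influence_bound.
exists (j * G * (2 * Num.sqrt eps)) => [|u v x y N hy vx vy].
  by rewrite !mulr_ge0 ?sqrtr_ge0.
have -> : j * G * (2 * Num.sqrt eps) * N * riesz x y =
  j * G * (2 * N * (Num.sqrt eps * riesz x y)) by ring.
by apply: ler_normM; [exact: ler_normM|exact: strain_riesz].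
Qed.

(** The constant is 4 times the bounds for g''' and for 2J divided by the
    normalization: two strains of fields bounded
    by M and N contribute 2M/r and 2N/r, and g'' brings a factor sqrt r. *)
Lemma Dforce_density_lipschitz : exists2 K, 0 <= K & forall u w v x y M N,
  enorm ((u - w) x) <= M -> enorm ((u - w) y) <= M ->
  enorm (v x) <= N -> enorm (v y) <= N ->
  `|Dforce_density u v x y - Dforce_density w v x y| <= K * (M * N) * riesz x y.
Proof.
have [G G0 hG] := @potential_bound 3 isT.
have [j j0 hj] := influence_bound.
exists (j * G * 4) => [|u w v x y M N ux uy vx vy]; first by rewrite !mulr_ge0.
rewrite /Dforce_density -mulrBl -mulrBr.
have M0 := le_trans (enorm_ge0 _) ux.
have N0 := le_trans (enorm_ge0 _) vx.
set r := enorm (y - x); set q := Num.sqrt r.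
have [r0|r0] := eqVneq r 0.
  by rewrite [strain y x v]strain0// mulr0 normr0 !mulr_ge0// riesz_ge0.
have q0 : q != 0 by exact: sqrt_len_neq0.
have -> : j * G * 4 * (M * N) * riesz x y =
    j * (G * (q * (2 * M / r))) * (2 * N / r).
  have rq : r = q ^+ 2 by rewrite sqr_sqrtr// enorm_ge0.
  by rewrite rieszE -/r -/q rq; field.
apply: ler_normM; last exact: strain_le.
apply: ler_normM => //.
have -> : q * strain y x u = q * strain y x w + q * strain y x (u - w).
  by rewrite strainB; ring.
apply: le_trans (@derive_bound_lipschitz _ (derive1n 2 g) G _ _ _ _) _ => //.
  by move=> z; exact: (potential_derivable hg).
rewrite ler_wpM2l// normrM ger0_norm ?sqrtr_ge0// ler_wpM2l ?sqrtr_ge0//.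
exact: strain_le.
Qed.

(** At zero length every term vanishes.  Otherwise factor out 2J/(c sqrt r): the
    strain of h is the increment b of the argument of g' divided by sqrt r, and
    the rest is the Taylor remainder of g' at the increment b. *)
Lemma force_density_taylor : exists2 K, 0 <= K & forall u h x y N,
  enorm (h x) <= N -> enorm (h y) <= N ->
  `|force_density (u + h) x y - force_density u x y - Dforce_density u h x y|
    <= K * N ^+ 2 * riesz x y.
Proof.
have [G G0 hG] := @potential_bound 3 isT.
have [j j0 hj] := influence_bound.
exists (j * G * 4) => [|u h x y N hx hy]; first by rewrite !mulr_ge0.
have N0 := le_trans (enorm_ge0 _) hx.
rewrite /Dforce_density /force_density strainD.
set r := enorm (y - x); set q := Num.sqrt r; set a := strain y x u; set b := strain y x h.
have [r0|r0] := eqVneq r 0.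
  rewrite /a /b ![strain y x _]strain0// /q r0 sqrtr0 !mulr0 invr0 !mulr0 !mul0r !subrr normr0.
  by rewrite !mulr_ge0 ?sqr_ge0// riesz_ge0.
have q0 : q != 0 by exact: sqrt_len_neq0.
have -> : 2 * J (r / eps) / (c * q) * derive1n 1 g (q * (a + b)) -
    2 * J (r / eps) / (c * q) * derive1n 1 g (q * a) -
    2 * J (r / eps) / c * derive1n 2 g (q * a) * b =
  2 * J (r / eps) / c * q^-1 * (derive1n 1 g (q * a + q * b) - derive1n 1 g (q * a) -
     derive1n 2 g (q * a) * (q * b)).
  rewrite invfM mulrDr !mulrBr; congr (_ - _ - _); rewrite ?mulrA//.
  by congr (_ * _); rewrite [RHS]mulrAC divfK.
have -> : j * G * 4 * N ^+ 2 * riesz x y = j * q^-1 * (G * ((2 * N) ^+ 2 / r)).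
  by rewrite rieszE -/r -/q; field; apply/andP; split.
apply: ler_normM.
  by apply: ler_normM => //; rewrite ger0_norm// invr_ge0 sqrtr_ge0.
apply: le_trans (@derive2_bound_taylor _ (derive1n 1 g) G _ _ _ _ _) _ => //.
- by move=> z; exact: (potential_derivable hg (n := 1)).
- by move=> z; exact: (potential_derivable hg (n := 2)).
by rewrite ler_wpM2l//; exact: scaled_strain_sqr.
Qed.

Let energy_densityE u x y : enorm (y - x) != 0 -> energy_density u x y =
  2^-1 * (2 * J (enorm (y - x) / eps) / c) * g (Num.sqrt (enorm (y - x)) * strain y x u).
Proof.
move=> r0; rewrite /energy_density /bond_energy -/c [(c * _)^-1]invfM.
move: (enorm (y - x)) (g _) (J _) (c^-1) r0 => r z w e r0; by field.
Qed.

Lemma energy_density_le : exists2 K, 0 <= K & forall u x y, hor x y ->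
  `|energy_density u x y| <= K * riesz x y.
Proof.
have [G G0 hG] := @potential_bound 0 isT.
have [j j0 hj] := influence_bound.
exists (2^-1 * j * G * (Num.sqrt eps * eps)) => [|u x y hy].
  by rewrite !mulr_ge0 ?sqrtr_ge0// ltW.
have [r0|r0] := eqVneq (enorm (y - x)) 0.
  rewrite /energy_density r0 mul0r normr0.
  by rewrite !mulr_ge0 ?sqrtr_ge0 ?riesz_ge0// ltW.
rewrite energy_densityE// -mulrA.
apply: (@le_trans _ _ (2^-1 * j * G)).
  rewrite mulrA; apply: ler_normM; last exact: (hG (_ * _)).
  by apply: ler_normM; rewrite ?hj// ger0_norm// invr_ge0.
rewrite -[leRHS]mulrA -[leLHS]mulr1 ler_wpM2l ?mulr_ge0 ?invr_ge0//.
have q0 := sqrt_len_neq0 r0.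
rewrite -[leLHS](mulfV q0) -mulrA ler_pM ?invr_ge0 ?sqrtr_ge0//.
  by rewrite ler_wsqrtr// ltW//; case: hy.
exact: inv_sqrt_length_le.
Qed.

(** The first-order term is the force density times the elongation, halved
    because every bond is counted from both of its ends. *)
Lemma energy_density_taylor : exists2 K, 0 <= K & forall u h x y N, hor x y ->
  enorm (h x) <= N -> enorm (h y) <= N ->
  `|energy_density (u + h) x y - energy_density u x y -
    2^-1 * (force_density u x y * dotp (h y - h x) (direction y x))|
    <= K * N ^+ 2 * riesz x y.
Proof.
have [G G0 hG] := @potential_bound 2 isT.
have [j j0 hj] := influence_bound.
exists (2^-1 * j * G * 4 * Num.sqrt eps) => [|u h x y N hy hx hy'].
  by rewrite !mulr_ge0 ?sqrtr_ge0.
have N0 := le_trans (enorm_ge0 _) hx.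
have [r0|r0] := eqVneq (enorm (y - x)) 0.
  have -> : dotp (h y - h x) (direction y x) = 0.
    by rewrite len0// -[X in dotp _ X](scale0r 0) dotpZr mul0r.
  rewrite /energy_density !r0 !mul0r !mulr0 !subrr normr0.
  by rewrite !mulr_ge0 ?sqr_ge0 ?sqrtr_ge0 ?riesz_ge0.
rewrite !energy_densityE// strainD.
have q0 := sqrt_len_neq0 r0.
have rq : enorm (y - x) = Num.sqrt (enorm (y - x)) ^+ 2 by rewrite sqr_sqrtr// enorm_ge0.
have el : dotp (h y - h x) (direction y x) =
    Num.sqrt (enorm (y - x)) * (Num.sqrt (enorm (y - x)) * strain y x h).
  by rewrite mulrA -expr2 -rq strainE mulrA mulfV// mul1r.
rewrite el /force_density [(c * _)^-1]invfM.
have sq := scaled_strain_sqr hx hy'; move: sq; rewrite mulrDr.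
move: (inv_length_le hy); set r := enorm (y - x) in rq r0 *.
move: (hj (r / eps)); set Jc := 2 * J _ / c.
set q := Num.sqrt r in q0 rq *.
set a := q * strain y x u; set b := q * strain y x h => hJc hr hb.
have -> : 2^-1 * Jc * g (a + b) - 2^-1 * Jc * g a -
    2^-1 * (2 * J (r / eps) * (c^-1 * q^-1) * derive1n 1 g a * (q * b)) =
    2^-1 * Jc * (g (a + b) - g a - derive1n 1 g a * b).
  have -> : 2 * J (r / eps) * (c^-1 * q^-1) * derive1n 1 g a * (q * b) =
     Jc * (derive1n 1 g a * b) * (q^-1 * q) by rewrite /Jc; ring.
  by rewrite mulVf// mulr1; ring.
apply: (@le_trans _ _ (2^-1 * j * (G * ((2 * N) ^+ 2 * (Num.sqrt eps * riesz x y))))); last first.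
  by rewrite le_eqVlt; apply/orP; left; apply/eqP; ring.
apply: ler_normM.
  by apply: ler_normM => //; rewrite ger0_norm// invr_ge0.
apply: le_trans (@derive2_bound_taylor _ g G _ _ _ _ _) _ => //.
- by move=> z; exact: (potential_derivable hg (n := 0)).
- by move=> z; exact: (potential_derivable hg (n := 1)).
rewrite ler_wpM2l// (le_trans hb)// ler_wpM2l//.
by rewrite sqr_ge0.
Qed.

Let two_fields (u v : field) : Linf Om u -> Linf Om v ->
  {ae leb, forall x, Om x -> [set x | enorm (u x) <= normoo Om u /\ enorm (v x) <= normoo Om v] x}.
Proof.
move=> hu hv; apply: filterS2 (normoo_ess hu) (normoo_ess hv) => x h1 h2 Ox /=.
by split; [exact: h1|exact: h2].
Qed.

Let Lsub := Linf_subspace Om.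

Lemma force_bond_le : exists2 K, 0 <= K & forall u, bond_le Om eps K (force_density u).
Proof.
have [K K0 hK] := force_density_le; exists K => // u.
by apply: aeW => x Ox; apply: aeW => y hy; exact: hK.
Qed.

Lemma Dforce_bond_le : exists2 K, 0 <= K & forall u v, Linf Om v ->
  bond_le Om eps (K * normoo Om v) (Dforce_density u v).
Proof.
have [K K0 hK] := Dforce_density_le; exists K => // u v hv.
apply: ae_bond (normoo_ess hv) _ => x y Ox hy vx vy; exact: hK.
Qed.

Lemma force_Linf u : measurable_fun Om u -> Linf Om (force g J Om eps u).
Proof.
move=> mu; have [K K0 hK] := force_bond_le; rewrite force_bond.
by apply: (bond_field_Linf d2 mOm fOm _ K0 (hK u)); exact: measurable_force_density.
Qed.

Lemma Dforce_in_V u v : measurable_fun Om u -> Linf Om v -> in_V Om (Dforce g J Om eps u v).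
Proof.
move=> mu hv; have [K K0 hK] := Dforce_bond_le; rewrite Dforce_bond.
apply: (bond_field_in_V d2 mOm fOm bOm _ _ (hK u v hv)).
- by apply: measurable_Dforce_density => //; case: hv.
- by rewrite mulr_ge0 ?normoo_ge0.
- by move=> x y; exact: Dforce_density_sym.
Qed.

Lemma Dforce_bounded : exists2 K, 0 <= K & forall u v, measurable_fun Om u -> Linf Om v ->
  normoo Om (Dforce g J Om eps u v) <= K * normoo Om v.
Proof.
have [K K0 hK] := Dforce_bond_le.
exists (d%:R * (K * riesz_bound Om)) => [|u v mu hv].
  by rewrite !mulr_ge0// riesz_bound_ge0.
have KN : 0 <= K * normoo Om v by rewrite mulr_ge0 ?normoo_ge0.
have -> : d%:R * (K * riesz_bound Om) * normoo Om v = field_bound Om (K * normoo Om v).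
  by rewrite /field_bound; ring.
apply: normoo_le; first by rewrite field_bound_ge0.
apply: (bond_field_ess d2 mOm fOm _ KN (hK u v hv)).
by apply: measurable_Dforce_density => //; case: hv.
Qed.

Lemma Dforce_linear u a v w : measurable_fun Om u -> Linf Om v -> Linf Om w ->
  eqae Om (Dforce g J Om eps u (a *: v + w)) (a *: Dforce g J Om eps u v + Dforce g J Om eps u w).
Proof.
move=> mu hv hw; have [K K0 hK] := Dforce_bond_le.
have mD z : Linf Om z -> bond_measurable Om (Dforce_density u z).
  by case=> mz _; exact: measurable_Dforce_density.
have mv := mD v hv; have mw := mD w hw.
apply: filterS2 (hK u v hv) (hK u w hw) => x hx1 hx2 Ox.
rewrite -[RHS]/(a *: Dforce g J Om eps u v x + Dforce g J Om eps u w x) !Dforce_bond.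
rewrite -(bond_fieldZ d2 mOm fOm a mv Ox (hx1 Ox)).
have hx1' : bond_le_at Om eps (`|a| * (K * normoo Om v)) (fun x y => a * Dforce_density u v x y) x.
  by apply: filterS (hx1 Ox) => y h hy; rewrite normrM -mulrA ler_wpM2l// h.
rewrite -(bond_fieldD d2 mOm fOm _ mw Ox hx1' (hx2 Ox)); last first.
  by apply: measurable_funM => //; exact: measurable_cst.
congr (bond_field Om eps _ x); apply/funext => x'; apply/funext => y'.
by rewrite /Dforce_density strainD strainZ; ring.
Qed.

Lemma Dforce_lipschitz : exists2 K, 0 <= K & forall u w v, Linf Om u -> Linf Om w -> Linf Om v ->
  normoo Om (Dforce g J Om eps u v - Dforce g J Om eps w v) <= K * (normoo Om (u - w) * normoo Om v).
Proof.
have [K K0 hK] := Dforce_density_lipschitz; have [K' K'0 hK'] := Dforce_bond_le.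
exists (d%:R * (K * riesz_bound Om)) => [|u w v hu hw hv].
  by rewrite !mulr_ge0// riesz_bound_ge0.
have huw := subspaceB Lsub hu hw.
have [mu mw mv] : [/\ measurable_fun Om u, measurable_fun Om w & measurable_fun Om v].
  by case: hu hw hv => [? _] [? _] [? _].
have m1 := measurable_Dforce_density mu mv; have m2 := measurable_Dforce_density mw mv.
have m2' : bond_measurable Om (fun x y => - 1 * Dforce_density w v x y).
  by apply: measurable_funM => //; exact: measurable_cst.
pose k x y := Dforce_density u v x y + - 1 * Dforce_density w v x y.
have kb : bond_le Om eps (K * (normoo Om (u - w) * normoo Om v)) k.
  apply: ae_bond (two_fields huw hv) _ => x y Ox hy [ux vx] [uy vy].
  by rewrite /k mulN1r; exact: hK.
set N := normoo Om (u - w) * normoo Om v in kb *.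
have KN : 0 <= K * N by rewrite !mulr_ge0 ?normoo_ge0.
have -> : d%:R * (K * riesz_bound Om) * N = field_bound Om (K * N).
  by rewrite /field_bound; ring.
apply: normoo_le; first by rewrite field_bound_ge0.
have kes := bond_field_ess d2 mOm fOm (measurable_funD m1 m2') KN kb.
apply: ess_le_eqae kes.
apply: filterS2 (hK' u v hv) (hK' w v hv) => x hx1 hx2 Ox.
have hx2' : bond_le_at Om eps (K' * normoo Om v) (fun x y => - 1 * Dforce_density w v x y) x.
  by apply: filterS (hx2 Ox) => y h hy; rewrite mulN1r normrN h.
rewrite (bond_fieldD d2 mOm fOm m1 m2' Ox (hx1 Ox) hx2').
by rewrite (bond_fieldZ d2 mOm fOm _ m2 Ox (hx2 Ox)) scaleN1r.
Qed.

Theorem force_frechet : exists2 K, 0 <= K & forall u h, Linf Om u -> Linf Om h ->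
  normoo Om (force g J Om eps (u + h) - force g J Om eps u - Dforce g J Om eps u h)
    <= K * normoo Om h ^+ 2.
Proof.
have [K K0 hK] := force_density_taylor; have [K' K'0 hK'] := Dforce_bond_le.
have [K2 K20 hK2] := force_bond_le.
exists (d%:R * (K * riesz_bound Om)) => [|u h hu hh].
  by rewrite !mulr_ge0// riesz_bound_ge0.
have [muh _] := subspaceD Lsub hu hh.
have [mu mh] : measurable_fun Om u /\ measurable_fun Om h by case: hu hh => [? _] [? _].
have m1 := measurable_force_density muh; have m2 := measurable_force_density mu.
have m3 := measurable_Dforce_density mu mh.
have mN (f : 'rV[R]_d -> 'rV[R]_d -> R) : bond_measurable Om f -> bond_measurable Om (fun x y => - 1 * f x y).
  by move=> mf; apply: measurable_funM => //; exact: measurable_cst.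
have bN (f : 'rV[R]_d -> 'rV[R]_d -> R) L x : bond_le_at Om eps L f x -> bond_le_at Om eps L (fun x y => - 1 * f x y) x.
  by apply: filterS => y h' hy; rewrite mulN1r normrN h'.
pose k x y := force_density (u + h) x y + - 1 * force_density u x y + - 1 * Dforce_density u h x y.
set N := normoo Om h.
have kb : bond_le Om eps (K * N ^+ 2) k.
  apply: ae_bond (normoo_ess hh) _ => x y Ox hy hx hy'.
  by rewrite /k !mulN1r; exact: hK.
have KN : 0 <= K * N ^+ 2 by rewrite mulr_ge0 ?sqr_ge0.
have -> : d%:R * (K * riesz_bound Om) * N ^+ 2 = field_bound Om (K * N ^+ 2).
  by rewrite /field_bound; ring.
apply: normoo_le; first by rewrite field_bound_ge0.
have mk := measurable_funD (measurable_funD m1 (mN _ m2)) (mN _ m3).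
apply: ess_le_eqae (bond_field_ess d2 mOm fOm mk KN kb).
have h1 := hK2 (u + h); have h2 := hK2 u.
apply: filterS3 (hK' u h hh) h1 h2 => x hx3 hx1 hx2 Ox.
have hx12 : bond_le_at Om eps (K2 + K2) (fun x y => force_density (u + h) x y + - 1 * force_density u x y) x.
  apply: filterS2 (hx1 Ox) (hx2 Ox) => y {}h1 {}h2 hy.
  by rewrite mulN1r mulrDl; apply: le_trans (ler_normB _ _) (lerD (h1 hy) (h2 hy)).
rewrite (bond_fieldD d2 mOm fOm (measurable_funD m1 (mN _ m2)) (mN _ m3) Ox hx12 (bN _ _ _ (hx3 Ox))).
rewrite (bond_fieldD d2 mOm fOm m1 (mN _ m2) Ox (hx1 Ox) (bN _ _ _ (hx2 Ox))).
rewrite (bond_fieldZ d2 mOm fOm _ m2 Ox (hx2 Ox)) (bond_fieldZ d2 mOm fOm _ m3 Ox (hx3 Ox)).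
by rewrite !scaleN1r.
Qed.

(** The energy has the force as its gradient: integrating the first-order term of
    energy_density_taylor gives exactly the work of the force, by
    bond_field_pairing. *)
Theorem PD_frechet : exists2 K, 0 <= K & forall u h, Linf Om u -> Linf Om h ->
  `|PD g J Om eps (u + h) - PD g J Om eps u - L2pairing Om (force g J Om eps u) h|
    <= K * normoo Om h ^+ 2.
Proof.
have [K K0 hK] := energy_density_taylor; have [K1 K10 hK1] := energy_density_le.
have [K2 K20 hK2] := force_bond_le.
exists (K * riesz_bound Om * fine (leb Om)) => [|u h hu hh].
  by rewrite !mulr_ge0// ?riesz_bound_ge0// fine_ge0.
have [muh _] := subspaceD Lsub hu hh.
have [mu mh] : measurable_fun Om u /\ measurable_fun Om h by case: hu hh => [? _] [? _].
have mf := measurable_force_density mu.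
have m1 := measurable_energy_density muh; have m2 := measurable_energy_density mu.
rewrite force_bond (bond_field_pairing d2 mOm fOm mf K20 (hK2 u) (force_density_sym u) hh).
rewrite !PD_bond.
pose f x y := force_density u x y * dotp (h y - h x) (direction y x).
have m3 : bond_measurable Om f.
  by apply: measurable_funM => //; exact: measurable_elongation.
have N0 : 0 <= normoo Om h by exact: normoo_ge0.
have f0 : 0 <= K2 * (2 * normoo Om h) by rewrite !mulr_ge0.
have fb : bond_le Om eps (K2 * (2 * normoo Om h)) f.
  have hB : {ae leb, forall x, Om x ->
      {ae leb, forall y, hor x y -> enorm (h y - h x) <= 2 * normoo Om h}}.
    apply: ae_bond (normoo_ess hh) _.
    move=> x y Ox hy hx hy'; rewrite (le_trans (ler_enormB _ _))//.
    by rewrite mulr2n mulrDl !mul1r lerD.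
  have hA := hK2 u; apply: filterS2 hA hB => x hx1 hx2 Ox.
  apply: filterS2 (hx1 Ox) (hx2 Ox) => y h1 h2 hy.
  rewrite /f [leRHS]mulrAC; apply: ler_normM; first exact: h1.
  rewrite (le_trans (cauchy_schwarz _ _))// -[leRHS]mulr1.
  by rewrite ler_pM ?enorm_ge0 ?enorm_direction ?h2.
have e1 w : bond_le Om eps K1 (energy_density w).
  by apply: aeW => x Ox; apply: aeW => y hy; exact: hK1.
have mN (a : R) (k : 'rV[R]_d -> 'rV[R]_d -> R) : bond_measurable Om k -> bond_measurable Om (fun x y => a * k x y).
  by move=> mk; apply: measurable_funM => //; exact: measurable_cst.
have bN (a : R) (k : 'rV[R]_d -> 'rV[R]_d -> R) L : bond_le Om eps L k ->
    bond_le Om eps (`|a| * L) (fun x y => a * k x y).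
  apply: filterS => x h1 Ox; apply: filterS (h1 Ox) => y h2 hy.
  by rewrite normrM -mulrA ler_wpM2l// h2.
have bD (k1 k2 : 'rV[R]_d -> 'rV[R]_d -> R) L1 L2 : bond_le Om eps L1 k1 -> bond_le Om eps L2 k2 ->
    bond_le Om eps (L1 + L2) (fun x y => k1 x y + k2 x y).
  apply: filterS2 => x h1 h2 Ox; apply: filterS2 (h1 Ox) (h2 Ox) => y {}h1 {}h2 hy.
  by rewrite mulrDl; apply: le_trans (ler_normD _ _) (lerD (h1 hy) (h2 hy)).
have -> : bond_int2 Om eps (energy_density (u + h)) - bond_int2 Om eps (energy_density u) -
    2^-1 * bond_int2 Om eps f =
  bond_int2 Om eps (fun x y => energy_density (u + h) x y + - 1 * energy_density u x y + - 2^-1 * f x y).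
  rewrite (bond_int2D d2 mOm fOm (measurable_funD m1 (mN _ _ m2)) (mN _ _ m3) _ _
     (bD _ _ _ _ (e1 _) (bN _ _ _ (e1 u))) (bN _ _ _ fb)); rewrite ?addr_ge0 ?mulr_ge0//.
  rewrite (bond_int2D d2 mOm fOm m1 (mN _ _ m2) _ _ (e1 _) (bN _ _ _ (e1 u))) ?mulr_ge0//.
  rewrite (bond_int2Z d2 mOm fOm _ m2 K10 (e1 u)) (bond_int2Z d2 mOm fOm _ m3 f0 fb).
  by rewrite mulN1r mulNr.
rewrite [leRHS]mulrAC [X in X * _]mulrAC.
apply: (bond_int2_le d2 mOm fOm).
- exact: measurable_funD (measurable_funD m1 (mN _ _ m2)) (mN _ _ m3).
- by rewrite mulr_ge0 ?sqr_ge0.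
- apply: ae_bond (normoo_ess hh) _ => x y Ox hy hx hy'.
  by rewrite mulN1r mulNr; exact: hK.
Qed.

Lemma eqae_PD u v : measurable_fun Om u -> measurable_fun Om v -> eqae Om u v ->
  PD g J Om eps u = PD g J Om eps v.
Proof.
move=> mu mv uv; apply: eq_bond_int2 => //; try exact: measurable_energy_density.
apply: ae_bond uv _ => x y Ox hy ux uy.
by rewrite /energy_density /bond_energy /strain ux uy.
Qed.

End operators.

(** * Calculus on a closed time interval *)

Section calculus_on_segment.
Context {R : realType} (T : R).
Implicit Types (phi psi : R -> R) (s t e del : R).

(** f s <= o(1) as s -> t within [0, T]; the value at s = t is included. *)
Definition small_near t (f : R -> R) : Prop := forall e, 0 < e ->
  exists2 del, 0 < del &
    forall s, 0 <= s <= T -> `|s - t| < del -> f s <= e.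

Lemma small_nearP t (f : R -> R) : small_near t f <->
  (forall e, 0 < e -> \forall s \near within `[0, T]%classic (nbhs t), f s <= e).
Proof.
split=> h e /h.
  move=> [del del0 hd]; apply/nbhs_ballP; exists del => // s ts.
  by rewrite /= in_itv /= => sT; apply: hd => //; rewrite distrC.
move=> /nbhs_ballP[del /= del0 hd]; exists del => // s sT st.
by apply: hd; rewrite /ball /= ?in_itv//= distrC.
Qed.

(** The value at t is replaced by 0 to express a limit over s <> t. *)
Lemma small_near_dnbhsP t (f : R -> R) : small_near t (fun s => if s == t then 0 else f s) <->
  (forall e, 0 < e -> \forall s \near within `[0, T]%classic t^', f s <= e).
Proof.
split=> h e /[dup] e0 /h.
  move=> [del del0 hd]; apply/nbhs_ballP; exists del => // s ts /= st.
  rewrite /= in_itv /= => sT; have := hd s sT; rewrite (negPf st) distrC; exact.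
move=> /nbhs_ballP[del /= del0 hd]; exists del => // s sT st.
case: eqVneq => [_|snt]; first exact: ltW.
by apply: hd => //=; rewrite /ball /= ?in_itv//= distrC.
Qed.

Lemma small_near_le t f1 f2 : small_near t f1 ->
  (exists2 del, 0 < del & forall s, 0 <= s <= T -> `|s - t| < del -> f2 s <= f1 s) ->
  small_near t f2.
Proof.
move=> h [d1 d10 h1] e /h[d2 d20 h2]; exists (Num.min d1 d2); first by rewrite lt_min d10.
by move=> s sT; rewrite lt_min => /andP[s1 s2]; rewrite (le_trans (h1 s sT s1))// h2.
Qed.

Lemma small_nearD t f1 f2 : small_near t f1 -> small_near t f2 ->
  small_near t (fun s => f1 s + f2 s).
Proof.
move=> h1 h2 e e0; have e20 : 0 < e / 2 by rewrite divr_gt0.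
have [d1 d10 hd1] := h1 _ e20; have [d2 d20 hd2] := h2 _ e20.
exists (Num.min d1 d2); first by rewrite lt_min d10.
move=> s sT; rewrite lt_min => /andP[s1 s2].
by rewrite (splitr e) lerD ?hd1 ?hd2.
Qed.

Lemma small_nearZ t f (a : R) : 0 <= a -> small_near t f -> small_near t (fun s => a * f s).
Proof.
move=> a0 h e e0; have a1 : 0 < a + 1 by rewrite ltr_pwDr.
have [del del0 hd] := h (e / (a + 1)) (divr_gt0 e0 a1).
exists del => // s sT st; apply: (@le_trans _ _ (a * (e / (a + 1)))).
  by rewrite ler_wpM2l// hd.
by rewrite mulrCA ger_pMr// ler_pdivrMr// mul1r lerDl.
Qed.

Lemma small_near_dist t : small_near t (fun s => `|s - t|).
Proof. by move=> e e0; exists e => // s _ /ltW. Qed.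

Definition continuous_on_segment phi : Prop :=
  forall t, 0 <= t <= T -> small_near t (fun s => `|phi s - phi t|).

Lemma continuous_on_subsegment phi b : continuous_on_segment phi -> 0 < b -> b < T ->
  {within `[0, b], continuous phi}.
Proof.
move=> hphi b0 bT; apply/continuous_within_itvP => //; split.
- move=> x; rewrite in_itv /= => /andP[x0 xb].
  apply/cvgrPdist_le => e e0.
  have xT : 0 <= x <= T by rewrite !ltW// (lt_trans xb).
  have [del del0 hd] := hphi x xT e e0.
  have m0 : 0 < Num.min del (Num.min x (T - x)).
    by rewrite !lt_min del0 x0 subr_gt0 (lt_trans xb).
  apply/nbhs_ballP; exists (Num.min del (Num.min x (T - x))) => // s.
  rewrite /ball /= !lt_min => /and3P[h1 h2 h3].
  rewrite distrC; apply: hd; last by rewrite distrC.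
  by apply/andP; move: h2 h3; rewrite !ltr_norml; split; lra.
- apply/cvgrPdist_le => e e0.
  have [|del del0 hd] := hphi 0 _ e e0; first by rewrite lexx ltW// (lt_trans b0).
  have m0 : 0 < Num.min del T by rewrite lt_min del0 (lt_trans b0).
  apply/nbhs_ballP; exists (Num.min del T) => // s.
  rewrite /ball /= !lt_min => /andP[h1 h2] s0.
  rewrite distrC; apply: hd; last by rewrite distrC.
  by apply/andP; move: h2; rewrite !ltr_norml; split; lra.
- apply/cvgrPdist_le => e e0.
  have [|del del0 hd] := hphi b _ e e0; first by rewrite !ltW.
  have m0 : 0 < Num.min del b by rewrite lt_min del0.
  apply/nbhs_ballP; exists (Num.min del b) => // s.
  rewrite /ball /= !lt_min => /andP[h1 h2] s0.
  rewrite distrC; apply: hd; last by rewrite distrC.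
  by apply/andP; move: h2; rewrite !ltr_norml; split; lra.
Qed.

Lemma integral_of_derivative phi psi t :
  continuous_on_segment phi -> continuous_on_segment psi ->
  (forall t, 0 < t < T -> small_near t
     (fun s => if s == t then 0 else `|(s - t)^-1 * (phi s - phi t) - psi t|)) ->
  0 < t < T ->
  \int[lebesgue_measure]_(tau in `[0, t]) psi tau = phi t - phi 0.
Proof.
move=> cphi cpsi dphi /andP[t0 tT].
have hder x : x \in `]0, t[ -> is_derive (x : R) (1 : R) phi (psi x).
  rewrite in_itv /= => /andP[x0 xt]; have xT := lt_trans xt tT.
  have lim : h^-1 *: (phi (h *: (1 : R) + x) - phi x) @[h --> 0^'] --> psi x.
    apply/cvgrPdist_le => e e0.
    have xT' : 0 < x < T by rewrite x0.
    have [del del0 hd] := dphi x xT' e e0.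
    have m0 : 0 < Num.min del (Num.min x (T - x)) by rewrite !lt_min del0 x0 subr_gt0.
    apply/nbhs_ballP; exists (Num.min del (Num.min x (T - x))) => // h.
    rewrite /ball /= sub0r normrN !lt_min => /and3P[h1 h2 h3] hn0.
    have := hd (h *: (1 : R) + x); rewrite [h *: _]mulr1 addrK.
    rewrite -subr_eq0 addrK (negPf hn0) distrC; apply => //.
    by apply/andP; move: h2 h3; rewrite !ltr_norml; split; lra.
  split; first by apply/cvg_ex; exists (psi x).
  exact: cvg_lim lim.
have := @continuous_FTC2 R psi phi 0 t t0 (continuous_on_subsegment cpsi t0 tT).
have [_ c0 ct] := (continuous_within_itvP phi t0).1 (continuous_on_subsegment cphi t0 tT).
rewrite /Rintegral => -> //.
- by split => // x xi; have [] := hder x xi.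
- by move=> x xi; rewrite derive1E; have [] := hder x xi.
Qed.

End calculus_on_segment.

(** * The solution path *)

Section norm_paths.
Context {R : realType} {d : nat} (Om : set 'rV[R]_d) (T : R).
Local Notation leb := (@lebesgue_rV R d).
Local Notation field := ('rV[R]_d -> 'rV[R]_d).
Local Notation normoo := (normoo Om).
Implicit Types (p : R -> field).

Let on_segment (F : set_system R) (FF : Filter F) (P : set R) :
  (forall s, 0 <= s <= T -> P s) -> within `[0, T]%classic F P.
Proof.
move=> hP; apply: (@filterE _ F FF [set s | `[0, T]%classic s -> P s]) => s hs.
by apply: hP; move: hs; rewrite /= in_itv.
Qed.

Lemma path_continuousP p : (forall t, 0 <= t <= T -> Linf Om (p t)) ->
  path_continuous Om T p <->
  (forall t, 0 <= t <= T -> small_near T t (fun s => normoo (p s - p t))).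
Proof.
move=> Lp.
have Lsub t : 0 <= t <= T ->
    \forall s \near within `[0, T]%classic (nbhs t), Linf Om (p s - p t).
  move=> tT; apply: on_segment => s sT.
  exact: subspaceB (Linf_subspace Om) _ _ (Lp s sT) (Lp t tT).
split=> h t tT; have := h t tT.
  by move=> /(linf_norm_cvg0P _ (Lsub t tT)) /small_nearP.
by move=> /small_nearP /(linf_norm_cvg0P _ (Lsub t tT)).
Qed.

Lemma path_derivativeP p t v : (forall t, 0 <= t <= T -> Linf Om (p t)) -> Linf Om v ->
  0 <= t <= T ->
  path_derivative Om T p t v <->
  small_near T t (fun s => if s == t then 0 else normoo ((s - t)^-1 *: (p s - p t) - v)).
Proof.
move=> Lp Lv tT; have hL := Linf_subspace Om.
have Lsub : \forall s \near within `[0, T]%classic t^', Linf Om ((s - t)^-1 *: (p s - p t) - v).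
  apply: on_segment => s sT.
  apply: (subspaceB hL) => //; apply: (subspaceZ hL).
  by apply: (subspaceB hL); exact: Lp.
split; first by move=> /(linf_norm_cvg0P _ Lsub) /small_near_dnbhsP.
by move=> /small_near_dnbhsP /(linf_norm_cvg0P _ Lsub).
Qed.

Lemma eqae_normoo (u v : field) : Linf Om u -> Linf Om v -> eqae Om u v -> normoo u = normoo v.
Proof.
move=> hu hv uv; apply/eqP; rewrite eq_le; apply/andP; split; apply: normoo_le;
  rewrite ?normoo_ge0//.
  by apply: ess_le_eqae (normoo_ess hv); exact: eqae_sym.
exact: ess_le_eqae uv (normoo_ess hu).
Qed.

End norm_paths.

(** For small eta the quadratic term is at most eta / 2 and is moved to the
    left-hand side. *)
Lemma absorb_quadratic (R : realType) (M K eta beta D r : R) :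
  0 <= M -> 0 <= K -> 0 <= eta -> D <= beta + r -> eta <= M * D ->
  r <= K * eta ^+ 2 -> eta <= 1 / (2 * (M * K + 1)) -> eta <= 2 * (M * beta).
Proof.
move=> M0 K0 eta0 h1 h2 h3 h4; have MK0 : 0 <= M * K by rewrite mulr_ge0.
rewrite ler_pdivlMr ?mulr_gt0 ?ltr_pwDr// in h4.
have h5 : M * K * eta <= 2^-1 by lra.
have h6 : M * D <= M * (beta + K * eta ^+ 2).
  by rewrite ler_wpM2l// (le_trans h1)// lerD2l.
have h7 : M * K * eta * eta <= 2^-1 * eta by rewrite ler_wpM2r.
have h8 : M * (beta + K * eta ^+ 2) = M * beta + M * K * eta * eta by ring.
by rewrite h8 in h6; lra.
Qed.

Lemma absorb_small_factor (R : realType) (M K eta beta D W0 om : R) :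
  0 <= M -> 0 <= K -> 0 <= eta -> 0 <= om -> om <= M * D ->
  D <= K * eta * (om + W0) + beta -> eta <= 1 / (2 * (M * K + 1)) ->
  om <= 2 * (M * (K * W0 * eta + beta)).
Proof.
move=> M0 K0 eta0 om0 h1 h2 h3; have MK0 : 0 <= M * K by rewrite mulr_ge0.
rewrite ler_pdivlMr ?mulr_gt0 ?ltr_pwDr// in h3.
have h4 : M * K * eta <= 2^-1 by lra.
have h5 : M * K * eta * om <= 2^-1 * om by rewrite ler_wpM2r.
have h6 : M * D <= M * (K * eta * (om + W0) + beta) by rewrite ler_wpM2l.
have h7 : M * (K * eta * (om + W0) + beta) =
  M * K * eta * om + M * (K * W0 * eta + beta) by ring.
by rewrite h7 in h6; lra.
Qed.

Section linearization.
Context {R : realType} {d : nat}.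
Hypothesis d2 : (1 < d)%N.
Context (g J : R -> R) (Om : set 'rV[R]_d) (eps : R).
Local Notation leb := (@lebesgue_rV R d).
Hypotheses (hg : potential g) (hJ : influence_function J).
Hypotheses (mOm : measurable Om) (fOm : (leb Om < +oo)%E) (bOm : bounded_set Om).
Hypothesis eps0 : 0 < eps.
Local Notation field := ('rV[R]_d -> 'rV[R]_d).
Local Notation normoo := (normoo Om).
Local Notation V := (in_V Om).
Local Notation L := (force g J Om eps).
Local Notation DL := (Dforce g J Om eps).
Implicit Types (u v w h : field).

Let VL u : V u -> Linf Om u. Proof. by case. Qed.
Let VM u : V u -> measurable_fun Om u. Proof. by case=> -[]. Qed.
Let hL := Linf_subspace Om.

Let DL_Linf u v : V u -> V v -> Linf Om (DL u v).
Proof. by move=> Vu Vv; apply: VL; exact: (Dforce_in_V d2 eps hg hJ mOm fOm bOm (VM Vu) (VL Vv)). Qed.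

Let V0 : V 0. Proof. exact: (subspace0 (in_V_subspace mOm fOm bOm)). Qed.

Lemma Dforce0 u : V u -> eqae Om (DL u 0) 0.
Proof.
move=> Vu; have hD := DL_Linf Vu V0.
have [K K0 hK] := Dforce_bounded d2 eps hg hJ mOm fOm.
rewrite -[DL u 0]subr0; apply/normoo_eqae; first by rewrite !subr0.
apply/eqP; rewrite eq_le normoo_ge0 andbT !subr0.
by rewrite (le_trans (hK u 0 (VM Vu) (VL V0)))// (seminorm0 hL (Linf_seminorm Om)) mulr0.
Qed.

Lemma DforceZB u a v w : V u -> V v -> V w ->
  eqae Om (DL u (a *: v - w)) (a *: DL u v - DL u w).
Proof.
move=> Vu Vv Vw.
have Vav : V (a *: v) by exact: (subspaceZ (in_V_subspace mOm fOm bOm)).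
have e1 := Dforce_linear d2 eps hg hJ mOm fOm (- 1) (VM Vu) (VL Vw) (VL Vav).
have e2 := Dforce_linear d2 eps hg hJ mOm fOm a (VM Vu) (VL Vv) (VL V0).
move: e1 e2 (Dforce0 Vu); rewrite addr0 scaleN1r [- w + _]addrC.
move: (DL u (a *: v - w)) (DL u w) (DL u (a *: v)) (DL u v) (DL u 0) => f1 f2 f3 f4 f5.
apply: filterS3 => x e1 e2 e3 Ox; rewrite e1//.
rewrite -[LHS]/(- 1 *: f2 x + f3 x) e2// -[X in _ + X]/(a *: f4 x + f5 x) e3//.
by rewrite addr0 scaleN1r addrC.
Qed.

Theorem Dforce_inverse_bounded u : V u -> invertible_on_V Om (DL u) ->
  exists2 M, 0 <= M & forall w, V w -> normoo w <= M * normoo (DL u w).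
Proof.
move=> Vu inv.
have [K K0 hK] := Dforce_bounded d2 eps hg hJ mOm fOm.
have hV := in_V_subspace mOm fOm bOm.
apply: (bounded_inverse hV (in_V_seminorm Om) (in_V_complete mOm fOm bOm) _ K0).
- by move=> w Vw; exact: (Dforce_in_V d2 eps hg hJ mOm fOm bOm (VM Vu) (VL Vw)).
- by move=> w Vw; apply: hK => //; [exact: VM|exact: VL].
- move=> a v w Vv Vw.
  have Vavw : V (a *: v + w) by apply: (subspaceD hV) => //; exact: (subspaceZ hV).
  apply/normoo_eqae; last by apply: (Dforce_linear d2 eps hg hJ mOm fOm) => //; [exact: VM|exact: VL|exact: VL].
  apply: (subspaceB hL); first exact: DL_Linf.
  by apply: (subspaceD hL); [apply: (subspaceZ hL)|]; exact: DL_Linf.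
- move=> w Vw w0.
  have [z [Vz _ uz]] := inv 0 V0.
  have z0 := uz 0 V0 (Dforce0 Vu).
  have DLw : Linf Om (DL u w) by exact: DL_Linf.
  have zw : eqae Om w z.
    by apply: uz => //; apply/normoo_eqae; rewrite subr0.
  rewrite -[w]subr0; apply/normoo_eqae; first by rewrite subr0; exact: VL.
  exact: eqae_trans zw (eqae_sym z0).
- move=> v Vv; have [w [Vw wv _]] := inv v Vv; exists w => //.
  by apply/normoo_eqae => //; apply: (subspaceB hL); [exact: DL_Linf|exact: VL].
Qed.

Lemma inverse_on_VP u v : V u -> V v -> invertible_on_V Om (DL u) ->
  V (inverse_on_V Om (DL u) v) /\ eqae Om (DL u (inverse_on_V Om (DL u) v)) v.
Proof.
move=> Vu Vv inv; rewrite /inverse_on_V.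
have [w [Vw wv _]] := inv v Vv.
have := @xgetPex _ 0 [set w | V w /\ eqae Om (DL u w) v].
by apply; exists w.
Qed.

Section solution_path.
Context (T : R) (b b_t u : R -> field).
Hypotheses (Vb : forall t, 0 <= t <= T -> V (b t))
  (Vb_t : forall t, 0 <= t <= T -> V (b_t t))
  (Vu : forall t, 0 <= t <= T -> V (u t)).
Hypothesis sol : forall t, 0 <= t <= T -> eqae Om (L (u t)) (b t).
Hypothesis inv : forall t, 0 <= t <= T -> invertible_on_V Om (DL (u t)).
Hypothesis cu : forall t, 0 <= t <= T -> small_near T t (fun s => normoo (u s - u t)).
Hypothesis db : forall t, 0 <= t <= T ->
  small_near T t (fun s => if s == t then 0 else normoo ((s - t)^-1 *: (b s - b t) - b_t t)).
Hypothesis cb_t : forall t, 0 <= t <= T -> small_near T t (fun s => normoo (b_t s - b_t t)).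

Let hV := in_V_subspace mOm fOm bOm.
Let sN := Linf_seminorm Om.
Let Lu t : 0 <= t <= T -> Linf Om (u t). Proof. by move=> /Vu[]. Qed.
Let Lb t : 0 <= t <= T -> Linf Om (b t). Proof. by move=> /Vb[]. Qed.
Let Lb_t t : 0 <= t <= T -> Linf Om (b_t t). Proof. by move=> /Vb_t[]. Qed.

Definition velocity t : field := inverse_on_V Om (DL (u t)) (b_t t).

Let Vw t : 0 <= t <= T -> V (velocity t).
Proof. by move=> tT; have [] := inverse_on_VP (Vu tT) (Vb_t tT) (inv tT). Qed.

Let Dw t : 0 <= t <= T -> eqae Om (DL (u t) (velocity t)) (b_t t).
Proof. by move=> tT; have [] := inverse_on_VP (Vu tT) (Vb_t tT) (inv tT). Qed.

Let normoo0 : normoo 0 = 0. Proof. exact: (seminorm0 hL sN). Qed.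

(** With b differentiable at t, the increment is eventually below
    (|b_t| + 1) |s - t|. *)
Lemma load_lipschitz t : 0 <= t <= T -> exists2 B, 0 <= B &
  exists2 del, 0 < del & forall s, 0 <= s <= T -> `|s - t| < del ->
    normoo (b s - b t) <= B * `|s - t|.
Proof.
move=> tT; have [del del0 hd] := db tT ltr01.
exists (1 + normoo (b_t t)); first by rewrite addr_ge0// normoo_ge0.
exists del => // s sT st; have := hd s sT st; case: eqVneq => [->|snt] h.
  by rewrite subrr normoo0 mulr_ge0// addr_ge0// normoo_ge0.
have Lbs := subspaceB hL (Lb sT) (Lb tT).
have Lq := subspaceZ hL (s - t)^-1 Lbs.
have -> : b s - b t = (s - t) *: (((s - t)^-1 *: (b s - b t) - b_t t) + b_t t).
  by rewrite subrK scalerA divff ?scale1r// subr_eq0.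
rewrite (le_trans (seminormZ sN _ _)) ?subrK// mulrC ler_wpM2r//.
rewrite -[X in normoo X](subrK (b_t t)).
by rewrite (le_trans (seminormD sN (subspaceB hL Lq (Lb_t tT)) (Lb_t tT)))// lerD2r.
Qed.

(** The force at u(s) and u(t) may be replaced by the loads they balance. *)
Lemma linearization_error : exists2 K, 0 <= K & forall s t, 0 <= s <= T -> 0 <= t <= T ->
  normoo ((b s - b t) - DL (u t) (u s - u t)) <= K * normoo (u s - u t) ^+ 2.
Proof.
have [K K0 hK] := force_frechet d2 hg hJ mOm fOm eps0; exists K => // s t sT tT.
have Lh := subspaceB hL (Lu sT) (Lu tT).
have := hK (u t) (u s - u t) (Lu tT) Lh; rewrite subrKC.
congr (_ <= _); apply: eqae_normoo.
- apply: (subspaceB hL); last by apply: DL_Linf; [exact: Vu|apply: (subspaceB hV); [exact: (Vu sT)|exact: (Vu tT)]].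
  apply: (subspaceB hL); apply: (force_Linf d2 hg hJ mOm fOm eps0).
    exact: VM (Vu sT).
  exact: VM (Vu tT).
- apply: (subspaceB hL); last by apply: DL_Linf; [exact: Vu|apply: (subspaceB hV); [exact: (Vu sT)|exact: (Vu tT)]].
  by apply: (subspaceB hL); [exact: (Lb sT)|exact: (Lb tT)].
move: (sol sT) (sol tT).
move: (L (u s)) (L (u t)) (DL _ _) => f1 f2 f3.
apply: filterS2 => x es et Ox.
by rewrite -[LHS]/(f1 x - f2 x - f3 x) es// et.
Qed.

(** The bounded inverse turns linearization_error into
    |h| <= M (|b s - b t| + K |h|^2) for h = u s - u t; by continuity of u the
    quadratic term is absorbed. *)
Lemma solution_lipschitz t : 0 <= t <= T -> exists2 B, 0 <= B &
  exists2 del, 0 < del & forall s, 0 <= s <= T -> `|s - t| < del ->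
    normoo (u s - u t) <= B * `|s - t|.
Proof.
move=> tT; have [M M0 hM] := Dforce_inverse_bounded (Vu tT) (inv tT).
have [K K0 hK] := linearization_error.
have [B B0 [d1 d10 hB]] := load_lipschitz tT.
have MK0 : 0 < 2 * (M * K + 1) by rewrite mulr_gt0// ltr_pwDr// mulr_ge0.
have [d3 d30 hu] := cu tT (divr_gt0 ltr01 MK0).
exists (2 * (M * B)); first by rewrite !mulr_ge0.
exists (Num.min d1 d3); first by rewrite lt_min d10.
move=> s sT; rewrite lt_min => /andP[s1 s3].
have := hB s sT s1; have := hu s sT s3; have := hK s t sT tT.
have Vh := subspaceB hV (Vu sT) (Vu tT).
have := hM _ Vh.
have Lbs := subspaceB hL (Lb sT) (Lb tT).
have LD := DL_Linf (Vu tT) Vh.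
have := seminormB hL sN Lbs (subspaceB hL Lbs LD).
rewrite opprB addrCA subrr addr0.
move=> h1 h2 h3 h4 h5.
have := absorb_quadratic M0 K0 (normoo_ge0 _ _) h1 h2 h3 h4.
move=> h; apply: (le_trans h); rewrite -[leRHS]mulrA -[in leRHS]mulrA.
by rewrite ler_wpM2l// ler_wpM2l.
Qed.

(** The inverse of the linearization is applied to its value on the difference
    quotient minus the velocity, which is the difference quotient of b minus b_t,
    up to the linearization error divided by s - t. *)
Lemma velocity_derivative t : 0 <= t <= T -> small_near T t (fun s =>
  if s == t then 0 else normoo ((s - t)^-1 *: (u s - u t) - velocity t)).
Proof.
move=> tT; have [M M0 hM] := Dforce_inverse_bounded (Vu tT) (inv tT).
have [K K0 hK] := linearization_error.
have [B B0 [d1 d10 hB]] := solution_lipschitz tT.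
apply: (small_near_le (f1 := fun s =>
  M * ((if s == t then 0 else normoo ((s - t)^-1 *: (b s - b t) - b_t t)) + K * B ^+ 2 * `|s - t|))).
  apply: small_nearZ => //; apply: small_nearD; first exact: db.
  by apply: small_nearZ; [rewrite mulr_ge0 ?sqr_ge0|exact: small_near_dist].
exists d1 => // s sT s1; have := hB s sT s1.
case: eqVneq => [->|snt] hBs.
  by rewrite add0r subrr normr0 !mulr0.
have st0 : 0 < `|s - t| by rewrite normr_gt0 subr_eq0.
set a := (s - t)^-1.
have Vh := subspaceB hV (Vu sT) (Vu tT).
have Vq := subspaceB hV (subspaceZ hV a Vh) (Vw tT).
apply: le_trans (hM _ Vq) _; rewrite ler_wpM2l//.
have LDh := DL_Linf (Vu tT) Vh.
have Lbs := subspaceB hL (Lb sT) (Lb tT).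
have L1 := subspaceB hL (subspaceZ hL a Lbs) (Lb_t tT).
have L2 := subspaceB hL Lbs LDh.
have -> : normoo (DL (u t) (a *: (u s - u t) - velocity t)) =
    normoo ((a *: (b s - b t) - b_t t) - a *: ((b s - b t) - DL (u t) (u s - u t))).
  apply: eqae_normoo; [exact: DL_Linf (Vu tT) Vq|exact: (subspaceB hL L1 (subspaceZ hL a L2))|].
  have := Dw tT; have := DforceZB a (Vu tT) Vh (Vw tT).
  move: (DL (u t) _) (DL (u t) (velocity t)) (DL (u t) _) => f1 f2 f3.
  apply: filterS2 => x e1 e2 Ox; rewrite e1// -[LHS]/(a *: f1 x - f2 x) e2//.
  rewrite -[RHS]/(a *: (b s x - b t x) - b_t t x - a *: (b s x - b t x - f1 x)).
  by rewrite [a *: (_ - f1 x)]scalerBr opprB [RHS]addrC subrKA.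
apply: le_trans (seminormB hL sN L1 (subspaceZ hL a L2)) _.
rewrite lerD2l (le_trans (seminormZ sN _ L2))//.
apply: (@le_trans _ _ (`|a| * (K * (B * `|s - t|) ^+ 2))).
  rewrite ler_wpM2l// (le_trans (hK _ _ sT tT))// ler_wpM2l//.
  by rewrite ler_pXn2r// nnegrE ?normoo_ge0// mulr_ge0.
rewrite /a normfV le_eqVlt; apply/orP; left; apply/eqP.
by field; rewrite gt_eqF.
Qed.

(** Subtracting the equations of the two velocities leaves the increment of b_t
    and the effect of changing the linearization, which is at most K |u s - u t|
    times |velocity s| <= |velocity s - velocity t| + |velocity t|. *)
Lemma velocity_continuous t : 0 <= t <= T ->
  small_near T t (fun s => normoo (velocity s - velocity t)).
Proof.
move=> tT; have [M M0 hM] := Dforce_inverse_bounded (Vu tT) (inv tT).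
have [K K0 hK] := Dforce_lipschitz d2 eps hg hJ mOm fOm.
have MK0 : 0 < 2 * (M * K + 1) by rewrite mulr_gt0// ltr_pwDr// mulr_ge0.
have [d1 d10 hu] := cu tT (divr_gt0 ltr01 MK0).
apply: (small_near_le (f1 := fun s =>
  2 * (M * (K * normoo (velocity t) * normoo (u s - u t) + normoo (b_t s - b_t t))))).
  apply: small_nearZ => //; apply: small_nearZ => //; apply: small_nearD; last exact: cb_t.
  by apply: small_nearZ; [rewrite mulr_ge0 ?normoo_ge0|exact: cu].
exists d1 => // s sT s1.
have Vd := subspaceB hV (Vw sT) (Vw tT).
have Ldb := subspaceB hL (Lb_t sT) (Lb_t tT).
have L1 := subspaceB hL (DL_Linf (Vu tT) (Vw sT)) (DL_Linf (Vu sT) (Vw sT)).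
have e : normoo (DL (u t) (velocity s - velocity t)) =
    normoo ((DL (u t) (velocity s) - DL (u s) (velocity s)) + (b_t s - b_t t)).
  apply: eqae_normoo; [exact: DL_Linf (Vu tT) Vd|exact: (subspaceD hL L1 Ldb)|].
  have := Dw tT; have := Dw sT; have := DforceZB 1 (Vu tT) (Vw sT) (Vw tT).
  rewrite scale1r.
  move: (DL (u t) _) (DL (u t) (velocity t)) (DL (u t) _) (DL (u s) _) => f1 f2 f3 f4.
  apply: filterS3 => x e1 e2 e3 Ox; rewrite e1// -[LHS]/(1 *: f1 x - f2 x) e3//.
  rewrite -[RHS]/(f1 x - f4 x + (b_t s x - b_t t x)) e2//.
  by rewrite scale1r addrA subrK.
apply: (@absorb_small_factor _ M K _ _ (normoo (DL (u t) (velocity s - velocity t)))) (hu s sT s1) => //;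
  rewrite ?normoo_ge0//; first exact: hM.
rewrite e (le_trans (seminormD sN L1 Ldb))// lerD2r.
apply: le_trans (hK _ _ _ (Lu tT) (Lu sT) (VL (Vw sT))) _.
rewrite (seminorm_distC hL sN (Lu tT) (Lu sT)) mulrA ler_wpM2l//.
  by rewrite mulr_ge0 ?normoo_ge0.
rewrite -[X in normoo X <= _](subrK (velocity t)).
exact: (seminormD sN (VL Vd) (VL (Vw tT))).
Qed.

(** The work of the load minus the stored energy; the sign is chosen so that the
    derivative is the pairing of u with b_t. *)
Definition released_energy t : R := L2pairing Om (u t) (b t) - PD g J Om eps (u t).

Let mu := fine (leb Om).
Let mu0 : 0 <= mu. Proof. by rewrite fine_ge0. Qed.

(** The first variation of the energy is the force, hence the load at time t, so
    the terms linear in u s - u t cancel and only the change of the load survives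
    to first order. *)
Lemma released_energy_increment : exists2 K, 0 <= K & forall s t,
  0 <= s <= T -> 0 <= t <= T ->
  `|released_energy s - released_energy t - L2pairing Om (u t) (b s - b t)| <=
    K * normoo (u s - u t) ^+ 2 + normoo (u s - u t) * normoo (b s - b t) * mu.
Proof.
have [K K0 hK] := PD_frechet d2 hg hJ mOm fOm eps0; exists K => // s t sT tT.
have Lh := subspaceB hL (Lu sT) (Lu tT).
have Ld := subspaceB hL (Lb sT) (Lb tT).
have := hK (u t) (u s - u t) (Lu tT) Lh; rewrite subrKC.
have -> : L2pairing Om (L (u t)) (u s - u t) = L2pairing Om (b t) (u s - u t).
  apply: (eqae_L2pairing _ _ _ _ (sol tT)) => //.
  - by have [] := force_Linf d2 hg hJ mOm fOm eps0 (VM (Vu tT)).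
  - exact: VM (Vb tT).
  - exact: VM (subspaceB hV (Vu sT) (Vu tT)).
move=> hPD.
have -> : released_energy s - released_energy t - L2pairing Om (u t) (b s - b t) =
  L2pairing Om (u s - u t) (b s - b t) -
  (PD g J Om eps (u s) - PD g J Om eps (u t) - L2pairing Om (b t) (u s - u t)).
  have Ls := Lu sT; have Lt := Lu tT; have Lbs := Lb sT; have Lbt := Lb tT.
  rewrite (L2pairingC _ (b t)) !(L2pairingBl mOm fOm Ls Lt)//.
  rewrite (L2pairingBr mOm fOm Ls Lbs Lbt) (L2pairingBr mOm fOm Lt Lbs Lbt) /released_energy.
  move: (PD _ _ _ _ (u s)) (PD _ _ _ _ (u t)) (L2pairing _ (u s) (b s))
    (L2pairing _ (u s) (b t)) (L2pairing _ (u t) (b s)) (L2pairing _ (u t) (b t)).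
  by move=> ? ? ? ? ? ?; ring.
apply: le_trans (ler_normB _ _) _; rewrite addrC lerD//.
exact: L2pairing_le.
Qed.

Lemma released_energy_lipschitz t : 0 <= t <= T -> exists2 K, 0 <= K &
  exists2 del, 0 < del & forall s, 0 <= s <= T -> `|s - t| < del ->
    `|released_energy s - released_energy t - L2pairing Om (u t) (b s - b t)|
      <= K * `|s - t| ^+ 2.
Proof.
move=> tT; have [K K0 hK] := released_energy_increment.
have [B B0 [d1 d10 hB]] := solution_lipschitz tT.
have [B' B'0 [d3 d30 hB']] := load_lipschitz tT.
exists (K * B ^+ 2 + B * B' * mu).
  by rewrite addr_ge0// ?mulr_ge0// ?sqr_ge0// mulr_ge0.
exists (Num.min d1 d3); first by rewrite lt_min d10.
move=> s sT; rewrite lt_min => /andP[s1 s3].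
apply: le_trans (hK _ _ sT tT) _; rewrite mulrDl lerD//.
  rewrite -mulrA -exprMn ler_wpM2l// ler_pXn2r ?nnegrE ?normoo_ge0 ?mulr_ge0//.
  exact: hB.
rewrite [leRHS]mulrAC ler_wpM2r//.
have -> : B * B' * `|s - t| ^+ 2 = (B * `|s - t|) * (B' * `|s - t|) by ring.
by rewrite ler_pM ?normoo_ge0// ?hB ?hB'.
Qed.

Lemma released_energy_continuous : continuous_on_segment T released_energy.
Proof.
move=> t tT; have [K K0 [d1 d10 hK]] := released_energy_lipschitz tT.
have [B B0 [d3 d30 hB]] := load_lipschitz tT.
apply: (small_near_le (f1 := fun s => (K + normoo (u t) * B * mu) * `|s - t|)).
  apply: small_nearZ; last exact: small_near_dist.
  by rewrite addr_ge0// !mulr_ge0 ?normoo_ge0.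
exists (Num.min 1 (Num.min d1 d3)); first by rewrite !lt_min ltr01 d10.
move=> s sT; rewrite !lt_min => /and3P[s1 s2 s3].
rewrite -[X in `|X|](subrK (L2pairing Om (u t) (b s - b t))).
rewrite (le_trans (ler_normD _ _))// mulrDl lerD//.
  rewrite (le_trans (hK s sT s2))// ler_wpM2l// expr2 -[leRHS]mul1r ler_wpM2r// ltW//.
have Ld := subspaceB hL (Lb sT) (Lb tT).
apply: le_trans (L2pairing_le mOm fOm (Lu tT) Ld) _.
rewrite [leRHS]mulrAC ler_wpM2r// -[leRHS]mulrA ler_wpM2l ?normoo_ge0//.
exact: hB.
Qed.

Lemma released_energy_derivative t : 0 <= t <= T -> small_near T t (fun s =>
  if s == t then 0 else
  `|(s - t)^-1 * (released_energy s - released_energy t) - L2pairing Om (u t) (b_t t)|).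
Proof.
move=> tT; have [K K0 [d1 d10 hK]] := released_energy_lipschitz tT.
apply: (small_near_le (f1 := fun s => K * `|s - t| + normoo (u t) * mu *
   (if s == t then 0 else normoo ((s - t)^-1 *: (b s - b t) - b_t t)))).
  apply: small_nearD; first by apply: small_nearZ => //; exact: small_near_dist.
  by apply: small_nearZ; [rewrite mulr_ge0 ?normoo_ge0|exact: db].
exists d1 => // s sT s1; have := hK s sT s1.
case: eqVneq => [->|snt] hKs; first by rewrite subrr normr0 !mulr0 addr0.
have st0 : 0 < `|s - t| by rewrite normr_gt0 subr_eq0.
set a := (s - t)^-1.
have Ld := subspaceB hL (Lb sT) (Lb tT).
have Lq := subspaceZ hL a Ld.
have -> : a * (released_energy s - released_energy t) - L2pairing Om (u t) (b_t t) =
  a * (released_energy s - released_energy t - L2pairing Om (u t) (b s - b t)) +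
  L2pairing Om (u t) (a *: (b s - b t) - b_t t).
  rewrite (L2pairingBr mOm fOm (Lu tT) Lq (Lb_t tT)).
  rewrite (L2pairingC _ (u t) (a *: _)) (L2pairingZl mOm fOm a Ld (Lu tT)) (L2pairingC _ (b s - b t)).
  move: (released_energy s) (released_energy t) (L2pairing _ _ _) (L2pairing _ _ (b_t t)).
  by move=> ? ? ? ?; ring.
rewrite (le_trans (ler_normD _ _))// lerD//; last first.
  rewrite (le_trans (L2pairing_le mOm fOm (Lu tT) (subspaceB hL Lq (Lb_t tT))))//.
  by rewrite mulrAC.
rewrite normrM; apply: (@le_trans _ _ (`|a| * (K * `|s - t| ^+ 2))).
  by rewrite ler_wpM2l.
rewrite /a normfV le_eqVlt; apply/orP; left; apply/eqP.
by field; rewrite gt_eqF.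
Qed.

Lemma power_continuous : continuous_on_segment T (fun t => L2pairing Om (u t) (b_t t)).
Proof.
move=> t tT.
have [d1 d10 hb] := cb_t tT ltr01.
apply: (small_near_le (f1 := fun s => (normoo (b_t t) + 1) * mu * normoo (u s - u t) +
   normoo (u t) * mu * normoo (b_t s - b_t t))).
  apply: small_nearD; apply: small_nearZ; rewrite ?mulr_ge0 ?addr_ge0 ?normoo_ge0//.
    exact: cu.
  exact: cb_t.
exists d1 => // s sT s1.
have Lh := subspaceB hL (Lu sT) (Lu tT).
have Ld := subspaceB hL (Lb_t sT) (Lb_t tT).
have -> : L2pairing Om (u s) (b_t s) - L2pairing Om (u t) (b_t t) =
  L2pairing Om (u s - u t) (b_t s) + L2pairing Om (u t) (b_t s - b_t t).
  rewrite (L2pairingBr mOm fOm (Lu tT) (Lb_t sT) (Lb_t tT)).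
  rewrite (L2pairingBl mOm fOm (Lu sT) (Lu tT) (Lb_t sT)).
  by rewrite addrA subrK.
rewrite (le_trans (ler_normD _ _))// lerD//.
  rewrite (le_trans (L2pairing_le mOm fOm Lh (Lb_t sT)))//.
  rewrite -[leLHS]mulrA [leRHS]mulrC ler_wpM2l ?normoo_ge0// ler_wpM2r//.
  rewrite -[X in normoo X <= _](subrK (b_t t)) addrC.
  rewrite (le_trans (seminormD sN (Lb_t tT) Ld))// lerD2l; exact: hb.
by rewrite (le_trans (L2pairing_le mOm fOm (Lu tT) Ld))// mulrAC.
Qed.

Theorem energy_balance t : 0 < t < T ->
  \int[lebesgue_measure]_(tau in `[0, t]) L2pairing Om (u tau) (b_t tau) =
  released_energy t - released_energy 0.
Proof.
apply: integral_of_derivative.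
- exact: released_energy_continuous.
- exact: power_continuous.
- by move=> s /andP[s0 sT]; apply: released_energy_derivative; rewrite !ltW.
Qed.

End solution_path.
End linearization.

Lemma op_norm_ge0 (R : realType) (d : nat) (Om : set 'rV[R]_d)
    (A : ('rV[R]_d -> 'rV[R]_d) -> 'rV[R]_d -> 'rV[R]_d) : 0 <= op_norm Om A.
Proof.
rewrite /op_norm; set S := image _ _.
have S0 x : S x -> 0 <= x.
  by move=> [v _ <-]; rewrite divr_ge0// fine_ge0// linf_norm_ge0.
have [[[x Sx] ubS]|nS] := pselect (has_sup S); last by rewrite sup_out.
exact: le_trans (S0 _ Sx) (ub_le_sup ubS Sx).
Qed.

Lemma const_path_continuous (R : realType) (d : nat) (Om : set 'rV[R]_d) (T : R)
  (v : 'rV[R]_d -> 'rV[R]_d) : path_continuous Om T (fun=> v).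
Proof.
move=> t tT; rewrite subrr (_ : linf_norm Om 0 = 0%E); first exact: cvg_cst.
apply/eqP; rewrite eq_le linf_norm_ge0 andbT.
by apply/linf_normP => //; apply: aeW => x _; rewrite enorm0.
Qed.

(** Both u0 and v are constant solution paths for the constant load b0, so the
    uniqueness of solution paths identifies them. *)
Lemma initial_state_unique (R : realType) (d : nat) (g J : R -> R) (C : R)
  (hC : inverse_function_constant d g J C)
  (Om : set 'rV[R]_d) (hOm : cone_domain Om) (eps : R) (heps : 0 < eps)
  (u0 b0 v : 'rV[R]_d -> 'rV[R]_d) (hbase : base_state g J Om eps u0 b0) :
  in_ball Om u0 (solution_radius g J Om eps C u0) v ->
  eqae Om (force g J Om eps v) b0 -> eqae Om v u0.
Proof.
move=> hv fv; have [C0 hC'] := hC; have [Vu0 Vb0 fu0 _ _] := hbase.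
have r0 : 0 <= solution_radius g J Om eps C u0.
  by rewrite divr_ge0 ?mulr_ge0 ?powR_ge0 ?op_norm_ge0// ltW.
have ball0 w r : in_V Om w -> 0 <= r -> in_ball Om w r w.
  move=> Vw r0'; split => //; rewrite subrr; apply/linf_normP => //.
  by apply: aeW => x _; rewrite enorm0.
have [|w [_ uw]] := hC' Om eps u0 b0 hOm heps hbase 1 (fun=> b0) ltr01.
  split; first exact: const_path_continuous.
  by move=> t _; apply: ball0 => //; rewrite divr_ge0// mulr_ge0// op_norm_ge0.
have t0 : 0 <= (0 : R) <= 1 by rewrite lexx ler01.
have e1 : eqae Om v (w 0).
  by apply: (uw (fun=> v)) t0; split; [exact: const_path_continuous|].
have e2 : eqae Om u0 (w 0).
  apply: (uw (fun=> u0)) t0; split; first exact: const_path_continuous.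
  by move=> t _; split => //; exact: ball0.
exact: eqae_trans e1 (eqae_sym e2).
Qed.

Theorem theorem7 (R : realType) (d : nat) (hd : d = 2%N \/ d = 3%N)
  (g J : R -> R) (hg : potential g) (hJ : influence_function J)
  (C : R) (hC : inverse_function_constant d g J C)
  (Om : set 'rV[R]_d) (hOm : cone_domain Om)
  (eps : R) (heps : 0 < eps) (T : R) (hT : 0 < T)
  (u0 b0 : 'rV[R]_d -> 'rV[R]_d) (hbase : base_state g J Om eps u0 b0)
  (b b_t : R -> 'rV[R]_d -> 'rV[R]_d)
  (hb : load_path g J Om eps C T u0 b0 b)
  (hb0 : eqae Om (b 0) b0)
  (hb_t : forall t : R, 0 <= t <= T ->
     in_V Om (b_t t) /\ path_derivative Om T b t (b_t t))
  (hb_t_cont : path_continuous Om T b_t)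
  (u : R -> 'rV[R]_d -> 'rV[R]_d)
  (hu : displacement_path g J Om eps C T u0 b u)
  (hinv : forall v, in_ball Om u0 (solution_radius g J Om eps C u0) v ->
     invertible_on_V Om (Dforce g J Om eps v)) :
  (exists u_t : R -> 'rV[R]_d -> 'rV[R]_d,
     [/\ forall t : R, 0 <= t <= T ->
           Linf Om (u_t t) /\ path_derivative Om T u t (u_t t),
         path_continuous Om T u_t
       & forall t : R, 0 <= t <= T ->
           eqae Om (inverse_on_V Om (Dforce g J Om eps (u t)) (b_t t)) (u_t t)])
  /\
  (forall t : R, 0 < t < T ->
     PD g J Om eps (u t) - L2pairing Om (u t) (b t) =
     PD g J Om eps u0 - L2pairing Om u0 b0
       - \int[lebesgue_measure]_(tau in `[0, t]) L2pairing Om (u tau) (b_t tau)).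
Proof.
have d2 : (1 < d)%N by case: hd => ->.
have [oOm _ _ bOm _] := hOm.
have [mOm fOm] := bounded_open_finite oOm bOm.
have [cb Bb] := hb; have [cu Bu] := hu.
have Vb t : 0 <= t <= T -> in_V Om (b t) by move=> /Bb[].
have Vu t : 0 <= t <= T -> in_V Om (u t) by move=> /Bu[[]].
have Vb_t t : 0 <= t <= T -> in_V Om (b_t t) by move=> /hb_t[].
have sol t : 0 <= t <= T -> eqae Om (force g J Om eps (u t)) (b t) by move=> /Bu[].
have inv t : 0 <= t <= T -> invertible_on_V Om (Dforce g J Om eps (u t)).
  by move=> /Bu[/hinv].
have Lb t : 0 <= t <= T -> Linf Om (b t) by move=> /Vb[].
have Lu t : 0 <= t <= T -> Linf Om (u t) by move=> /Vu[].
have Lb_t t : 0 <= t <= T -> Linf Om (b_t t) by move=> /Vb_t[].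
have cu' := (path_continuousP Lu).1 cu.
have cb_t := (path_continuousP Lb_t).1 hb_t_cont.
have db t : 0 <= t <= T -> small_near T t (fun s =>
    if s == t then 0 else normoo Om ((s - t)^-1 *: (b s - b t) - b_t t)).
  by move=> tT; exact: (path_derivativeP Lb (Lb_t t tT) tT).1 (hb_t t tT).2.
pose w := velocity g J Om eps b_t u.
have Vw t : 0 <= t <= T -> in_V Om (w t).
  by move=> tT; have [] := inverse_on_VP (Vu t tT) (Vb_t t tT) (inv t tT).
have Lw t : 0 <= t <= T -> Linf Om (w t) by move=> /Vw[].
split.
  exists w; split.
  - move=> t tT; split; first exact: Lw.
    apply: (path_derivativeP Lu (Lw t tT) tT).2.
    exact: (velocity_derivative d2 hg hJ mOm fOm bOm heps Vb Vb_t Vu sol inv cu' db tT).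
  - apply: (path_continuousP Lw).2 => t tT.
    exact: (velocity_continuous d2 hg hJ mOm fOm bOm Vb_t Vu inv cu' cb_t tT).
  - by move=> t _; exact: eqae_refl.
move=> t tT.
have T0 : 0 <= (0 : R) <= T by rewrite lexx ltW.
have [Vu0 Vb0 _ _ _] := hbase.
have u00 : eqae Om (u 0) u0.
  apply: (initial_state_unique hC hOm heps hbase); first by have [] := Bu 0 T0.
  exact: eqae_trans (sol 0 T0) hb0.
have mV v : in_V Om v -> measurable_fun Om v by case=> -[].
rewrite (energy_balance d2 hg hJ mOm fOm bOm heps Vb Vb_t Vu sol inv cu' db cb_t tT).
rewrite /released_energy.
rewrite (eqae_PD eps hg hJ mOm (mV _ (Vu 0 T0)) (mV _ Vu0) u00).
rewrite (eqae_L2pairing mOm (mV _ (Vu 0 T0)) (mV _ Vu0) (mV _ (Vb 0 T0)) u00).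
rewrite (L2pairingC _ u0 (b 0)).
rewrite (eqae_L2pairing mOm (mV _ (Vb 0 T0)) (mV _ Vb0) (mV _ Vu0) hb0).
rewrite (L2pairingC _ b0 u0).
move: (PD _ _ _ _ (u t)) (PD _ _ _ _ u0) (L2pairing _ (u t) _) (L2pairing _ u0 b0).
by move=> ? ? ? ?; ring.
Qed.
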